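(* Let $\Gamma$ be a set of topological lines of the plane such that for all distinct $\gamma,\gamma'\in\Gamma$, the difference $\gamma\setminus\gamma'$ is a portion of $\gamma$. Then, for all distinct $\gamma,\gamma'\in\Gamma$, the set $$J(\gamma,\gamma'):=\overline{\gamma\,\triangle\,\gamma'}$$ (closure in $\mathbb R^2$ of the symmetric difference) is a Jordan curve. Furthermore, setting $$(\gamma,\gamma')_\Gamma:=\{\sigma\in\Gamma\setminus\{\gamma,\gamma'\}: J(\gamma,\sigma)\subset\overline{\mathrm{Int}}\,J(\gamma,\gamma')\}$$ for all distinct $\gamma,\gamma'\in\Gamma$, the ternary relation $\cdot\in(\cdot,\cdot)_\Gamma$ induces a betweenness structure on $\Gamma$, that is, there exists a strict total order $<_\Gamma$ on $\Gamma$, unique up to reversal, such that for all distinct $\gamma,\gamma',\sigma\in\Gamma$, $$\sigma\in(\gamma,\gamma')_\Gamma\iff[\gamma<_\Gamma\sigma<_\Gamma\gamma'\ \text{ or }\ \gamma'<_\Gamma\sigma<_\Gamma\gamma].$$ Finally, for all distinct $\gamma,\gamma',\sigma\in\Gamma$, $$\sigma\notin(\gamma,\gamma')_\Gamma\iff J(\gamma,\sigma)\subset\overline{\mathrm{Ext}}\,J(\gamma,\gamma').$$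
   Context: A topological line is a subset $\gamma\subset\mathbb R^2$ (with the subspace topology) for which there is a homeomorphism $\Phi:\mathbb R\to\gamma$. A portion of a topological line $\gamma$ is a subset $\pi\subset\gamma$ which, in the subspace topology of $\gamma$, is open, connected and relatively compact; equivalently, for some (hence any) homeomorphism $\Phi:\mathbb R\to\gamma$, $\Phi^{-1}(\pi)$ is a bounded open interval of $\mathbb R$ (possibly empty). A Jordan curve is a subset $J\subset\mathbb R^2$ that is the image of a continuous injection of the circle $\mathbb S^1$. $\mathrm{Int}\,J$ and $\mathrm{Ext}\,J$ denote the bounded and unbounded connected components of $\mathbb R^2\setminus J$, and $\overline{\mathrm{Int}}\,J$, $\overline{\mathrm{Ext}}\,J$ their closures. *)

(* Defs.v *)
From HB Require Import structures.
From mathcomp Require Import all_boot all_order all_algebra.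
From mathcomp Require Import all_classical all_reals all_analysis.
Import Order.TTheory GRing.Theory Num.Theory.
Import numFieldNormedType.Exports.

Set Implicit Arguments.
Unset Strict Implicit.
Unset Printing Implicit Defensive.

Local Open Scope classical_set_scope.
Local Open Scope ring_scope.

Notation plane R := (R * R)%type.

(* [Phi] is a homeomorphism onto [gamma]; only the values of its inverse [Psi]
   on [gamma] matter. *)
Definition topological_line (R : realType) (gamma : set (plane R)) : Prop :=
  exists (Phi : R -> plane R) (Psi : plane R -> R),
    [/\ continuous Phi, range Phi = gamma, cancel Phi Psi
      & {within gamma, continuous Psi}].

(* In the library, [subspace gamma] has the whole plane as carrier, with the
   points off [gamma] isolated; hence the explicit inclusion in [gamma]. *)
Definition portion (R : realType) (gamma p : set (plane R)) : Prop :=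
  [/\ p `<=` gamma, open (p : set (subspace gamma)),
      connected (p : set (subspace gamma))
    & precompact (p : set (subspace gamma))].

Definition unit_circle (R : realType) : set (plane R) :=
  [set z | z.1 ^+ 2 + z.2 ^+ 2 = 1].
Arguments unit_circle R : clear implicits.

Definition jordan_curve (R : realType) (J : set (plane R)) : Prop :=
  exists f : plane R -> plane R,
    [/\ {within unit_circle R, continuous f}, set_inj (unit_circle R) f
      & f @` unit_circle R = J].

Definition is_component (T : topologicalType) (A C : set T) : Prop :=
  exists2 x, A x & C = connected_component A x.

(* "The" (un)bounded component is a definite description: the values are
   meaningful when exactly one such component exists, as for Jordan curves. *)
Definition Int (R : realType) (J : set (plane R)) : set (plane R) :=
  xget set0 [set C | is_component (~` J) C /\ bounded_set C].

Definition Ext (R : realType) (J : set (plane R)) : set (plane R) :=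
  xget set0 [set C | is_component (~` J) C /\ ~ bounded_set C].

Definition symdiff_closure (R : realType) (gamma gamma' : set (plane R)) :
    set (plane R) :=
  closure (gamma `+` gamma').

Definition between (R : realType) (Gamma : set (set (plane R)))
    (gamma gamma' : set (plane R)) : set (set (plane R)) :=
  [set sigma | [/\ Gamma sigma, sigma <> gamma, sigma <> gamma'
    & symdiff_closure gamma sigma `<=`
        closure (Int (symdiff_closure gamma gamma'))]].

Definition strict_total_order_on (T : Type) (A : set T) (lt : T -> T -> Prop) :
    Prop :=
  [/\ forall x, A x -> ~ lt x x,
      forall x y z, A x -> A y -> A z -> lt x y -> lt y z -> lt x z
    & forall x y, A x -> A y -> x <> y -> lt x y \/ lt y x].

Definition induces_between (R : realType) (Gamma : set (set (plane R)))
    (lt : set (plane R) -> set (plane R) -> Prop) : Prop :=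
  forall gamma gamma' sigma, Gamma gamma -> Gamma gamma' -> Gamma sigma ->
    gamma <> gamma' -> gamma <> sigma -> gamma' <> sigma ->
    between Gamma gamma gamma' sigma <->
      (lt gamma sigma /\ lt sigma gamma') \/
      (lt gamma' sigma /\ lt sigma gamma).

(* Main.v *)
Require Import Defs.
From HB Require Import structures.
From mathcomp Require Import all_boot all_order all_algebra.
From mathcomp Require Import all_classical all_reals all_analysis.
From mathcomp Require Import ring lra.
Import Order.TTheory GRing.Theory Num.Theory.
Import numFieldNormedType.Exports.
Local Open Scope classical_set_scope.
Local Open Scope ring_scope.

Set Implicit Arguments.
Unset Strict Implicit.
Unset Printing Implicit Defensive.

(** The proof rests on the Jordan curve theorem and on a count of sides for
    three lines.

    The Jordan curve theorem is obtained from continuous arguments.  For a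
    compact set [K] and a point [z] off [K], [has_log K z] says that the
    argument of [x - z] has a continuous real-valued branch on [K].  Three
    facts carry everything.  A branch survives when [z] moves in a connected
    set off [K], and exists for far away [z] ([has_log_connected],
    [has_log_far]).  No branch exists for [z] in a bounded open set whose
    boundary lies in [K] ([no_log_inside], after Eilenberg).  Branches on two
    closed sets with connected intersection glue ([has_log_glue], after
    Janiszewski).  An arc carries a branch for every point off it, so it
    contains the boundary of no nonempty bounded open set disjoint from it,
    and every component of the complement of a simple closed curve has the
    whole curve as boundary ([closed_curve_boundary]).  That there is a bounded
    component ([exists_no_log]) and only one ([bounded_component_unique])
    follows by gluing branches on suitable theta-shaped sets.

    Two lines [g] and [h] of the family differ along two open arcs with the
    same pair of endpoints ([fellow_endpoint]), and these two arcs form the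
    closed curve [J g h], the closure of the symmetric difference. For three
    lines the three curves form a theta-shaped set: any two of them meet in a
    connected set ([theta_connected]), and what one of them has off another is
    connected and nonempty ([theta_arc_connected], [theta_arc_nonempty]). So
    [J a b] minus [J a c] lies entirely inside or entirely outside [J a c]; in
    the first case [b] is between [a] and [c]. Of three lines exactly one is
    between the other two ([inner_excl], [inner_some]). If [b] is between [a]
    and [c], then for any fourth line [d], [b] is between [a] and [d] or
    between [c] and [d] ([inner_split]): four lines have a point of [b] that
    lies on none of [a], [c], [d] ([exclusive_part4]), and if it were outside
    both [J a d] and [J c d], then gluing branches would put it outside [J a
    c] as well.

    These two properties of a ternary relation are enough to recover a total
    order, unique up to reversal ([betweenness_order]): the second one, with
    the first, says that every point cuts the others into at most two sides,
    and fixing one point and one of its sides orients all the others. *)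

(** * Arguments of plane vectors *)

Section Angle.
Variable R : realType.
Implicit Types (u v w : plane R) (s t : R).

(** With vectors read as complex numbers, [dot u v] and [crs u v] are the real
    and the imaginary part of the product of [v] with the conjugate of [u]. *)
Definition dot u v := u.1 * v.1 + u.2 * v.2.
Definition crs u v := u.1 * v.2 - u.2 * v.1.
Definition has_arg u t := exists2 r : R, 0 < r & u = (r * cos t, r * sin t).
(** The angle from [u] to [v], as long as it is less than a right angle. *)
Definition ang u v : R := atan (crs u v / dot u v).

(** A turn by less than a right angle changes the argument by an amount that is
    a continuous function of both vectors.  Long turns are composed of such small
    ones, so that no branch cut is ever needed. *)
Lemma has_argD u v s : has_arg u s -> 0 < dot u v -> has_arg v (s + ang u v).
Proof.
move=> [r r0 ->]; rewrite /ang /dot /crs /=.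
set t := atan _ => uv0.
have c0 : 0 < cos t by apply: cos_gt0_pihalf; rewrite atan_gtNpi2 atan_ltpi2.
have cs := cos2Dsin2 s.
pose p := cos s * v.1 + sin s * v.2; pose q := cos s * v.2 - sin s * v.1.
have p0 : 0 < p.
  rewrite -(pmulr_rgt0 _ r0) /p; move: uv0.
  by rewrite mulrDr !mulrA.
have tE : sin t = cos t * q / p.
  have : tan t = q / p.
    rewrite /t atanK /p /q -!mulrA -mulrBr -mulrDr -mulf_div divff ?mul1r //.
    exact: lt0r_neq0.
  rewrite /tan => h; rewrite -mulrA -h; field; have := lt0r_neq0 c0; done.
exists (p / cos t); first exact: divr_gt0.
have c1 : cos t != 0 by exact: lt0r_neq0.
have p1 : p != 0 by exact: lt0r_neq0.
have v1E : v.1 = p * cos s - q * sin s.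
  by rewrite -[LHS]mul1r -cs /p /q; ring.
have v2E : v.2 = p * sin s + q * cos s.
  by rewrite -[LHS]mul1r -cs /p /q; ring.
rewrite cosD sinD tE [LHS]surjective_pairing v1E v2E.
by congr pair; field; apply/andP.
Qed.

Lemma has_arg_cosB u s t : has_arg u s -> has_arg u t -> cos (s - t) = 1.
Proof.
move=> [r r0 ->] [r' r'0 [e1 e2]].
have rr' : r = r'.
  apply/eqP; rewrite -(eqrXn2 (n := 2)) ?ltW //; apply/eqP.
  have := cos2Dsin2 s; have := cos2Dsin2 t => ht hs.
  rewrite -[LHS]mulr1 -hs -[RHS]mulr1 -ht !mulrDr -!exprMn.
  by rewrite e1 e2.
move: e1 e2; rewrite -rr' cosB.
move=> /(mulfI (lt0r_neq0 r0)) -> /(mulfI (lt0r_neq0 r0)) ->.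
by rewrite -(cos2Dsin2 t) !expr2.
Qed.

Lemma sin_of_cos1 t : cos t = 1 -> sin t = 0.
Proof. by move=> c1; apply: cos1sin0; rewrite c1 normr1. Qed.

Lemma has_arg_shift u s c : has_arg u s -> cos c = 1 -> has_arg u (s + c).
Proof.
move=> [r r0 ->] c1; exists r => //.
by rewrite cosD sinD c1 (sin_of_cos1 c1) !mulr1 !mulr0 subr0 addr0.
Qed.

(** The norm is the maximum norm; the factor 1/2 makes up for the difference
    with the Euclidean norm. *)
Lemma dot_nearby u v : `|v - u| < `|u| / 2 -> 0 < dot u v.
Proof.
rewrite /dot !prod_normE /= => h.
have {h} [h1 h2] : `|v.1 - u.1| < Num.max `|u.1| `|u.2| / 2 /\
    `|v.2 - u.2| < Num.max `|u.1| `|u.2| / 2.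
  by split; apply: le_lt_trans h; rewrite le_max lexx ?orbT.
set m := Num.max _ _ in h1 h2.
have m0 : 0 < m by have := le_lt_trans (normr_ge0 _) h1; rewrite pmulr_lgt0.
have mm : m ^+ 2 <= u.1 ^+ 2 + u.2 ^+ 2.
  rewrite -[u.1 ^+ 2]real_normK ?num_real // -[u.2 ^+ 2]real_normK ?num_real //.
  by rewrite /m; case: (leP `|u.1| `|u.2|) => _; rewrite ?lerDr ?lerDl sqr_ge0.
have sq a : `|a| < m / 2 -> a ^+ 2 < m ^+ 2 / 4.
  move=> am; rewrite -real_normK ?num_real //.
  have -> : m ^+ 2 / 4 = (m / 2) ^+ 2 by field.
  by rewrite ltr_pXn2r // nnegrE // ltW // divr_gt0.
have := sq _ h1; have := sq _ h2; rewrite !expr2 in mm *; nra.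
Qed.

Lemma has_arg_exists u : u != 0 -> exists t, has_arg u t.
Proof.
move=> u0.
have d0 a : 0 < a -> has_arg (a, 0) 0.
  by move=> a0; exists a => //; rewrite cos0 sin0 mulr1 mulr0.
have d1 a : 0 < a -> has_arg (0, a) (pi / 2).
  by move=> a0; exists a => //; rewrite cos_pihalf sin_pihalf mulr1 mulr0.
have d2 a : 0 < a -> has_arg (- a, 0) pi.
  by move=> a0; exists a => //; rewrite cospi sinpi mulrN mulr1 mulr0.
have d3 a : 0 < a -> has_arg (0, - a) (- (pi / 2)).
  move=> a0; exists a => //.
  by rewrite cosN sinN cos_pihalf sin_pihalf mulrN mulr1 mulr0.
have [x0|x0|x0] := ltgtP 0 u.1.
- by eexists; apply: has_argD (d0 _ ltr01) _; rewrite /dot /= mul1r mul0r addr0.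
- eexists; apply: has_argD (d2 _ ltr01) _.
  by rewrite /dot /= mulN1r mul0r addr0 oppr_gt0.
have [y0|y0|y0] := ltgtP 0 u.2.
- by eexists; apply: has_argD (d1 _ ltr01) _; rewrite /dot /= mul1r mul0r add0r.
- eexists; apply: has_argD (d3 _ ltr01) _.
  by rewrite /dot /= mulN1r mul0r add0r oppr_gt0.
by move: u0; rewrite [u]surjective_pairing -x0 -y0 eqxx.
Qed.

(** The values of [d] are multiples of [2 * pi].  If there were two of them, the
    intermediate value theorem would provide an increment in ]0, pi], where the
    cosine is less than 1. *)
Lemma connected_two_pi (T : topologicalType) (K : set T) (d : T -> R) :
  connected K -> {within K, continuous d} -> (forall x, K x -> cos (d x) = 1) ->
  forall x y, K x -> K y -> d x = d y.
Proof.
move=> cK cd d1.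
suff lt_absurd x y : K x -> K y -> ~ d x < d y.
  move=> x y Kx Ky; have [h|h|//] := ltgtP (d x) (d y).
  - by case: (lt_absurd _ _ Kx Ky h).
  - by case: (lt_absurd _ _ Ky Kx h).
move=> Kx Ky xy.
pose e := Num.min (d y - d x) pi.
have e0 : 0 < e by rewrite lt_min subr_gt0 xy pi_gt0.
have /connected_intervalP iK := connected_continuous_connected cK cd.
have [] := iK (d x) (d y) _ _ (d x + e).
- by exists x.
- by exists y.
- by rewrite lerDl (ltW e0) /= -lerBrDl ge_min lexx.
move=> z Kz dz; have := d1 _ Kz.
rewrite dz cosD (d1 _ Kx) (sin_of_cos1 (d1 _ Kx)) mul1r mul0r subr0.
apply/eqP; rewrite lt_eqF //.
rewrite -cos0 ltr_cos //; rewrite in_itv /= ?lexx ?pi_ge0 ?(ltW e0) //=.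
by rewrite ge_min lexx orbT.
Qed.
End Angle.

(** * Lifting the argument over a square *)

Section Lift.
Variable R : realType.
Implicit Types (u v w : plane R).

Lemma cvg_plane (T : Type) (F : set_system T) (FF : Filter F) (f g : T -> R) (a b : R) :
  f @ F --> a -> g @ F --> b -> (f x, g x) @[x --> F] --> ((a, b) : plane R).
Proof. by move=> fa gb; exact: (cvg_pair fa gb). Qed.

Lemma cvg_dot (T : Type) (F : set_system T) (FF : Filter F) (f g : T -> plane R) u v :
  f @ F --> u -> g @ F --> v -> dot (f x) (g x) @[x --> F] --> dot u v.
Proof.
move=> fu gv; apply: (@cvgD _ R^o); apply: cvgM.
- by apply: cvg_comp fu _; case: u => a b; exact: cvg_fst.
- by apply: cvg_comp gv _; case: v => a b; exact: cvg_fst.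
- by apply: cvg_comp fu _; case: u => a b; exact: cvg_snd.
- by apply: cvg_comp gv _; case: v => a b; exact: cvg_snd.
Qed.

Lemma cvg_crs (T : Type) (F : set_system T) (FF : Filter F) (f g : T -> plane R) u v :
  f @ F --> u -> g @ F --> v -> crs (f x) (g x) @[x --> F] --> crs u v.
Proof.
move=> fu gv; apply: (@cvgB _ R^o); apply: cvgM.
- by apply: cvg_comp fu _; case: u => a b; exact: cvg_fst.
- by apply: cvg_comp gv _; case: v => a b; exact: cvg_snd.
- by apply: cvg_comp fu _; case: u => a b; exact: cvg_snd.
- by apply: cvg_comp gv _; case: v => a b; exact: cvg_fst.
Qed.

Lemma cvg_ang (T : Type) (F : set_system T) (FF : Filter F) (f g : T -> plane R) u v :
  f @ F --> u -> g @ F --> v -> 0 < dot u v ->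
  ang (f x) (g x) @[x --> F] --> ang u v.
Proof.
move=> fu gv uv0.
apply: (@cvg_comp _ _ _ (fun x => crs (f x) (g x) / dot (f x) (g x)) (@atan R) F
  (nbhs (crs u v / dot u v))); last exact: continuous_atan.
by apply: cvgM; [exact: cvg_crs|apply: cvgV; [exact: lt0r_neq0|exact: cvg_dot]].
Qed.

Lemma nbhs_distP (V : normedModType R) (x : V) (A : set V) :
  nbhs x A <-> exists2 e : R, 0 < e & forall y, `|x - y| < e -> A y.
Proof.
split=> [/nbhs_ballP[e /= e0 h]|[e e0 h]].
  by exists e => // y xy; apply: h; rewrite -ball_normE.
by apply/nbhs_ballP; exists e => //= y; rewrite -ball_normE; exact: h.
Qed.

(** Uniform continuity in the form needed to follow an argument: over a short
    step the vector [F] turns by less than a right angle. *)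
Lemma leash (K : set (plane R)) (F : plane R -> plane R) :
  compact K -> continuous F -> (forall x, K x -> F x != 0) ->
  exists2 d : R, 0 < d &
    forall x y, K x -> `|x - y| < d -> 0 < dot (F x) (F y).
Proof.
move=> /compact_near_coveringP cK cF F0.
have := cK R (nbhs 0^'+) (fun d x => forall y, `|x - y| < d -> 0 < dot (F x) (F y)) _.
case.
  move=> x Kx.
  have dd : 0 < dot (F x) (F x).
    rewrite /dot -!expr2; have := F0 _ Kx; case: (F x) => a b /=.
    rewrite -[0 : plane R]/(0, 0) xpair_eqE negb_and => /orP[] h.
      by rewrite ltr_wpDr ?sqr_ge0 // exprn_even_gt0.
    by rewrite ltr_wpDl ?sqr_ge0 // exprn_even_gt0.
  have : \forall p \near (x, x), 0 < dot (F p.1) (F p.2).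
    apply: (@cvgr_gt _ _ (nbhs (x, x)) _ (fun p => dot (F p.1) (F p.2))
      (dot (F x) (F x))) => //.
    apply: cvg_dot.
      by apply: (@cvg_comp _ _ _ fst F (nbhs (x, x)) (nbhs x)); [exact: cvg_fst|exact: cF].
    by apply: (@cvg_comp _ _ _ snd F (nbhs (x, x)) (nbhs x)); [exact: cvg_snd|exact: cF].
  case=> -[A B] /= [/nbhs_distP[e1 e10 hA] /nbhs_distP[e2 e20 hB]] AB.
  exists ([set y | `|x - y| < Num.min e1 e2 / 2], [set d | d < Num.min e1 e2 / 2]).
    split; last by apply: nbhs_right_lt; rewrite divr_gt0 // lt_min e10.
    by apply/nbhs_distP; exists (Num.min e1 e2 / 2) => //; rewrite divr_gt0 // lt_min e10.
  move=> [x' d] /= [xx' dd'] y x'y.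
  have m0 : 0 < Num.min e1 e2 by rewrite lt_min e10.
  have [me1 me2] : Num.min e1 e2 <= e1 /\ Num.min e1 e2 <= e2.
    by rewrite !ge_min !lexx orbT.
  apply: (AB (x', y)); split => /=.
    by apply: hA => /=; lra.
  apply: hB => /=.
  have := ler_distD x' x y; lra.
move=> e /= e0 he; exists (e / 2); first by rewrite divr_gt0.
move=> x y Kx xy; apply: (he (e / 2)) => //=.
  by rewrite sub0r normrN gtr0_norm ?divr_gt0 // ltr_pdivrMr // ltr_pMr // ltr1n.
by rewrite divr_gt0.
Qed.

Definition unit_square : set (plane R) := `[0, 1] `*` `[0, 1].

Definition clamp01 (x : R) : R := Num.max 0 (Num.min 1 x).
Lemma clamp01_cont : continuous clamp01.
Proof.
move=> x; apply: continuous_max; first exact: cvg_cst.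
by apply: continuous_min; [exact: cvg_cst|exact: cvg_id].
Qed.
Lemma clamp01_in x : clamp01 x \in `[0, 1].
Proof. by rewrite in_itv /= /clamp01 le_max lexx ge_max ler01 ge_min lexx. Qed.
Lemma clamp01_id x : x \in `[0, 1] -> clamp01 x = x.
Proof.
rewrite in_itv /= => /andP[x0 x1].
by rewrite /clamp01 (min_idPr _) // (max_idPr _).
Qed.

Lemma square_compact : compact unit_square.
Proof. by apply: compact_setX; exact: segment_compact. Qed.

(** The square is compact and star-shaped about the origin.  Walk from 0 to [v]
    in [N] equal steps, with [N] so large that [F] turns by less than a right
    angle in each step, uniformly in [v]; the sum of the [N] increments is
    continuous in [v].  Clamping the coordinates extends it to the plane. *)
Lemma square_lift (F : plane R -> plane R) :
  continuous F -> (forall v, unit_square v -> F v != 0) ->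
  exists2 th : plane R -> R, continuous th &
    forall v, unit_square v -> has_arg (F v) (th v).
Proof.
move=> cF F0.
have [d d0 hd] := leash square_compact cF F0.
have [N N0 hN] : exists2 N : nat, (0 < N)%N & N%:R^-1 < d.
  exists (Num.truncn d^-1).+1 => //.
  by rewrite invf_plt ?posrE //; exact: truncnS_gt.
have NR0 : 0 < N%:R :> R by rewrite ltr0n.
have sq0 : unit_square 0 by split; rewrite /= in_itv /= lexx ler01.
have [th0 hth0] := has_arg_exists (F0 _ sq0).
pose P k v := F ((k%:R / N%:R) *: v).
have sqk k v : (k <= N)%N -> unit_square v -> unit_square ((k%:R / N%:R) *: v).
  move=> kN [/= v1 v2]; have k0 : 0 <= k%:R / N%:R :> R by exact: divr_ge0.
  have k1 : k%:R / N%:R <= 1 :> R by rewrite ler_pdivrMr // mul1r ler_nat.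
  move: v1 v2; rewrite !in_itv /= => /andP[a1 b1] /andP[a2 b2].
  by split; rewrite /= in_itv /= mulr_ge0 //= mulr_ile1.
have Pdot k v : (k < N)%N -> unit_square v -> 0 < dot (P k v) (P k.+1 v).
  move=> kN sv; apply: hd; first by apply: sqk => //; exact: ltnW.
  rewrite -scalerBl -mulrBl -natr1 opprD addNKr mulN1r scaleNr normrN normrZ.
  rewrite gtr0_norm ?invr_gt0 //; apply: le_lt_trans hN.
  rewrite ler_piMr ?invr_ge0 ?(ltW NR0) //.
  case: sv => /=; rewrite !in_itv /= => /andP[a1 b1] /andP[a2 b2].
  by rewrite prod_normE ge_max !ger0_norm // b1.
pose th1 j v := th0 + \sum_(k < j) ang (P k v) (P k.+1 v).
have th1P j v : (j <= N)%N -> unit_square v -> has_arg (P j v) (th1 j v).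
  move=> + sv; elim: j => [|j IH] jN.
    by rewrite /P /th1 mul0r scale0r big_ord0 addr0.
  rewrite /th1 big_ord_recr /= addrA; apply: has_argD; last exact: Pdot.
  by apply: IH; exact: ltnW.
have Pc k v : P k x @[x --> v] --> P k v.
  apply: (@cvg_comp _ _ _ ( *:%R (k%:R / N%:R)) F (nbhs v)
    (nbhs ((k%:R / N%:R) *: v))); last exact: cF.
  by move=> A; apply: (@scaler_continuous _ (plane R) (k%:R / N%:R) v A).
have th1c j v : (j <= N)%N -> unit_square v -> th1 j x @[x --> v] --> th1 j v.
  move=> + sv; rewrite /th1; elim: j => [|j IH] jN.
    rewrite big_ord0 addr0.
    under eq_fun => x do rewrite big_ord0 addr0.
    exact: cvg_cst.
  rewrite big_ord_recr /= addrA.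
  under eq_fun => x do rewrite big_ord_recr /= addrA.
  apply: (@cvgD _ R^o); first by apply: IH; exact: ltnW.
  by apply: cvg_ang; [exact: Pc|exact: Pc|exact: Pdot].
pose cl v : plane R := (clamp01 v.1, clamp01 v.2).
have clsq v : unit_square (cl v) by split; exact: clamp01_in.
exists (th1 N \o cl).
  move=> v; apply: (@continuous_comp _ _ _ cl (th1 N)); last exact: th1c.
  case: v => a b; apply: cvg_plane => /=.
    apply: (@cvg_comp _ _ _ fst clamp01 (nbhs (a, b)) (nbhs a)).
      exact: cvg_fst.
    exact: clamp01_cont.
  apply: (@cvg_comp _ _ _ snd clamp01 (nbhs (a, b)) (nbhs b)).
    exact: cvg_snd.
  exact: clamp01_cont.
move=> v sv /=.
have -> : cl v = v.
  by case: v sv => a b [/= sa sb]; rewrite /cl /= !clamp01_id.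
by have := th1P _ _ (leqnn N) sv; rewrite /P divff ?lt0r_neq0 // scale1r.
Qed.
End Lift.

(** * Continuous arguments on closed sets *)

Section Log.
Variable R : realType.
Implicit Types (K U : set (plane R)) (x y z : plane R).

(** A continuous branch on [K] of the argument of [x - z], that is, of the
    imaginary part of a complex logarithm of [x - z]. *)
Definition has_log K z := exists g : plane R -> R,
  {within K, continuous g} /\ forall x, K x -> has_arg (x - z) (g x).

Lemma has_log_sub K K' z : K' `<=` K -> has_log K z -> has_log K' z.
Proof.
move=> KK' [g [cg hg]]; exists g; split; first exact: continuous_subspaceW cg.
by move=> x /KK'; exact: hg.
Qed.

(** On the intersection two branches differ by a continuous function with
    values in the multiples of [2 * pi]; as the intersection is connected, this
    is a constant, and adding it to one of the branches makes them agree. *)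
Lemma has_log_glue K1 K2 z : closed K1 -> closed K2 -> connected (K1 `&` K2) ->
  has_log K1 z -> has_log K2 z -> has_log (K1 `|` K2) z.
Proof.
move=> cl1 cl2 cK [g1 [c1 h1]] [g2 [c2 h2]].
have cd : {within K1 `&` K2, continuous (fun x => g1 x - g2 x)}.
  move=> x; apply: (@cvgB _ R^o).
    by apply: (continuous_subspaceW _ c1) => y [].
  by apply: (continuous_subspaceW _ c2) => y [].
have d1 x : (K1 `&` K2) x -> cos (g1 x - g2 x) = 1.
  by move=> [x1 x2]; exact: (has_arg_cosB (h1 _ x1) (h2 _ x2)).
have [c [c1E dE]] : exists c, cos c = 1 /\ forall x, (K1 `&` K2) x -> g1 x - g2 x = c.
  have [[x Kx]|K0] := pselect ((K1 `&` K2) !=set0).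
    exists (g1 x - g2 x); split; first exact: d1.
    by move=> y Ky; exact: connected_two_pi d1 _ _ Ky Kx.
  exists 0; split; first exact: cos0.
  by move=> x Kx; case: K0; exists x.
exists (fun x => if x \in K1 then g1 x else g2 x + c); split.
  apply: withinU_continuous => //.
    apply: (@subspace_eq_continuous _ _ _ g1) => // x; rewrite inE => xK1.
    by rewrite /from_subspace mem_set.
  apply: (@subspace_eq_continuous _ _ _ (fun x => g2 x + c)).
    move=> x; rewrite inE => xK2; rewrite /from_subspace; case: ifPn => //; rewrite inE => xK1.
    by rewrite -(dE x) // [g2 x + _]addrC subrK.
  apply/subspace_continuousP => x Kx; apply: (@cvgD _ R^o); last exact: cvg_cst.
  by move/subspace_continuousP : c2; exact.
move=> x [xK1|xK2]; first by rewrite mem_set //; exact: h1.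
case: ifPn => [|_]; first by rewrite inE; exact: h1.
by apply: has_arg_shift => //; exact: h2.
Qed.

(** The quotient of [x - z'] by [x - z] stays in the right half-plane, where the
    argument is continuous. *)
Lemma has_log_near K z z' : (forall x, K x -> `|z' - z| < `|x - z| / 2) ->
  has_log K z -> has_log K z'.
Proof.
move=> near [g [cg hg]].
have dd x : K x -> 0 < dot (x - z) (x - z').
  by move=> Kx; apply: dot_nearby; rewrite opprB addrC addrA subrK distrC near.
exists (fun x => g x + ang (x - z) (x - z')); split.
  apply/subspace_continuousP => x Kx; apply: (@cvgD _ R^o).
    by move/subspace_continuousP : cg; exact.
  apply: cvg_ang; last exact: dd.
    by apply: cvgB; [exact: cvg_within|exact: cvg_cst].
  by apply: cvgB; [exact: cvg_within|exact: cvg_cst].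
by move=> x Kx; apply: has_argD; [exact: hg|exact: dd].
Qed.

(** Seen from far away, the whole of [K] lies in one half-plane. *)
Lemma has_log_far K z M : (forall x, K x -> `|x| <= M) -> 2 * M < `|z| ->
  has_log K z.
Proof.
move=> KM Mz.
have [[x0 Kx0]|K0] := pselect (K !=set0); last first.
  exists (cst 0); split; first exact/continuous_subspaceT/cst_continuous.
  by move=> x Kx; case: K0; exists x.
have M0 : 0 <= M by apply: le_trans (KM _ Kx0).
have z0 : - z != 0 by rewrite -normr_gt0 normrN; apply: le_lt_trans Mz; rewrite mulr_ge0.
have [t ht] := has_arg_exists z0.
have dd x : K x -> 0 < dot (- z) (x - z).
  move=> Kx; apply: dot_nearby; rewrite addrK normrN ltr_pdivlMr // mulrC.
  by apply: le_lt_trans Mz; rewrite ler_pM2l // KM.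
exists (fun x => t + ang (- z) (x - z)); split.
  apply/subspace_continuousP => x Kx; apply: (@cvgD _ R^o); first exact: cvg_cst.
  apply: cvg_ang; [exact: cvg_cst| |exact: dd].
  by apply: cvgB; [exact: cvg_within|exact: cvg_cst].
by move=> x Kx; apply: has_argD; [exact: ht|exact: dd].
Qed.

Lemma connected_locally_const (T : topologicalType) (C : set T) (P : T -> Prop) :
  connected C -> (forall w, C w -> \forall u \near w, P u <-> P w) ->
  forall x y : T, C x -> C y -> P x -> P y.
Proof.
move=> cC loc x y Cx Cy Px.
suff E : C `&` [set u | P u] = C by move: Cy; rewrite -E => -[].
apply: cC.
- by exists x.
- exists (interior [set u | P u]); first exact: open_interior.
  apply/seteqP; split=> u [Cu Pu]; split=> //.
    by apply: filterS (loc _ Cu) => v [_]; exact.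
  exact: nbhs_singleton Pu.
- exists (~` interior [set u | ~ P u]); first exact/open_closedC/open_interior.
  apply/seteqP; split=> u [Cu Pu]; split=> //.
    by move=> /nbhs_singleton.
  apply: contrapT => nPu; apply: Pu.
  by apply: filterS (loc _ Cu) => v [vu _] /vu.
Qed.

(** By [has_log_near], the points off [K] with a branch form a set that is both
    open and closed off [K]. *)
Lemma has_log_connected K C z z' : closed K -> connected C -> C `&` K = set0 ->
  C z -> C z' -> has_log K z -> has_log K z'.
Proof.
move=> clK cC CK; apply: connected_locally_const => // w Cw.
have : nbhs w (~` K).
  apply: open_nbhs_nbhs; split; first exact: closed_openC.
  by move=> Kw; have : (C `&` K) w by []; rewrite CK.
move=> /nbhs_distP[e e0 he].
have hK x : K x -> e <= `|w - x|.
  by move=> Kx; rewrite leNgt; apply/negP => /he.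
apply/nbhs_distP; exists (e / 4); first by rewrite divr_gt0.
move=> u wu; split; apply: has_log_near => x Kx.
  by have := hK _ Kx; have := ler_distD u w x; rewrite [`|u - x|]distrC; lra.
by have := hK _ Kx; rewrite distrC in wu; rewrite [`|x - w|]distrC; lra.
Qed.

Lemma compact_plane_closed K : compact K -> closed K.
Proof. by apply: compact_closed; exact: norm_hausdorff. Qed.

Lemma compact_norm_bounded K : compact K -> exists M, forall x, K x -> `|x| <= M.
Proof.
move=> /compact_bounded[M [_ hM]]; exists (M + 1) => x Kx.
by apply: hM => //; rewrite ltrDl.
Qed.

Definition cis (t : R) : plane R := (cos t, sin t).
Lemma cis_cont : continuous cis.
Proof. by move=> t; apply: cvg_plane; [exact: continuous_cos|exact: continuous_sin]. Qed.

Lemma norm_cis_le1 t : `|cis t| <= 1.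
Proof. by rewrite prod_normE ge_max /= cos_max sin_max. Qed.

Lemma norm_cis_ge t : 1 / 2 <= `|cis t|.
Proof.
rewrite prod_normE le_max /=; apply: contraT; rewrite negb_or -!ltNge => /andP[a b].
have : `|cos t| ^+ 2 + `|sin t| ^+ 2 = 1.
  by rewrite !real_normK ?num_real // cos2Dsin2.
have := normr_ge0 (cos t); have := normr_ge0 (sin t).
by rewrite !expr2; nra.
Qed.

(** Eilenberg's criterion.  Suppose that there is a branch; extend it to a
    continuous function [G] on the plane by Tietze's theorem.  The map that is
    [x - z] on [U] and has argument [G] and the same modulus off [U] is
    continuous, with [z] as its only zero.  Its winding number along a circle
    about [z] does not depend on the radius.  It is 1 for small circles, which
    lie in [U], and 0 for large ones, on which [G] is a single-valued
    argument. *)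
Lemma no_log_inside U K z : open U -> U z -> compact K ->
  closure U `\` U `<=` K -> (exists M, forall x, U x -> `|x| <= M) ->
  ~ has_log K z.
Proof.
move=> oU Uz cK bdU [M hM] [g [cg hg]].
have clK := compact_plane_closed cK.
have [G [GE cG]] : exists G : plane R -> R,
    (forall x, K x -> g x = G x) /\ continuous G.
  have /compact_bounded[B [_ hB]] := continuous_compact cg cK.
  pose B1 := Num.max B 0 + 1.
  have B10 : 0 < B1 by rewrite ltr_wpDl // le_max lexx orbT.
  have [|G [GE cG _]] := @continuous_bounded_extension _ R
     (@pseudometric_normal R (plane R)) K clK (g : plane R -> R^o) B1 B10 cg.
    move=> x Kx; apply: hB; last by exists x.
    by rewrite /B1; apply: le_lt_trans (_ : Num.max B 0 < _); rewrite ?le_max ?lexx // ltrDl.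
  by exists G; split => // x Kx; apply: GE; rewrite inE.
pose rho x := Num.sqrt (dot (x - z) (x - z)).
pose H x := if x \in closure U then x - z else rho x *: cis (G x).
have HA x : closure U x -> H x = x - z by move=> Ux; rewrite /H mem_set.
have HB x : ~ U x -> H x = rho x *: cis (G x).
  move=> Ux; rewrite /H; case: ifPn => //; rewrite inE => cUx.
  have Kx : K x by apply: bdU.
  have [r r0 xz] := hg _ Kx.
  rewrite /rho xz /dot /= -GE //.
  rewrite -!expr2 !exprMn -mulrDr cos2Dsin2 mulr1 sqrtr_sqr gtr0_norm //.
have cB : continuous (fun x => x - z : plane R).
  by move=> x; apply: cvgB; [exact: cvg_id|exact: cvg_cst].
have crho : continuous rho.
  move=> x; apply: (@cvg_comp _ _ _ (fun x => dot (x - z) (x - z)) Num.sqrt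
     (nbhs x) (nbhs (dot (x - z) (x - z)))); last exact: sqrt_continuous.
  by apply: cvg_dot; exact: cB.
have cH : continuous H.
  apply/continuous_subspace_setT.
  have -> : [set: plane R] = closure U `|` ~` U.
    apply/seteqP; split => // x _; have [Ux|Ux] := pselect (U x); last by right.
    by left; exact: subset_closure.
  apply: withinU_continuous.
  - exact: closed_closure.
  - exact: open_closedC.
  - apply: (@subspace_eq_continuous _ _ _ (fun x => x - z)).
      by move=> x; rewrite inE /from_subspace => /HA ->.
    exact: continuous_subspaceT.
  - apply: (@subspace_eq_continuous _ _ _ (fun x => rho x *: cis (G x))).
      by move=> x; rewrite inE /from_subspace => /HB ->.
    apply: continuous_subspaceT => x; apply: cvgZ; first exact: crho.
    apply: (@cvg_comp _ _ _ G cis (nbhs x) (nbhs (G x))); first exact: cG.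
    exact: cis_cont.
have H0 x : x != z -> H x != 0.
  move=> xz; have [/HA ->|Ux] := pselect (closure U x); first by rewrite subr_eq0.
  rewrite HB; last by move=> /subset_closure.
  have xz0 : x - z != 0 by rewrite subr_eq0.
  have [t [r r0 E]] := has_arg_exists xz0.
  rewrite /rho E /dot /= -!expr2 !exprMn -mulrDr cos2Dsin2 mulr1 sqrtr_sqr.
  rewrite -normr_gt0 normrZ mulr_gt0 //; first by rewrite normr_id normr_gt0 gt_eqF.
  by apply: lt_le_trans (norm_cis_ge _); rewrite divr_gt0.
have /nbhs_distP[e e0 he] : nbhs z U by apply: open_nbhs_nbhs.
pose N := 2 * (`|z| + `|M|) + e.
pose e' := e / 2.
have e'0 : 0 < e' by rewrite divr_gt0.
pose pt (s t : R) : plane R := z + (e' + s * N) *: cis (2 * pi * t).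
have N0 : 0 < N by rewrite ltr_wpDl // mulr_ge0 // addr_ge0.
have pt0 s t : 0 <= s -> pt s t != z.
  move=> s0; rewrite -subr_eq0 addrAC subrr add0r -normr_gt0 normrZ mulr_gt0 //.
    by rewrite normr_gt0 gt_eqF // ltr_pwDl // mulr_ge0 // ltW.
  by apply: lt_le_trans (norm_cis_ge _); rewrite divr_gt0.
have ptU t : U (pt 0 t).
  apply: he; rewrite opprD addrA subrr sub0r normrN normrZ mul0r addr0 gtr0_norm //.
  apply: le_lt_trans (_ : e' < e).
    by rewrite ger_pMr // norm_cis_le1.
  by rewrite /e' ltr_pdivrMr // ltr_pMr // ltr1n.
have ptN t : ~ U (pt 1 t).
  move=> /hM; apply/negP; rewrite -ltNge.
  have : `|(e' + 1 * N) *: cis (2 * pi * t)| <= `|pt 1 t| + `|z|.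
    by rewrite -[X in `|X| <= _](addKr z) (le_trans (ler_normD _ _)) // normrN addrC.
  rewrite normrZ gtr0_norm; last by rewrite mul1r addr_gt0.
  have := norm_cis_ge (2 * pi * t); have := ler_norm M; rewrite /N /e' => h1 h2 h3.
  have : (e / 2 + 1 * (2 * (`|z| + `|M|) + e)) * (1 / 2) <= `|pt 1 t| + `|z|.
    apply: le_trans h3; rewrite ler_pM2l //.
    by rewrite mul1r addr_gt0.
  by lra.
(* Polar coordinates about [z], with radii from [e'], inside [U], to [e' + N],
   beyond [U]. *)
pose F (v : plane R) := H (pt v.1 v.2).
have cF : continuous F.
  move=> v; apply: (@cvg_comp _ _ _ (fun v => pt v.1 v.2) H (nbhs v)
    (nbhs (pt v.1 v.2))); last exact: cH.
  have f1 : v'.1 @[v' --> v] --> v.1 by case: (v) => a b; exact: cvg_fst.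
  have f2 : v'.2 @[v' --> v] --> v.2 by case: (v) => a b; exact: cvg_snd.
  apply: cvgD; first exact: cvg_cst.
  apply: cvgZ.
    apply: (@cvgD _ R^o); first exact: cvg_cst.
    by apply: cvgM => //; exact: cvg_cst.
  apply: (@cvg_comp _ _ _ (fun v => 2 * pi * v.2) cis (nbhs v) (nbhs (2 * pi * v.2))).
    by apply: cvgM => //; exact: cvg_cst.
  exact: cis_cont.
have F0 v : unit_square v -> F v != 0.
  case: v => s t [/=]; rewrite in_itv /= => /andP[s0 s1] _.
  by apply: H0; exact: pt0.
have [th cth hth] := square_lift cF F0.
have I0 : (0 : R) \in `[0, 1] by rewrite in_itv /= lexx ler01.
have I1 : (1 : R) \in `[0, 1] by rewrite in_itv /= lexx ler01.
have cth1 t : continuous (fun s => th (s, t)).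
  move=> s; apply: (@cvg_comp _ _ _ (fun s => (s, t)) th (nbhs s) (nbhs (s, t))).
    by apply: cvg_plane; [exact: cvg_id|exact: cvg_cst].
  exact: cth.
have cth2 s : continuous (fun t => th (s, t)).
  move=> t; apply: (@cvg_comp _ _ _ (fun t => (s, t)) th (nbhs t) (nbhs (s, t))).
    by apply: cvg_plane; [exact: cvg_cst|exact: cvg_id].
  exact: cth.
pose D s := th (s, 1) - th (s, 0).
have cD : {within `[0, 1], continuous D}.
  by apply: continuous_subspaceT => s; apply: (@cvgB _ R^o); exact: cth1.
have D01 : D 0 = D 1.
  apply: (connected_two_pi (@segment_connected R 0 1) cD) => // s sI.
  apply: (@has_arg_cosB _ (F (s, 1))); first by apply: hth.
  have -> : F (s, 1) = F (s, 0).
    rewrite /F /pt /= /cis mulr1 mulr0 cos0 sin0.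
    by rewrite mulr_natl cos2pi sin2pi.
  by apply: hth.
have segconst (a : R -> R) s : s \in `[0, 1] -> continuous a ->
    (forall t, t \in `[0, 1] -> has_arg (F (s, t)) (a t)) -> D s = a 1 - a 0.
  move=> sI ca ha.
  have E : th (s, 1) - a 1 = th (s, 0) - a 0.
    apply: (@connected_two_pi R R `[0, 1] (fun t => th (s, t) - a t)
      (@segment_connected R 0 1)) => //.
      by apply: continuous_subspaceT => t; apply: (@cvgB _ R^o); [exact: cth2|exact: ca].
    move=> t tI; apply: (@has_arg_cosB _ (F (s, t))); first exact: hth.
    exact: ha.
  by rewrite /D; lra.
have D0E : D 0 = 2 * pi.
  rewrite (segconst (fun t => 2 * pi * t)) //; first by rewrite mulr1 mulr0 subr0.
    by move=> t; apply: cvgM; [exact: cvg_cst|exact: cvg_id].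
  move=> t tI; exists e' => //.
  rewrite /F /= HA; last exact/subset_closure/ptU.
  by rewrite /pt addrAC subrr add0r mul0r addr0.
have D1E : D 1 = 0.
  rewrite (segconst (fun t => G (pt 1 t))) //.
  - by rewrite /pt /cis mulr1 mulr0 cos0 sin0 mulr_natl cos2pi sin2pi subrr.
  - move=> t; apply: (@cvg_comp _ _ _ (fun t => pt 1 t) G (nbhs t) (nbhs (pt 1 t))); last exact: cG.
    apply: cvgD; first exact: cvg_cst.
    apply: cvgZ; first exact: cvg_cst.
    apply: (@cvg_comp _ _ _ (fun t => 2 * pi * t) cis (nbhs t) (nbhs (2 * pi * t))).
      by apply: cvgM; [exact: cvg_cst|exact: cvg_id].
    exact: cis_cont.
  - move=> t tI; exists (rho (pt 1 t)); last by rewrite /F /= HB.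
    rewrite lt_neqAle sqrtr_ge0 andbT eq_sym; apply/eqP => r0.
    by have := H0 _ (pt0 1 t ler01); rewrite HB // r0 scale0r eqxx.
by have := pi_gt0 R; rewrite D0E D1E in D01; lra.
Qed.

(** A continuous map on a compact segment is closed, hence a quotient map onto
    its image. *)
Lemma image_factor_continuous (f : R -> plane R) (th : R -> R) (g : plane R -> R) :
  continuous f -> continuous th -> (forall t, t \in `[0, 1] -> g (f t) = th t) ->
  {within f @` `[0, 1], continuous g}.
Proof.
move=> cf cth gf; apply/continuous_closedP => W clW.
apply/closed_subspaceP; exists (f @` (`[0, 1] `&` th @^-1` W)).
  apply: compact_plane_closed; apply: continuous_compact.
    exact: continuous_subspaceT.
  apply: subclosed_compact (@segment_compact _ 0 1) _; last by move=> ? [].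
  apply: closedI; first exact: interval_closed.
  by apply: preimage_closed => // x _; exact: cth.
apply/seteqP; split=> x.
  move=> [[t [tI /= Wt] <-] fI]; split => //=.
  by rewrite /from_subspace gf.
move=> [Wx [t tI E]]; split; last by exists t.
by exists t => //; split => //=; rewrite -gf // E.
Qed.

Lemma has_log_path (f : R -> plane R) z : continuous f ->
  {in `[0, 1] &, injective f} -> (forall t, t \in `[0, 1] -> f t != z) ->
  has_log (f @` `[0, 1]) z.
Proof.
move=> cf fI fz.
have cF : continuous (fun v : plane R => f v.1 - z).
  move=> v; apply: cvgB; last exact: cvg_cst.
  apply: (@cvg_comp _ _ _ fst f (nbhs v) (nbhs v.1)); last exact: cf.
  by case: (v) => a b; exact: cvg_fst.
have [v [vI _]|th cth hth] := square_lift cF; first by rewrite subr_eq0 fz.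
pose s x := xget 0 [set t | t \in `[0, 1] /\ f t = x].
have sf t : t \in `[0, 1] -> s (f t) = t.
  move=> tI; rewrite /s; case: xgetP => [u _ [uI fu]|/(_ t)[]//].
  exact: fI.
exists (fun x => th (s x, 0)); split.
  apply: (@image_factor_continuous f (fun t => th (t, 0))) => //.
    move=> t; apply: (@cvg_comp _ _ _ (fun t => (t, 0)) th (nbhs t) (nbhs (t, 0))).
      by apply: cvg_plane; [exact: cvg_id|exact: cvg_cst].
    exact: cth.
  by move=> t tI; rewrite sf.
move=> _ [t tI <-]; rewrite sf //; apply: (hth (t, 0)).
by split => //=; rewrite in_itv /= lexx ler01.
Qed.
End Log.

(** * Arcs and simple closed curves *)

Section Arc.
Variable R : realType.
Implicit Types (A B J : set (plane R)) (a b c d x y z : plane R).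

Definition simple_arc A a b := exists f : R -> plane R,
  [/\ continuous f, {in `[0, 1] &, injective f}, f 0 = a, f 1 = b
    & A = f @` `[0, 1]].

Let I0 : (0 : R) \in `[0, 1]. Proof. by rewrite in_itv /= lexx ler01. Qed.
Let I1 : (1 : R) \in `[0, 1]. Proof. by rewrite in_itv /= lexx ler01. Qed.

Lemma arc_ends A a b : simple_arc A a b -> [/\ A a, A b & a <> b].
Proof.
move=> [f [cf fI <- <- ->]]; split; [by exists 0|by exists 1|].
by move=> /(fI _ _ I0 I1) /eqP; rewrite eq_sym oner_eq0.
Qed.

Lemma arc_compact A a b : simple_arc A a b -> compact A.
Proof.
move=> [f [cf fI _ _ ->]]; apply: continuous_compact; last exact: segment_compact.
exact: continuous_subspaceT.
Qed.

Lemma arc_connected A a b : simple_arc A a b -> connected A.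
Proof.
move=> [f [cf fI _ _ ->]]; apply: connected_continuous_connected.
  exact: segment_connected.
exact: continuous_subspaceT.
Qed.

Lemma arc_interior_connected A a b : simple_arc A a b -> connected (A `\` [set a; b]).
Proof.
move=> [f [cf fI <- <- ->]].
have -> : (f @` `[0, 1]) `\` [set f 0; f 1] = f @` `]0, 1[.
  apply/seteqP; split=> x.
    move=> [[t tI <-] /not_orP[/= t0 t1]]; exists t => //=.
    move: tI => /=; rewrite !in_itv /= !le_eqVlt => /andP[/orP[/eqP tE|->]].
      by case: t0; rewrite -tE.
    by move=> /orP[/eqP tE|->//]; case: t1; rewrite tE.
  move=> [t /= tI <-].
  have tI' : t \in `[0, 1].
    by move: tI; rewrite !in_itv /= => /andP[/ltW -> /ltW ->].
  split; first by exists t.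
  by case=> /fI; rewrite ?I0 ?I1 => /(_ tI') E; move: tI; rewrite E // in_itv /= ltxx ?andbF.
apply: connected_continuous_connected; last exact: continuous_subspaceT.
exact/connected_intervalP/interval_is_interval.
Qed.

Lemma arc_log A a b z : simple_arc A a b -> ~ A z -> has_log A z.
Proof.
move=> [f [cf fI _ _ ->]] nz; apply: has_log_path => // t tI.
by apply/eqP => E; apply: nz; exists t.
Qed.

Lemma arc_path (f : R -> plane R) (s t : R) : continuous f -> s < t ->
  {in `[s, t] &, injective f} -> simple_arc (f @` `[s, t]) (f s) (f t).
Proof.
move=> cf st fI.
have ts0 : 0 < t - s by rewrite subr_gt0.
have hI u : u \in `[0, 1] -> s + u * (t - s) \in `[s, t].
  rewrite !in_itv /= => /andP[u0 u1]; rewrite lerDl mulr_ge0 ?(ltW ts0) //=.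
  by rewrite -lerBrDl ler_piMl // ltW.
exists (fun u => f (s + u * (t - s))); split.
- move=> u; apply: (@cvg_comp _ _ _ (fun u => s + u * (t - s)) f (nbhs u)
    (nbhs (s + u * (t - s)))); last exact: cf.
  apply: (@cvgD _ R^o); first exact: cvg_cst.
  by apply: cvgM; [exact: cvg_id|exact: cvg_cst].
- move=> u v uI vI /(fI _ _ (hI _ uI) (hI _ vI)) /addrI.
  by apply: mulIf; exact: lt0r_neq0.
- by rewrite mul0r addr0.
- by rewrite mul1r addrC subrK.
apply/seteqP; split=> x [u /= uI <-]; last by exists (s + u * (t - s)) => //; exact: hI.
exists ((u - s) / (t - s)); last by rewrite divfK ?lt0r_neq0 // addrC subrK.
move: uI; rewrite /= !in_itv /= => /andP[su ut].
by rewrite divr_ge0 ?subr_ge0 ?(ltW st) //= ler_pdivrMr // mul1r lerB.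
Qed.

Lemma arc_rev A a b : simple_arc A a b -> simple_arc A b a.
Proof.
move=> [f [cf fI <- <- ->]].
have hI (u : R) : u \in `[0, 1] -> 1 - u \in `[0, 1].
  by rewrite !in_itv /= => /andP[u0 u1]; rewrite subr_ge0 u1 gerBl.
exists (fun u => f (1 - u)); split.
- move=> u; apply: (@cvg_comp _ _ _ (fun u => 1 - u) f (nbhs u)
    (nbhs (1 - u))); last exact: cf.
  by apply: (@cvgB _ R^o); [exact: cvg_cst|exact: cvg_id].
- by move=> u v uI vI /(fI _ _ (hI _ uI) (hI _ vI)) /addrI /oppr_inj.
- by rewrite subr0.
- by rewrite subrr.
apply/seteqP; split=> x [u /= uI <-]; last by exists (1 - u) => //; exact: hI.
by exists (1 - u); [exact: hI|rewrite subKr].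
Qed.

Lemma path_cut (f : R -> plane R) s : continuous f ->
  {in `[0, 1] &, injective f} -> 0 < s -> s < 1 ->
  [/\ simple_arc (f @` `[0, s]) (f 0) (f s), simple_arc (f @` `[s, 1]) (f s) (f 1),
    f @` `[0, 1] = f @` `[0, s] `|` f @` `[s, 1]
    & forall x, (f @` `[0, s]) x -> (f @` `[s, 1]) x -> x = f s].
Proof.
move=> cf fI s0 s1.
have S1 u : u \in `[0, s] -> u \in `[0, 1].
  by rewrite !in_itv /= => /andP[-> /le_trans]; apply; exact: ltW.
have S2 u : u \in `[s, 1] -> u \in `[0, 1].
  by rewrite !in_itv /= => /andP[/(le_trans (ltW s0)) -> ->].
split.
- by apply: arc_path => // u v /S1 uI /S1 vI; exact: fI.
- by apply: arc_path => // u v /S2 uI /S2 vI; exact: fI.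
- rewrite -image_setU; congr (f @` _); apply/seteqP; split=> u /=.
    rewrite !in_itv /= => /andP[u0 u1]; have [us|us] := leP u s; [left|right].
      by rewrite u0.
    by rewrite (ltW us).
  by case=> [/S1|/S2].
move=> x [u /= uI <-] [v /= vI] /(fI _ _ (S2 _ vI) (S1 _ uI)) E.
congr f; apply/eqP; rewrite eq_le; move: uI vI.
by rewrite E !in_itv /= => /andP[_ ->] /andP[-> _].
Qed.

Lemma arc_cut A a b c : simple_arc A a b -> A c -> c <> a -> c <> b ->
  exists A1 A2, [/\ simple_arc A1 a c, simple_arc A2 c b, A = A1 `|` A2
    & forall x, A1 x -> A2 x -> x = c].
Proof.
move=> [f [cf fI <- <- ->]] [s sI <-] sa sb.
have [s0 s1] : 0 < s /\ s < 1.
  move: sI; rewrite /= in_itv /= !le_eqVlt => /andP[/orP[/eqP E|->]].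
    by case: sa; rewrite -E.
  by move=> /orP[/eqP E|->//]; case: sb; rewrite E.
by exists (f @` `[0, s]), (f @` `[s, 1]); exact: path_cut.
Qed.

(** The two paths are added rather than pasted: on each half of the parameter
    interval one of the two summands is constant, equal to [b]. *)
Lemma arc_cat A B a b c : simple_arc A a b -> simple_arc B b c ->
  (forall x, A x -> B x -> x = b) -> simple_arc (A `|` B) a c.
Proof.
move=> [f [cf fI <- fb ->]] [g [cg gI gb <- ->]] AB.
pose h t := f (Num.min (2 * t) 1) + g (Num.max (2 * t - 1) 0) - b.
have h1 t : t <= 1 / 2 -> h t = f (2 * t).
  by move=> t1; rewrite /h min_l ?max_r ?gb ?addrK //; lra.
have h2 t : 1 / 2 <= t -> h t = g (2 * t - 1).
  by move=> t1; rewrite /h min_r ?max_l ?fb ?(addrC b) ?addrK //; lra.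
have i1 (t : R) : t \in `[0, 1] -> t <= 1 / 2 -> 2 * t \in `[0, 1].
  by rewrite !in_itv /= => /andP[t0 _] t1; apply/andP; split; lra.
have i2 (t : R) : t \in `[0, 1] -> 1 / 2 <= t -> 2 * t - 1 \in `[0, 1].
  by rewrite !in_itv /= => /andP[_ t0] t1; apply/andP; split; lra.
exists h; split.
- have c2 : continuous (fun t : R => 2 * t).
    by move=> t; apply: cvgM; [exact: cvg_cst|exact: cvg_id].
  move=> t; apply: cvgB; last exact: cvg_cst; apply: cvgD.
    apply: (@cvg_comp _ _ _ (fun t => Num.min (2 * t) 1) f (nbhs t)
      (nbhs (Num.min (2 * t) 1))); last exact: cf.
    apply: (@continuous_min R R (fun t => 2 * t) (cst 1)); first exact: c2.
    exact: cvg_cst.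
  apply: (@cvg_comp _ _ _ (fun t => Num.max (2 * t - 1) 0) g (nbhs t)
      (nbhs (Num.max (2 * t - 1) 0))); last exact: cg.
  apply: (@continuous_max R R (fun t => 2 * t - 1) (cst 0)); last exact: cvg_cst.
  by apply: (@cvgB _ R^o); [exact: c2|exact: cvg_cst].
- have cross (t u : R) : t \in `[0, 1] -> u \in `[0, 1] -> t <= 1 / 2 -> 1 / 2 <= u ->
      h t = h u -> t = u.
    move=> tI uI t1 u1; rewrite h1 // h2 // => E.
    have Eb : f (2 * t) = b.
      apply: AB; first by exists (2 * t) => //; exact: i1.
      by rewrite E; exists (2 * u - 1) => //; exact: i2.
    have : 2 * t = 1 by apply: fI => //; [exact: i1|rewrite fb].
    have : 2 * u - 1 = 0 by apply: gI => //; [exact: i2|rewrite -E gb].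
    by lra.
  move=> t u tI uI; have [t1|/ltW t1] := leP t (1 / 2); have [u1|/ltW u1] := leP u (1 / 2).
  + rewrite !h1 // => /(fI _ _ (i1 _ tI t1) (i1 _ uI u1)); lra.
  + exact: cross.
  + by move=> /esym E; apply/esym; exact: cross.
  + rewrite !h2 // => /(gI _ _ (i2 _ tI t1) (i2 _ uI u1)); lra.
- by rewrite h1 ?mulr0 // divr_ge0.
- by rewrite h2; [congr g; lra|lra].
apply/seteqP; split=> x.
  case=> -[t /= tI <-]; move: (tI); rewrite in_itv /= => /andP[t0 t1].
    exists (t / 2); first by rewrite /= in_itv /=; apply/andP; split; lra.
    by rewrite h1; [congr f; lra|lra].
  exists ((t + 1) / 2); first by rewrite /= in_itv /=; apply/andP; split; lra.
  by rewrite h2; [congr g; lra|lra].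
move=> [t /= tI <-]; have [t1|/ltW t1] := leP t (1 / 2).
  by left; rewrite h1 //; exists (2 * t) => //; exact: i1.
by right; rewrite h2 //; exists (2 * t - 1) => //; exact: i2.
Qed.

Definition arc_split J a b A B :=
  [/\ simple_arc A a b, simple_arc B a b, forall x, A x -> B x -> x = a \/ x = b & J = A `|` B].

(** Simple closed curves are given as pairs of arcs with common endpoints, which
    is how the curves of two lines arise. *)
Definition closed_curve J := exists a b A B, arc_split J a b A B.

Lemma arc_splitC J a b A B : arc_split J a b A B -> arc_split J a b B A.
Proof. by move=> [hA hB AB ->]; split => //; [move=> x ? ?; exact: AB|rewrite setUC]. Qed.

Lemma arc_split_rev J a b A B : arc_split J a b A B -> arc_split J b a A B.
Proof.
move=> [hA hB AB ->]; split; [exact: arc_rev|exact: arc_rev| |by []].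
by move=> x Ax Bx; apply/or_comm/AB.
Qed.

(** One of the two cut points of a simple closed curve may be moved to any other
    place: the piece between the old and the new cut point changes sides. *)
Lemma arc_split_move J a b c A B : arc_split J a b A B -> J c -> c <> b ->
  exists A' B', arc_split J c b A' B'.
Proof.
move=> sJ Jc cb.
wlog Ac : A B sJ / A c.
  move=> H; have [_ _ _ JE] := sJ; have [h|h] : (A `|` B) c by rewrite -JE.
    exact: H sJ h.
  exact: H (arc_splitC sJ) h.
have [ca|ca] := pselect (c = a); first by exists A, B; rewrite ca.
have [hA hB AB JE] := sJ.
have [A1 [A2 [h1 h2 AE A12]]] := arc_cut hA Ac ca cb.
exists A2, (A1 `|` B); split => //.
- apply: (arc_cat (arc_rev h1) hB) => x x1 xB.
  have [//|E] : x = a \/ x = b by apply: AB => //; rewrite AE; left.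
  have [_ b2 _] := arc_ends h2; case: cb; rewrite -E.
  by apply/esym/A12 => //; rewrite E.
- move=> x x2 [x1|xB]; first by left; exact: A12.
  have [E|E] : x = a \/ x = b by apply: AB => //; rewrite AE; right.
    have [a1 _ _] := arc_ends h1; case: ca; rewrite -E.
    by apply/esym/A12 => //; rewrite E.
  by right.
by rewrite JE AE -setUA setUCA.
Qed.

Lemma closed_curve_split J c d : closed_curve J -> J c -> J d -> c <> d ->
  exists A B, arc_split J c d A B.
Proof.
move=> [a [b [A [B sJ]]]] Jc Jd cd.
have [cb|cb] := pselect (c = b).
  rewrite -{}cb in sJ.
  have [A' [B' sJ']] := arc_split_move sJ Jd (nesym cd).
  by exists A', B'; exact: arc_split_rev.
have [A' [B' sJ']] := arc_split_move sJ Jc cb.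
have [A2 [B2 sJ2]] := arc_split_move (arc_split_rev sJ') Jd (nesym cd).
by exists A2, B2; exact: arc_split_rev.
Qed.

Lemma closed_curve_compact J : closed_curve J -> compact J.
Proof.
move=> [a [b [A [B [hA hB _ ->]]]]].
by apply: compactU; [exact: arc_compact hA|exact: arc_compact hB].
Qed.
End Arc.

(** * A simple closed curve separates the plane *)

Section Essential.
Variable R : realType.
Implicit Types (A B J K : set (plane R)) (a b c d x y z : plane R) (N s t : R).

Lemma plane_normP x N : (`|x| <= N) = [&& - N <= x.1, x.1 <= N, - N <= x.2 & x.2 <= N].
Proof. by rewrite prod_normE ge_max !ler_norml -andbA. Qed.

Lemma fst_continuous : continuous (fst : plane R -> R).
Proof. by case=> a b; exact: cvg_fst. Qed.
Lemma snd_continuous : continuous (snd : plane R -> R).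
Proof. by case=> a b; exact: cvg_snd. Qed.

Lemma closed_pre (T U : topologicalType) (f : T -> U) (D : set U) :
  continuous f -> closed D -> closed (f @^-1` D).
Proof. by move=> /continuous_closedP; apply. Qed.

Lemma closed_fst_le s : closed [set x : plane R | x.1 <= s].
Proof. exact: (closed_pre fst_continuous (@closed_le R s)). Qed.
Lemma closed_fst_ge s : closed [set x : plane R | s <= x.1].
Proof. exact: (closed_pre fst_continuous (@closed_ge R s)). Qed.
Lemma closed_snd_le s : closed [set x : plane R | x.2 <= s].
Proof. exact: (closed_pre snd_continuous (@closed_le R s)). Qed.
Lemma closed_snd_ge s : closed [set x : plane R | s <= x.2].
Proof. exact: (closed_pre snd_continuous (@closed_ge R s)). Qed.

Lemma closed_fst_eq s : closed [set x : plane R | x.1 = s].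
Proof.
have -> : [set x : plane R | x.1 = s] = [set x | x.1 <= s] `&` [set x | s <= x.1].
  apply/seteqP; split=> x /=; first by move=> ->.
  by move=> [? ?]; apply/eqP; rewrite eq_le; apply/andP.
by apply: closedI; [exact: closed_fst_le|exact: closed_fst_ge].
Qed.
Lemma closed_snd_eq s : closed [set x : plane R | x.2 = s].
Proof.
have -> : [set x : plane R | x.2 = s] = [set x | x.2 <= s] `&` [set x | s <= x.2].
  apply/seteqP; split=> x /=; first by move=> ->.
  by move=> [? ?]; apply/eqP; rewrite eq_le; apply/andP.
by apply: closedI; [exact: closed_snd_le|exact: closed_snd_ge].
Qed.

Lemma closed_box N : closed [set x : plane R | `|x| <= N].
Proof.
exact: (closed_pre (@norm_continuous _ (plane R)) (@closed_le R N)).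
Qed.

Lemma compact_box N : compact [set x : plane R | `|x| <= N].
Proof.
have -> : [set x : plane R | `|x| <= N] = `[- N, N] `*` `[- N, N].
  apply/seteqP; split=> x /=; rewrite plane_normP !in_itv /=.
    by case/and4P => -> -> -> ->.
  by move=> [/andP[-> ->] /andP[-> ->]].
by apply: compact_setX; exact: segment_compact.
Qed.

Lemma vertical_connected s (I : set R) : is_interval I ->
  connected [set x : plane R | x.1 = s /\ I x.2].
Proof.
move=> /connected_intervalP cI.
have -> : [set x : plane R | x.1 = s /\ I x.2] = (fun t => (s, t)) @` I.
  apply/seteqP; split=> x; last by move=> [t It <-].
  by case: x => u v /= [-> Iv]; exists v.
apply: connected_continuous_connected => //; apply: continuous_subspaceT => t.
by apply: cvg_plane; [exact: cvg_cst|exact: cvg_id].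
Qed.

Lemma horizontal_connected s (I : set R) : is_interval I ->
  connected [set x : plane R | I x.1 /\ x.2 = s].
Proof.
move=> /connected_intervalP cI.
have -> : [set x : plane R | I x.1 /\ x.2 = s] = (fun t => (t, s)) @` I.
  apply/seteqP; split=> x; last by move=> [t It <-].
  by case: x => u v /= [Iv ->]; exists u.
apply: connected_continuous_connected => //; apply: continuous_subspaceT => t.
by apply: cvg_plane; [exact: cvg_id|exact: cvg_cst].
Qed.

Lemma connected_value (C : set (plane R)) (h : plane R -> R) a b s :
  connected C -> continuous h -> C a -> C b -> h a <= s <= h b ->
  exists2 x, C x & h x = s.
Proof.
move=> cC ch Ca Cb hs.
have /connected_intervalP iC :=
  connected_continuous_connected cC (continuous_subspaceT ch).
by have [|| x Cx <-] := iC (h a) (h b) _ _ s hs; [exists a|exists b|exists x].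
Qed.

(** If the curve were contained in a vertical line, the two arcs joining [p] and
    [q] would both take the height midway between [p] and [q], hence would have
    a common point other than [p] and [q]. *)
Lemma closed_curve_width J : closed_curve J ->
  exists a b, [/\ J a, J b, a.1 < b.1 & forall x, J x -> a.1 <= x.1 <= b.1].
Proof.
move=> cJ; have kJ := closed_curve_compact cJ.
have [p [q [A [B [hA hB AB JE]]]]] := cJ.
have [Ap Aq pq] := arc_ends hA; have [Bp Bq _] := arc_ends hB.
have J0 : J !=set0 by exists p; rewrite JE; left.
have cfst K : {within K, continuous (fst : plane R -> R)}.
  exact/continuous_subspaceT/fst_continuous.
have [a Ja amin] := compact_EVT_min J0 kJ (cfst J).
have [b Jb bmax] := compact_EVT_max J0 kJ (cfst J).
rewrite !inE in Ja Jb.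
have ab x : J x -> a.1 <= x.1 <= b.1.
  by move=> Jx; rewrite amin ?bmax // inE.
exists a, b; split => //; rewrite lt_neqAle.
have /andP[-> _] := ab _ Jb; rewrite andbT; apply/eqP => E.
have flat x : J x -> x.1 = a.1.
  by move=> /ab; rewrite -E => h; apply/eqP; rewrite eq_le andbC.
have p2q2 : p.2 <> q.2.
  move=> pq2; apply: pq; rewrite [p]surjective_pairing [q]surjective_pairing pq2.
  by rewrite !flat // JE; left.
have cA := arc_connected hA; have cB := arc_connected hB.
wlog lt_pq : p q Ap Aq Bp Bq AB p2q2 {pq hA hB} / p.2 < q.2 => [H|].
  have [h|h|//] := ltgtP p.2 q.2; first exact: (H p q).
  by apply: (H q p) => // [x Ax Bx|]; [apply/or_comm/AB|exact/nesym].
have mid : p.2 <= (p.2 + q.2) / 2 <= q.2 by apply/andP; split; lra.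
have [u Au uE] := connected_value cA snd_continuous Ap Aq mid.
have [v Bv vE] := connected_value cB snd_continuous Bp Bq mid.
have uv : u = v.
  rewrite [u]surjective_pairing [v]surjective_pairing uE vE !flat // JE.
    by right.
  by left.
rewrite -uv in Bv.
by have [E'|E'] := AB _ Au Bv; move: uE; rewrite E'; lra.
Qed.

Lemma box_boundary_no_log N z : `|z| < N -> ~ has_log [set x | `|x| = N] z.
Proof.
move=> zN; apply: (@no_log_inside _ [set x | `|x| < N]) => //.
- apply: (@open_comp _ _ (fun x : plane R => `|x|) [set t | t < N]); last exact: open_lt.
  by move=> x _; exact: norm_continuous.
- apply: subclosed_compact (@compact_box N) _; last by move=> x /= ->.
  have -> : [set x : plane R | `|x| = N] = [set x | `|x| <= N] `&` [set x | N <= `|x|].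
    apply/seteqP; split=> x /=; first by move=> ->.
    by move=> [? ?]; apply/eqP; rewrite eq_le; apply/andP.
  apply: closedI; first exact: closed_box.
  exact: (closed_pre (@norm_continuous _ (plane R)) (@closed_ge R N)).
- move=> x [/= cx /negP]; rewrite -leNgt => Nx; apply/eqP; rewrite eq_le Nx andbT.
  suff : closure [set x : plane R | `|x| < N] `<=` [set x | `|x| <= N] by apply.
  rewrite ((closure_id _).1 (@closed_box N)).
  by apply: closureS => y /= /ltW.
by exists N => x /= /ltW.
Qed.


Section Frame.
Variables (a b : plane R) (N : R).

Definition in_box x := [/\ - N < x.1, x.1 < N, - N < x.2 & x.2 < N].
(** The boundary of the box is cut into an upper and a lower frame, on the left
    side at the height of [a] and on the right side at the height of [b]; the
    whiskers are the horizontal segments from these two cut points to [a] and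
    [b]. *)
Definition whiskers : set (plane R) :=
  [set x | [/\ - N <= x.1, x.1 <= a.1 & x.2 = a.2]] `|`
  [set x | [/\ b.1 <= x.1, x.1 <= N & x.2 = b.2]].
Definition upper_frame : set (plane R) := [set x | `|x| <= N] `&`
  ([set x | N <= x.2] `|` ([set x | x.1 <= - N] `&` [set x | a.2 <= x.2]) `|`
   ([set x | N <= x.1] `&` [set x | b.2 <= x.2])).
Definition lower_frame : set (plane R) := [set x | `|x| <= N] `&`
  ([set x | x.2 <= - N] `|` ([set x | x.1 <= - N] `&` [set x | x.2 <= a.2]) `|`
   ([set x | N <= x.1] `&` [set x | x.2 <= b.2])).

Lemma closed_upper_frame : closed upper_frame.
Proof.
apply: closedI; first exact: closed_box.
apply: closedU; first apply: closedU.
- exact: closed_snd_ge.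
- by apply: closedI; [exact: closed_fst_le|exact: closed_snd_ge].
- by apply: closedI; [exact: closed_fst_ge|exact: closed_snd_ge].
Qed.

Lemma closed_lower_frame : closed lower_frame.
Proof.
apply: closedI; first exact: closed_box.
apply: closedU; first apply: closedU.
- exact: closed_snd_le.
- by apply: closedI; [exact: closed_fst_le|exact: closed_snd_le].
- by apply: closedI; [exact: closed_fst_ge|exact: closed_snd_le].
Qed.

Let whiskersE : whiskers = [set x | [set` `[- N, a.1]] x.1 /\ x.2 = a.2] `|`
  [set x | [set` `[b.1, N]] x.1 /\ x.2 = b.2].
Proof.
rewrite /whiskers; congr (_ `|` _); apply/seteqP; split=> x /=; rewrite in_itv /=.
- by move=> [-> -> ->].
- by move=> [/andP[-> ->] ->].
- by move=> [-> -> ->].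
- by move=> [/andP[-> ->] ->].
Qed.

Lemma closed_whiskers : closed whiskers.
Proof.
rewrite whiskersE; apply: closedU.
  apply: (@closedI _ (fst @^-1` `[- N, a.1]) [set x | x.2 = a.2]).
    by apply: (closed_pre fst_continuous); exact: interval_closed.
  exact: closed_snd_eq.
apply: (@closedI _ (fst @^-1` `[b.1, N]) [set x | x.2 = b.2]).
  by apply: (closed_pre fst_continuous); exact: interval_closed.
exact: closed_snd_eq.
Qed.

Lemma connected_whiskersU A : connected A -> A a -> A b -> in_box a -> in_box b ->
  connected (A `|` whiskers).
Proof.
move=> cA Aa Ab [a1 _ _ _] [_ b1 _ _]; rewrite whiskersE setUA; apply: connectedU.
- exists b; split; [by left|split => //=; rewrite in_itv /= lexx; exact: ltW].
- apply: connectedU => //.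
    by exists a; split => //; split => //=; rewrite in_itv /= lexx andbT; exact: ltW.
  exact/horizontal_connected/interval_is_interval.
- exact/horizontal_connected/interval_is_interval.
Qed.

Lemma box_upper_frame x : - N < x.1 -> x.1 < N -> x.2 < N -> ~ upper_frame x.
Proof. by move=> h1 h2 h3 [_ [[/=|[/= h4 _]]|[/= h4 _]]]; lra. Qed.

Lemma box_lower_frame x : - N < x.1 -> x.1 < N -> - N < x.2 -> ~ lower_frame x.
Proof. by move=> h1 h2 h3 [_ [[/=|[/= h4 _]]|[/= h4 _]]]; lra. Qed.

Lemma upper_lower_frame x : in_box a -> in_box b ->
  upper_frame x -> lower_frame x -> whiskers x.
Proof.
move=> [a1 a2 a3 a4] [b1 b2 b3 b4] [/=].
rewrite plane_normP => /and4P[h1 h2 h3 h4] ht [_ hb].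
case: ht => [[/= ht|[/= ht ht']]|[/= ht ht']];
  case: hb => [[/= hb|[/= hb hb']]|[/= hb hb']]; try (exfalso; lra).
  by left; split; [lra|lra|apply/eqP; rewrite eq_le hb'].
by right; split; [lra|lra|apply/eqP; rewrite eq_le hb'].
Qed.

Lemma whiskers_box x : in_box a -> in_box b -> whiskers x -> `|x| <= N.
Proof.
move=> [a1 a2 a3 a4] [b1 b2 b3 b4].
rewrite plane_normP => -[[/= h1 h2 ->]|[/= h1 h2 ->]]; apply/and4P.
  by split=> //; [apply: ltW; exact: le_lt_trans h2 a2|exact: ltW|exact: ltW].
by split=> //; [apply: ltW; exact: lt_le_trans b1 h1|exact: ltW|exact: ltW].
Qed.

Lemma whiskers_off x : a.1 < x.1 -> x.1 < b.1 -> ~ whiskers x.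
Proof. by move=> h1 h2 [[/= _ + _]|[/= + _ _]]; rewrite leNgt ?h1 ?h2. Qed.

Lemma whiskers_curve x : a.1 <= x.1 <= b.1 -> whiskers x -> x = a \/ x = b.
Proof.
move=> /andP[h4 h5] [[/= h1 h2 h3]|[/= h1 h2 h3]]; [left|right].
  rewrite [x]surjective_pairing [a]surjective_pairing h3; congr (_, _).
  by apply/eqP; rewrite eq_le h2.
rewrite [x]surjective_pairing [b]surjective_pairing h3; congr (_, _).
by apply/eqP; rewrite eq_le h5.
Qed.

Lemma frame_cover x : `|x| = N -> upper_frame x \/ lower_frame x.
Proof.
move=> xN.
have : `|x| <= N by rewrite xN.
have : [\/ x.1 = - N, x.1 = N, x.2 = - N | x.2 = N].
  have := xN; rewrite prod_normE; case: (leP `|x.1| `|x.2|) => _.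
    by case: (ler0P x.2) => _ E; [apply: Or43|apply: Or44]; rewrite -?E ?opprK.
  by case: (ler0P x.1) => _ E; [apply: Or41|apply: Or42]; rewrite -?E ?opprK.
rewrite /upper_frame /lower_frame /=; case=> -> ->.
- have [h|/ltW h] := leP a.2 x.2; [left|right]; split => //; left; right; split => //.
- have [h|/ltW h] := leP b.2 x.2; [left|right]; split => //; right; split => //.
- by right; split => //; left; left.
- by left; split => //; left; left.
Qed.

End Frame.

(** Let [a] be a leftmost and [b] a rightmost point of the curve, let [l] be its
    highest point on a vertical line strictly between them, and call [A] the arc
    from [a] to [b] through [l] and [B] the other one.  Take [z0] right below the
    lowest point [m] of [A] on that line.  Going up to [m], then along [A] to
    [l], then straight up, [z0] escapes to infinity without meeting [B], the
    whiskers or the lower frame; going straight down, it escapes without meeting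
    [A], the whiskers or the upper frame.  This provides branches on the lower
    frame with [B] and on the upper frame with [A].  A branch on the curve would
    allow to glue them, first along [B], then along [A] with the whiskers, to a
    branch on the boundary of the box, which has none because [z0] is inside. *)
Lemma exists_no_log J : closed_curve J -> exists2 z, ~ J z & ~ has_log J z.
Proof.
move=> cJ; have kJ := closed_curve_compact cJ.
have [a [b [Ja Jb ab abJ]]] := closed_curve_width cJ.
have ab' : a <> b by move=> E; move: ab; rewrite E ltxx.
have [A [B sJ]] := closed_curve_split cJ Ja Jb ab'.
have [x0 ax0 x0b] : exists2 s : R, a.1 < s & s < b.1.
  by exists ((a.1 + b.1) / 2); lra.
have csnd K : {within K, continuous (snd : plane R -> R)}.
  exact/continuous_subspaceT/snd_continuous.
have [l [Jl lx0] lmax] : exists2 l, J l /\ l.1 = x0 &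
    forall x, J x -> x.1 = x0 -> x.2 <= l.2.
  have [| | |l + lmax] := @compact_EVT_max _ R snd (J `&` [set x | x.1 = x0]).
  - have [hA hB _ JE] := sJ; have [Aa Ab _] := arc_ends hA.
    have [|u Au uE] := connected_value (arc_connected hA) fst_continuous Aa Ab (s := x0).
      by rewrite !ltW.
    by exists u; split => //; rewrite JE; left.
  - apply: (subclosed_compact _ kJ); last by move=> ? [].
    apply: closedI; first exact: compact_plane_closed.
    exact: closed_fst_eq.
  - exact: csnd.
  - rewrite inE => -[Jl lE]; exists l => // x Jx xE.
    by apply: lmax; rewrite inE.
wlog Al : A B sJ / A l.
  move=> H; have [_ _ _ JE] := sJ; have [h|h] : (A `|` B) l by rewrite -JE.
    exact: H sJ h.
  exact: H (arc_splitC sJ) h.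
have [hA hB AB JE] := sJ.
have [Aa Ab _] := arc_ends hA; have [Ba Bb _] := arc_ends hB.
have AJ : A `<=` J by rewrite JE; left.
have BJ : B `<=` J by rewrite JE; right.
have kA := arc_compact hA; have kB := arc_compact hB.
have clA := compact_plane_closed kA; have clB := compact_plane_closed kB.
have [m [Am mx0] mmin] : exists2 m, A m /\ m.1 = x0 &
    forall x, A x -> x.1 = x0 -> m.2 <= x.2.
  have [| | |m + mmin] := @compact_EVT_min _ R snd (A `&` [set x | x.1 = x0]).
  - by exists l.
  - apply: (subclosed_compact _ kA); last by move=> ? [].
    by apply: closedI => //; exact: closed_fst_eq.
  - exact: csnd.
  - rewrite inE => -[Jm mE]; exists m => // x Jx xE.
    by apply: mmin; rewrite inE.
have notAB x : x.1 = x0 -> A x -> ~ B x.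
  by move=> xE Ax Bx; have [E|E] := AB _ Ax Bx; move: ax0 x0b; rewrite -xE E ltxx.
have [e [e0 e1 he]] : exists e,
    [/\ 0 < e, e < 1 & forall s, m.2 - e <= s <= m.2 -> ~ B (x0, s)].
  have : nbhs m (~` B).
    by apply: open_nbhs_nbhs; split; [exact: closed_openC|exact: notAB].
  move=> /nbhs_distP[e e0 he]; exists (Num.min e 1 / 2).
  have d0 : 0 < Num.min e 1 by rewrite lt_min e0 ltr01.
  have dm : m = (x0, m.2) by rewrite [LHS]surjective_pairing mx0.
  split; first by rewrite divr_gt0.
    by rewrite ltr_pdivrMr // mul1r gt_min ltr1n orbT.
  move=> s /andP[s1 s2]; apply: he; rewrite dm prod_normE gt_max /= subrr normr0 e0 /=.
  rewrite ger0_norm ?subr_ge0 //; apply: le_lt_trans (_ : Num.min e 1 / 2 < _).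
    by rewrite lerBlDr -lerBlDl.
  apply: lt_le_trans (_ : Num.min e 1 <= _); last by rewrite ge_min lexx.
  by rewrite ltr_pdivrMr // ltr_pMr // ltr1n.
pose z0 : plane R := (x0, m.2 - e).
have z0m : m.2 - e < m.2 by rewrite gtrBl.
have z0A : ~ A z0 by move=> /mmin /(_ erefl); rewrite leNgt /= z0m.
have z0B : ~ B z0 by apply: he; rewrite lexx ltW.
exists z0; first by rewrite JE => -[].
have [M hM] := compact_norm_bounded kJ.
have [N [N1 inbox mN]] : exists N, [/\ 0 < N, forall x, J x -> in_box N x & - N < m.2 - e].
  exists (M + 1); split.
  - by rewrite ltr_wpDl // (le_trans (normr_ge0 _) (hM _ Ja)).
  - move=> x /hM; rewrite plane_normP => /and4P[h1 h2 h3 h4].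
    by split; lra.
  - by have := hM _ (AJ _ Am); rewrite plane_normP => /and4P[_ _ h3 _]; lra.
have ina := inbox _ Ja; have inb := inbox _ Jb.
have [Na aN _ _] := ina; have [Nb bN _ _] := inb.
have [m1 m2 m3 m4] := inbox _ (AJ _ Am).
have [l1 l2 l3 l4] := inbox _ Jl.
have Nx0 : - N < x0 by exact: lt_trans Na ax0.
have x0N : x0 < N by exact: lt_trans x0b bN.
have z0N : m.2 - e < N by exact: lt_trans z0m m4.
have JN x : J x -> `|x| <= N.
  by move=> /inbox[h1 h2 h3 h4]; rewrite plane_normP !ltW.
have normz0 : `|z0| < N by rewrite prod_normE gt_max /= !ltr_norml Nx0 x0N mN.
move=> logJ; apply: (box_boundary_no_log normz0).
pose segs := whiskers a b N; pose top := upper_frame a b N; pose bot := lower_frame a b N.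
have clsegs : closed segs := @closed_whiskers a b N.
have cltop : closed top := @closed_upper_frame a b N.
have clbot : closed bot := @closed_lower_frame a b N.
have Jsegs x : J x -> segs x -> x = a \/ x = b.
  by move=> Jx; apply: whiskers_curve; exact: abJ.
have Jtop x : J x -> ~ top x by move=> /inbox[h1 h2 h3 h4]; exact: box_upper_frame.
have Jbot x : J x -> ~ bot x by move=> /inbox[h1 h2 h3 h4]; exact: box_lower_frame.
have topbot x : top x -> bot x -> segs x by exact: upper_lower_frame.
have segsN x : segs x -> `|x| <= N by exact: whiskers_box.
have segsx0 x : x.1 = x0 -> ~ segs x by move=> E; apply: whiskers_off; rewrite E.
have botx0 x : x.1 = x0 -> - N < x.2 -> ~ bot x.
  by move=> E h; apply: box_lower_frame; rewrite ?E.
have topx0 x : x.1 = x0 -> x.2 < N -> ~ top x.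
  by move=> E h; apply: box_upper_frame; rewrite ?E.
pose LA := A `|` segs; pose LB := B `|` segs.
have NN : N < 2 * N + 1 by apply: (@lt_trans _ _ (2 * N)); rewrite ?ltrDl // ltr_pMl // ltr1n.
have far s : 2 * N + 1 <= `|s| -> 2 * N < `|(x0, s) : plane R|.
  move=> h; rewrite prod_normE lt_max /=; apply/orP; right.
  by apply: lt_le_trans h; rewrite ltrDl.
have NN0 : 0 < 2 * N + 1 by exact: lt_trans N1 NN.
have log_bot : has_log (bot `|` LB) z0.
  pose w : plane R := (x0, 2 * N + 1).
  pose C := [set x : plane R | x.1 = x0 /\ [set` `[m.2 - e, m.2]] x.2] `|`
    (A `\` [set a; b]) `|` [set x : plane R | x.1 = x0 /\ [set` `[l.2, +oo[] x.2].
  have nab x : x.1 = x0 -> ~ [set a; b] x.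
    by move=> xE [E|E]; move: ax0 x0b; rewrite -xE E ltxx.
  apply: (@has_log_connected _ _ C w).
  - by apply: closedU => //; apply: closedU.
  - apply: connectedU; last first.
    + exact/vertical_connected/interval_is_interval.
    + apply: connectedU; last exact: arc_interior_connected hA.
        exists m; split; last by split => //; exact: nab.
        by split => //=; rewrite in_itv /= lexx andbT ltW.
      exact/vertical_connected/interval_is_interval.
    + exists l; split; last by split => //=; rewrite in_itv /= lexx.
      by right; split => //; exact: nab.
  - apply/seteqP; split => // x [[[[/= xE]|[Ax nx]]|[/= xE]]].
    + rewrite in_itv /= => /andP[h1 h2] [|[Bx|]].
      * by apply: botx0 => //; exact: lt_le_trans h1.
      * by apply: (he x.2); rewrite ?h1 // -xE -surjective_pairing.
      * exact: segsx0.
    + move=> [/(Jbot _ (AJ _ Ax)) //|[Bx|/(Jsegs _ (AJ _ Ax))]]; last exact: nx.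
      by apply: nx; exact: AB.
    + rewrite in_itv /= andbT => h1 [|[Bx|]].
      * by apply: botx0 => //; exact: lt_le_trans h1.
      * have h2 := lmax _ (BJ _ Bx) xE.
        apply: (notAB l) => //; rewrite (_ : l = x) //.
        rewrite [x]surjective_pairing [l]surjective_pairing xE lx0; congr (_, _).
        by apply/eqP; rewrite eq_le h1.
      * exact: segsx0.
  - right; split => //=; rewrite in_itv /= andbT; apply: ltW.
    exact: lt_trans l4 NN.
  - by left; left; split => //=; rewrite in_itv /= lexx ltW.
  - apply: (@has_log_far _ _ _ N).
      by move=> x [[]//|[/BJ/JN//|/segsN]].
    by apply: far; rewrite ger0_norm // ltW.
have log_top : has_log (top `|` LA) z0.
  pose w : plane R := (x0, - (2 * N + 1)).
  pose C := [set x : plane R | x.1 = x0 /\ [set` `]-oo, m.2 - e]] x.2].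
  apply: (@has_log_connected _ _ C w).
  - by apply: closedU => //; apply: closedU.
  - exact/vertical_connected/interval_is_interval.
  - apply/seteqP; split => // x [[/= xE]]; rewrite in_itv /= => h1 [|[Ax|]].
    + by apply: topx0 => //; exact: le_lt_trans h1 _.
    + by move: (mmin _ Ax xE); rewrite leNgt (le_lt_trans h1 z0m).
    + exact: segsx0.
  - split => //=; rewrite in_itv /=; apply: ltW; apply: lt_trans mN.
    by rewrite ltrN2.
  - by split => //=; rewrite in_itv /=.
  - apply: (@has_log_far _ _ _ N).
      by move=> x [[]//|[/AJ/JN//|/segsN]].
    by apply: far; rewrite normrN ger0_norm // ltW.
have clJ := compact_plane_closed kJ.
have log1 : has_log (J `|` (bot `|` LB)) z0.
  apply: has_log_glue => //.
    by apply: closedU => //; apply: closedU.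
  rewrite (_ : _ `&` _ = B); first exact: arc_connected hB.
  apply/seteqP; split=> x.
    by move=> [Jx [/(Jbot _ Jx)//|[//|/(Jsegs _ Jx)[->|->]]]].
  by move=> Bx; split; [exact: BJ|right; left].
have cLA : connected LA by apply: connected_whiskersU => //; exact: arc_connected hA.
have : has_log ((J `|` (bot `|` LB)) `|` (top `|` LA)) z0.
  apply: has_log_glue => //.
  - by apply: closedU => //; apply: closedU => //; apply: closedU.
  - by apply: closedU => //; apply: closedU.
  rewrite (_ : _ `&` _ = LA) //; apply/seteqP; split=> x.
    move=> [h [tx|//]]; case: h => [/Jtop//|[/(topbot _ tx)|[/BJ/Jtop//|]]]; by right.
  move=> LAx; split; last by right.
  by case: LAx => [/AJ|]; [left|right; right; right].
apply: has_log_sub => x /= /(frame_cover a b)[h|h]; first by right; left.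
by left; right; left.
Qed.
End Essential.

(** * Components of the complement *)

Section Jordan.
Variable R : realType.
Implicit Types (A B J K C U : set (plane R)) (a b c d x y z : plane R) (N s t : R).

Lemma ball_segment_connected x y (e : R) : `|x - y| < e ->
  exists S, [/\ connected S, S x, S y & forall u, S u -> `|x - u| < e].
Proof.
move=> xy.
exists ((fun t => x + t *: (y - x)) @` `[0, 1]); split.
- apply: connected_continuous_connected; first exact: segment_connected.
  apply: continuous_subspaceT => t; apply: cvgD; first exact: cvg_cst.
  by apply: cvgZ; [exact: cvg_id|exact: cvg_cst].
- by exists 0; rewrite ?scale0r ?addr0 //= in_itv /= lexx ler01.
- by exists 1; rewrite ?scale1r ?(addrC x) ?subrK //= in_itv /= lexx ler01.
move=> u [t /=]; rewrite in_itv /= => /andP[t0 t1] <-.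
rewrite opprD addrA subrr add0r normrN normrZ distrC.
by apply: le_lt_trans xy; rewrite ger0_norm // ler_piMl.
Qed.

Definition component_at K z := connected_component (~` K) z.

Lemma component_at_sub K z x : component_at K z x -> ~ K x.
Proof. exact: connected_component_sub. Qed.

Lemma component_at_refl K z : ~ K z -> component_at K z z.
Proof. exact: connected_component_refl. Qed.

Lemma component_at_max K z x C : connected C -> C z -> C x -> (forall u, C u -> ~ K u) ->
  component_at K z x.
Proof. by move=> cC Cz Cx CK; exact: (@connected_component_max _ _ C z). Qed.

Lemma component_at_extend K z x y (e : R) : (forall u, `|x - u| < e -> ~ K u) ->
  `|x - y| < e -> component_at K z y -> component_at K z x.
Proof.
move=> he xy zy; apply: connected_component_trans zy _.
have [S [cS Sx Sy hS]] := ball_segment_connected xy.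
by apply: (component_at_max cS) => // u /hS; exact: he.
Qed.

Lemma component_at_open K z : closed K -> open (component_at K z).
Proof.
move=> clK; rewrite openE => x zx; have Kx := component_at_sub zx.
have /nbhs_distP[e e0 he] : nbhs x (~` K).
  by apply: open_nbhs_nbhs; split; [exact: closed_openC|].
apply/nbhs_distP; exists e => // y xy.
apply: connected_component_trans zx _.
have [S [cS Sx Sy hS]] := ball_segment_connected xy.
by apply: (component_at_max cS) => // u /hS; exact: he.
Qed.

Lemma component_at_boundary K z : closed K ->
  closure (component_at K z) `\` component_at K z `<=` K.
Proof.
move=> clK x [cx nx]; apply: contrapT => Kx; apply: nx.
have nK : nbhs x (~` K) by apply: open_nbhs_nbhs; split; [exact: closed_openC|].
have /nbhs_distP[e e0 he] := nK.
have : nbhs x [set y | `|x - y| < e] by apply/nbhs_distP; exists e.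
by move=> /cx [y [zy xy]]; exact: component_at_extend he xy zy.
Qed.

Definition outside N : set (plane R) := [set x | N < `|x|].

(** For the maximum norm, the outside of a box is a union of four half-planes,
    the neighbouring ones of which meet. *)
Lemma outside_connected N : 0 <= N -> connected (outside N).
Proof.
move=> N0.
have prodc (I1 I2 : set R) : is_interval I1 -> is_interval I2 -> connected (I1 `*` I2).
  move=> i1 i2.
  have [[p [p1 p2]]|/nonemptyPn ->] := pselect ((I1 `*` I2) !=set0); last first.
    exact: connected0.
  have -> : I1 `*` I2 = \bigcup_(t in I1)
     ([set x : plane R | x.1 = t /\ I2 x.2] `|` [set x | I1 x.1 /\ x.2 = p.2]).
    apply/seteqP; split=> x.
      by move=> [x1 x2]; exists x.1 => //; left.
    by move=> [t It [[/= -> ?]|[/= ? ->]]].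
  apply: bigcup_connected.
    by exists p => t It; right.
  move=> t It; apply: connectedU.
  - by exists (t, p.2).
  - exact: vertical_connected.
  - exact: horizontal_connected.
have iT : is_interval [set: R] by [].
have iL : is_interval [set` `]-oo, - N[] by exact: interval_is_interval.
have iR : is_interval [set` `]N, +oo[] by exact: interval_is_interval.
have NN : - (N + 1) < - N by rewrite ltrN2 ltrDl.
have N1 : N < N + 1 by rewrite ltrDl.
have -> : outside N = ([set` `]-oo, - N[] `*` setT `|` setT `*` [set` `]-oo, - N[]) `|`
    ([set` `]N, +oo[] `*` setT `|` setT `*` [set` `]N, +oo[]).
  apply/seteqP; split=> x; rewrite /outside /= !in_itv /= prod_normE lt_max;
    rewrite !ltr_normr /= !andbT ![_ < - N]ltrNr.
    by move=> /orP[] /orP[] h; tauto.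
  by move=> [[[h _]|[_ h]]|[[h _]|[_ h]]]; rewrite h ?orbT.
apply: connectedU.
- exists (- (N + 1), N + 1); split.
    by left; split => //=; rewrite in_itv.
  by right; split => //=; rewrite in_itv /= andbT.
- apply: connectedU; [|exact: prodc|exact: prodc].
  by exists (- (N + 1), - (N + 1)); split; split => //=; rewrite in_itv.
- apply: connectedU; [|exact: prodc|exact: prodc].
  by exists (N + 1, N + 1); split; split => //=; rewrite in_itv /= andbT.
Qed.

Definition norm_bounded C := exists N, forall x, C x -> `|x| <= N.

Lemma norm_boundedE C : bounded_set C <-> norm_bounded C.
Proof.
split=> [[M [_ hM]]|[N hN]].
  by exists (M + 1) => x Cx; apply: hM => //; rewrite ltrDl.
exists N; split; first exact: num_real.
by move=> t Nt x Cx; apply: le_trans (hN _ Cx) (ltW Nt).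
Qed.

Lemma bounded_no_log K z : compact K -> ~ K z -> norm_bounded (component_at K z) ->
  ~ has_log K z.
Proof.
move=> cK Kz bK; have clK := compact_plane_closed cK.
apply: (@no_log_inside _ (component_at K z)) => //.
- exact: component_at_open.
- exact: component_at_refl.
- exact: component_at_boundary.
Qed.

Lemma unbounded_outside K z : compact K -> ~ norm_bounded (component_at K z) ->
  exists N, [/\ 0 <= N, forall x, K x -> `|x| <= N & outside N `<=` component_at K z].
Proof.
move=> cK ub; have [M hM] := compact_norm_bounded cK.
exists `|M|; split => //; first by move=> x /hM /le_trans; apply; exact: ler_norm.
have [x zx Mx] : exists2 x, component_at K z x & outside `|M| x.
  apply: contrapT => h; apply: ub; exists `|M| => x zx; rewrite leNgt.
  by apply/negP => Mx; apply: h; exists x.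
move=> y My; apply: connected_component_trans zx _.
apply: (component_at_max (outside_connected (normr_ge0 M))) => // u Mu /hM.
by apply/negP; rewrite -ltNge; apply: le_lt_trans Mu; exact: ler_norm.
Qed.

Lemma unbounded_log K z : compact K -> ~ norm_bounded (component_at K z) ->
  forall x, component_at K z x -> has_log K x.
Proof.
move=> cK ub x zx; have [N [N0 KN oN]] := unbounded_outside cK ub.
pose w : plane R := (2 * N + 1, 0).
have wn : `|w| = 2 * N + 1.
  have h : 0 <= 2 * N + 1 by rewrite addr_ge0 // mulr_ge0.
  by rewrite prod_normE /= normr0 ger0_norm // max_l.
apply: (@has_log_connected _ K (component_at K z) w).
- exact: compact_plane_closed.
- exact: component_connected.
- by apply/seteqP; split=> // u [/component_at_sub].
- by apply: oN; rewrite /outside /= wn ltr_pwDr // ler_peMl // ler1n.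
- by [].
by apply: (has_log_far KN); rewrite wn ltrDl.
Qed.

Lemma arc_shrink A a b O : simple_arc A a b -> nbhs a O ->
  exists c A1 A2, [/\ simple_arc A1 a c, simple_arc A2 c b, A = A1 `|` A2,
    forall x, A1 x -> A2 x -> x = c & A1 `<=` O].
Proof.
move=> [f [cf fI <- <- ->]] hO.
have /nbhs_distP[e e0 he] : nbhs 0 (f @^-1` O) by exact: cf.
pose s := Num.min e 1 / 2.
have d0 : 0 < Num.min e 1 by rewrite lt_min e0 ltr01.
have s0 : 0 < s by rewrite divr_gt0.
have s1 : s < 1 by rewrite ltr_pdivrMr // mul1r gt_min ltr1n orbT.
have se : s < e.
  by apply: lt_le_trans (_ : Num.min e 1 <= _);
    [rewrite ltr_pdivrMr // ltr_pMr // ltr1n|rewrite ge_min lexx].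
have [h1 h2 fE f12] := path_cut cf fI s0 s1.
exists (f s), (f @` `[0, s]), (f @` `[s, 1]); split => //.
move=> w [u /= uI <-]; apply: he; move: uI; rewrite in_itv /= sub0r normrN => /andP[u0 us].
by rewrite ger0_norm //; exact: le_lt_trans se.
Qed.

(** Cut the curve at [x] and at another point [d]; shortening both arcs at [x]
    and joining them at [d] leaves out only points close to [x]. *)
Lemma closed_curve_big_arc J x O : closed_curve J -> J x -> nbhs x O ->
  exists A c d, [/\ simple_arc A c d, A `<=` J & forall u, J u -> ~ O u -> A u].
Proof.
move=> cJ Jx hO.
have [d Jd xd] : exists2 d, J d & x <> d.
  have [p [q [A [B [hA _ _ ->]]]]] := cJ; have [Ap Aq pq] := arc_ends hA.
  have [xp|xp] := pselect (x = p); last by exists p => //; left.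
  by exists q; [left|rewrite xp].
have [A [B [hA hB AB JE]]] := closed_curve_split cJ Jx Jd xd.
have [c [A1 [A2 [h1 h2 AE A12 A1O]]]] := arc_shrink hA hO.
have [c' [B1 [B2 [g1 g2 BE B12 B1O]]]] := arc_shrink hB hO.
exists (A2 `|` B2), c, c'; split.
- apply: (arc_cat h2 (arc_rev g2)) => u u2 v2.
  have [E|//] : u = x \/ u = d by apply: AB; rewrite ?AE ?BE; right.
  have [A1x _ xc] := arc_ends h1; case: xc; rewrite -E; apply: A12 => //.
  by rewrite E.
- by rewrite JE AE BE => u [|]; [left|right]; right.
- by move=> u; rewrite JE AE BE => -[[/A1O//|]|[/B1O//|]]; [left|right].
Qed.

(** Otherwise the boundary of the component [C] of [z] is contained in an arc
    [A] of the curve, and [A] carries a branch for every point off it.  This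
    contradicts [no_log_inside] if [C] is bounded.  If [C] is unbounded, then
    the complement of [C] and [A] is a bounded open set with boundary in [A],
    and it contains the point provided by [exists_no_log]. *)
Lemma closed_curve_boundary J z : closed_curve J -> ~ J z -> J `<=` closure (component_at J z).
Proof.
move=> cJ Jz x Jx; apply: contrapT => cx.
have kJ := closed_curve_compact cJ; have clJ := compact_plane_closed kJ.
pose O := ~` closure (component_at J z).
have hO : nbhs x O.
  by apply: open_nbhs_nbhs; split => //; apply: closed_openC; exact: closed_closure.
have [A [c [d [hA AJ OA]]]] := closed_curve_big_arc cJ Jx hO.
have bdA : closure (component_at J z) `\` component_at J z `<=` A.
  move=> u [cu nu]; apply: OA; last by move=> /(_ cu).
  by apply: (@component_at_boundary J z).
have kA := arc_compact hA; have clA := compact_plane_closed kA.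
have oC : open (component_at J z) by exact: component_at_open.
have [bC|ub] := pselect (norm_bounded (component_at J z)).
  apply: (@no_log_inside _ (component_at J z) A z) => //; first exact: component_at_refl.
  by apply: arc_log hA _ => /AJ.
have [z0 Jz0 nlog] := exists_no_log cJ.
have [N [N0 KN oN]] := unbounded_outside kJ ub.
have clCA : closed (component_at J z `|` A).
  move=> u; rewrite closureU => -[cu|]; last by move=> /clA; right.
  by have [Cu|Cu] := pselect (component_at J z u); [left|right; exact: bdA].
apply: (@no_log_inside _ (~` (component_at J z `|` A)) A z0) => //.
- exact: closed_openC.
- move=> [Cz0|/AJ//]; apply: nlog; exact: unbounded_log ub _ Cz0.
- move=> u [cu /contrapT[Cu|//]].
  have /cu [v [nv Cv]] : nbhs u (component_at J z) by apply: open_nbhs_nbhs.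
  by case: nv; left.
- exists N => u nu; rewrite leNgt; apply/negP => /oN Cu; by apply: nu; left.
- by apply: arc_log hA _ => /AJ.
Qed.

(** As its component is bounded, a horizontal line through [z] meets the curve on
    both sides of [z]; take the first points met. *)
Lemma crosscut J z : closed_curve J -> ~ J z -> norm_bounded (component_at J z) ->
  exists A m p, [/\ simple_arc A m p, J m, J p
    & forall x, A x -> [\/ x = m, x = p | component_at J z x]].
Proof.
move=> cJ Jz [N hN]; have kJ := closed_curve_compact cJ.
have clJ := compact_plane_closed kJ.
have cfst K : {within K, continuous (fst : plane R -> R)}.
  exact/continuous_subspaceT/fst_continuous.
have zz := component_at_refl Jz.
have [p [Jp p2 zp] pmin] : exists2 p, [/\ J p, p.2 = z.2 & z.1 <= p.1] &
    forall x, J x -> x.2 = z.2 -> z.1 <= x.1 -> p.1 <= x.1.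
  have [| | |p + pmin] := @compact_EVT_min _ R fst
    (J `&` ([set x | x.2 = z.2] `&` [set x | z.1 <= x.1])).
  - apply: contrapT => h.
    pose w : plane R := (z.1 + `|z.1| + `|N| + 1, z.2).
    have zw : z.1 <= w.1 by rewrite /= -!addrA lerDl !addr_ge0.
    have : component_at J z w.
      apply: (@component_at_max _ _ _ [set x | [set` `[z.1, +oo[] x.1 /\ x.2 = z.2]).
      - exact/horizontal_connected/interval_is_interval.
      - by split => //=; rewrite in_itv /= lexx.
      - by split => //=; rewrite in_itv /= andbT.
      - by move=> u [/=]; rewrite in_itv /= andbT => h1 h2 Ju; apply: h; exists u.
    move=> /hN; rewrite plane_normP => /and4P[_ + _ _]; apply/negP; rewrite -ltNge /=.
    apply: le_lt_trans (ler_norm N) _; rewrite ltr_pwDr // -{1}[`|N|]add0r lerD2r.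
    by rewrite -[0](subrr z.1) lerD2l -normrN ler_norm.
  - apply: (subclosed_compact _ kJ); last by move=> ? [].
    apply: closedI => //; apply: closedI; first exact: closed_snd_eq.
    exact: closed_fst_ge.
  - exact: cfst.
  - rewrite inE => -[Jp [p2 zp]]; exists p => // x Jx x2 zx.
    by apply: pmin; rewrite inE.
have [m [Jm m2 mz] mmax] : exists2 m, [/\ J m, m.2 = z.2 & m.1 <= z.1] &
    forall x, J x -> x.2 = z.2 -> x.1 <= z.1 -> x.1 <= m.1.
  have [| | |m + mmax] := @compact_EVT_max _ R fst
    (J `&` ([set x | x.2 = z.2] `&` [set x | x.1 <= z.1])).
  - apply: contrapT => h.
    pose w : plane R := (z.1 - `|z.1| - `|N| - 1, z.2).
    have zw : w.1 <= z.1 by rewrite /= -!addrA -!opprD gerDl oppr_le0 !addr_ge0.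
    have : component_at J z w.
      apply: (@component_at_max _ _ _ [set x | [set` `]-oo, z.1]] x.1 /\ x.2 = z.2]).
      - exact/horizontal_connected/interval_is_interval.
      - by split => //=; rewrite in_itv /=.
      - by split => //=; rewrite in_itv /=.
      - by move=> u [/=]; rewrite in_itv /= => h1 h2 Ju; apply: h; exists u.
    move=> /hN; rewrite plane_normP => /and4P[+ _ _ _]; apply/negP; rewrite -ltNge /=.
    by have := ler_norm N; have := ler_norm z.1; clear; lra.
  - apply: (subclosed_compact _ kJ); last by move=> ? [].
    apply: closedI => //; apply: closedI; first exact: closed_snd_eq.
    exact: closed_fst_le.
  - exact: cfst.
  - rewrite inE => -[Jm [m2 mz]]; exists m => // x Jx x2 zx.
    by apply: mmax; rewrite inE.
have off x : J x -> x.2 = z.2 -> x.1 != z.1.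
  move=> Jx x2; apply/eqP => x1; apply: Jz.
  by rewrite [z]surjective_pairing -x1 -x2 -surjective_pairing.
have zp' : z.1 < p.1 by rewrite lt_neqAle eq_sym off.
have mz' : m.1 < z.1 by rewrite lt_neqAle off.
pose f t : plane R := (t, z.2).
have cf : continuous f by move=> t; apply: cvg_plane; [exact: cvg_id|exact: cvg_cst].
exists (f @` `[m.1, p.1]), m, p; split => //.
  have := @arc_path R f m.1 p.1 cf (lt_trans mz' zp').
  have -> : f m.1 = m by rewrite /f -m2 -surjective_pairing.
  have -> : f p.1 = p by rewrite /f -p2 -surjective_pairing.
  apply.
  by move=> u v _ _ [].
move=> w [t /= tI <-]; move: tI; rewrite in_itv /= => /andP[mt tp].
have [tm|tm] := eqVneq t m.1.
  by apply: Or31; rewrite /f tm -m2 -surjective_pairing.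
have [tp'|tp'] := eqVneq t p.1.
  by apply: Or32; rewrite /f tp' -p2 -surjective_pairing.
apply: Or33; apply: (@component_at_max _ _ _ [set x | [set` `]m.1, p.1[] x.1 /\ x.2 = z.2]).
- exact/horizontal_connected/interval_is_interval.
- by split => //=; rewrite in_itv /= mz'.
- by split => //=; rewrite in_itv /= !lt_neqAle eq_sym tm mt tp' tp.
move=> u [/=]; rewrite in_itv /= => /andP[mu up] u2 Ju.
have [h|/ltW h] := leP z.1 u.1.
  by move: (pmin _ Ju u2 h); rewrite leNgt up.
by move: (mmax _ Ju u2 h); rewrite leNgt mu.
Qed.
End Jordan.

(** * The Jordan curve theorem *)

Section JordanTheorem.
Variable R : realType.
Implicit Types (A B J K C U S : set (plane R)) (a b c d x y z : plane R) (N s t : R).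

(** Let [c] be a crosscut of the component of [z], from [m] to [p]; it cuts the
    curve into arcs [A1] and [A2].  An interior point [y] of [A2] is in the
    boundary of both the component of [z1] and the unbounded component, and off
    [A1] and [c]; so [z1] is connected to infinity off [A1] and [c], and has a
    branch there.  The same holds for [A2] and [c].  The two branches glue along
    [c] to a branch on the whole curve, although [z1] lies in a bounded
    component. *)
Lemma bounded_component_unique J z z1 : closed_curve J -> ~ J z -> ~ J z1 ->
  norm_bounded (component_at J z) -> norm_bounded (component_at J z1) -> component_at J z z1.
Proof.
move=> cJ Jz Jz1 bz bz1; apply: contrapT => zz1.
have kJ := closed_curve_compact cJ; have clJ := compact_plane_closed kJ.
have disj x : component_at J z x -> ~ component_at J z1 x.
  move=> zx z1x; apply: zz1; apply: connected_component_trans zx _.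
  exact: connected_component_sym.
have [c [m [p [hc Jm Jp cE]]]] := crosscut cJ Jz bz.
have [cm cp mp] := arc_ends hc.
have kc := arc_compact hc.
have step A1 A2 : arc_split J m p A1 A2 -> has_log (A1 `|` c) z1.
  move=> [h1 h2 A12 JE].
  have kK : compact (A1 `|` c) by apply: compactU => //; exact: arc_compact h1.
  have clK := compact_plane_closed kK.
  have A1J : A1 `<=` J by rewrite JE; left.
  have [y [A2y ym yp]] : exists y, [/\ A2 y, y <> m & y <> p].
    have [f [cf fI f0 f1 E]] := h2.
    have hI : (1 / 2 : R) \in `[0, 1] by rewrite in_itv /=; apply/andP; split; lra.
    have hI0 : (0 : R) \in `[0, 1] by rewrite in_itv /= lexx ler01.
    have hI1 : (1 : R) \in `[0, 1] by rewrite in_itv /= lexx ler01.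
    exists (f (1 / 2)); split; first by rewrite E; exists (1 / 2).
      by rewrite -f0 => /(fI _ _ hI hI0); clear; lra.
    by rewrite -f1 => /(fI _ _ hI hI1); clear; lra.
  have Jy : J y by rewrite JE; right.
  have Ky : ~ (A1 `|` c) y.
    case=> [A1y|/cE[//|//|/component_at_sub//]].
    by have [] := A12 _ A1y A2y.
  have /nbhs_distP[e e0 he] : nbhs y (~` (A1 `|` c)).
    by apply: open_nbhs_nbhs; split => //; exact: closed_openC.
  have ne : nbhs y [set x | `|y - x| < e] by apply/nbhs_distP; exists e.
  have [M hM] := compact_norm_bounded (compactU kJ kK).
  have M0 : 0 <= M by apply: le_trans (hM y _); [exact: normr_ge0|left].
  pose w : plane R := (2 * M + 1, 0).
  have wn : `|w| = 2 * M + 1.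
    have h : 0 <= 2 * M + 1 by rewrite addr_ge0 // mulr_ge0.
    by rewrite prod_normE /= normr0 ger0_norm // max_l.
  have Mw : 2 * M < `|w| by rewrite wn ltrDl.
  have Jw : ~ J w.
    move=> Jw; have := hM _ (or_introl Jw); rewrite wn leNgt ltr_pwDr //.
    by rewrite ler_peMl // ler1n.
  have logw K : (forall x, K x -> `|x| <= M) -> has_log K w by move=> /has_log_far; apply.
  have zw : ~ component_at J z w.
    move=> zw; apply: (bounded_no_log kJ Jz bz).
    apply: (@has_log_connected _ J (component_at J z) w z) => //.
    - exact: component_connected.
    - by apply/seteqP; split=> // u [/component_at_sub].
    - exact: component_at_refl.
    - by apply: logw => x Jx; apply: hM; left.
  have offK q : ~ component_at J z q -> ~ J q -> component_at J q `&` (A1 `|` c) = set0.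
    move=> zq Jq; apply/seteqP; split=> // u [qu [/A1J|/cE[E|E|zu]]].
    - exact: component_at_sub qu.
    - by move: Jm; rewrite -E; exact: component_at_sub qu.
    - by move: Jp; rewrite -E; exact: component_at_sub qu.
    - apply: zq; apply: connected_component_trans zu _.
      exact: connected_component_sym.
  have [v [wv yv]] := closed_curve_boundary cJ Jw Jy ne.
  have [u [z1u yu]] := closed_curve_boundary cJ Jz1 Jy ne.
  have near v1 v2 : `|y - v1| < e -> `|y - v2| < e ->
      has_log (A1 `|` c) v1 -> has_log (A1 `|` c) v2.
    move=> e1 e2.
    have [S1 [cS1 S1y S1v hS1]] := ball_segment_connected e1.
    have [S2 [cS2 S2y S2v hS2]] := ball_segment_connected e2.
    apply: (@has_log_connected _ _ (S1 `|` S2)) => //.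
    - by apply: connectedU => //; exists y.
    - by apply/seteqP; split=> // q [[/hS1|/hS2] /he].
    - by left.
    - by right.
  apply: (@has_log_connected _ _ (component_at J z1) u) => //.
  - exact: component_connected.
  - exact: offK.
  - exact: component_at_refl.
  apply: near yv yu _.
  apply: (@has_log_connected _ _ (component_at J w) w) => //.
  - exact: component_connected.
  - exact: offK.
  - exact: component_at_refl.
  - by apply: logw => x Kx; apply: hM; right.
have [A1 [A2 sJ]] := closed_curve_split cJ Jm Jp mp.
apply: (bounded_no_log kJ Jz1 bz1).
have [h1 h2 A12 JE] := sJ.
apply: (@has_log_sub _ ((A1 `|` c) `|` (A2 `|` c))).
  by rewrite JE => x [|]; [left|right]; left.
have clU A a b : simple_arc A a b -> closed (A `|` c).
  move=> hA; apply: closedU; apply: compact_plane_closed => //.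
  exact: arc_compact hA.
apply: has_log_glue; [exact: clU h1|exact: clU h2| |exact: step sJ|].
  rewrite (_ : _ `&` _ = c); first exact: arc_connected hc.
  apply/seteqP; split=> x; last by move=> cx; split; right.
  by move=> [[A1x|//] [A2x|//]]; have [->|->] := A12 _ A1x A2x.
exact: step (arc_splitC sJ).
Qed.

Lemma Int_component J : closed_curve J ->
  exists z, [/\ ~ J z, Int J = component_at J z & norm_bounded (component_at J z)].
Proof.
move=> cJ; have kJ := closed_curve_compact cJ.
have [z Jz nz] := exists_no_log cJ; exists z.
have bz : norm_bounded (component_at J z).
  by apply: contrapT => ub; apply: nz; apply: unbounded_log ub _ (component_at_refl Jz).
split=> //; apply: xget_unique.
  by split; [exists z|exact/norm_boundedE].
move=> C [[x Jx ->] /norm_boundedE bx].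
by apply: same_connected_component; exact: bounded_component_unique.
Qed.

Lemma Ext_component J : closed_curve J ->
  exists z, [/\ ~ J z, Ext J = component_at J z & ~ norm_bounded (component_at J z)].
Proof.
move=> cJ; have kJ := closed_curve_compact cJ.
have [M hM] := compact_norm_bounded kJ.
pose pt N : plane R := (`|N| + 1, 0).
have ptn' N : `|N| < `|pt N|.
  rewrite prod_normE /= lt_max; apply/orP; left.
  by rewrite [X in _ < X]ger0_norm ?addr_ge0 // ltrDl.
have ptn N : N < `|pt N| := le_lt_trans (ler_norm N) (ptn' N).
have Jz : ~ J (pt M) by move=> /hM; apply/negP; rewrite -ltNge.
have meet N N' : exists2 x, outside N x & outside N' x.
  exists (pt (Num.max N N')); apply: le_lt_trans (ptn _); by rewrite le_max lexx ?orbT.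
exists (pt M).
have ub : ~ norm_bounded (component_at J (pt M)).
  move=> [N hN]; have [x Nx M'x] := meet N `|M|.
  have : component_at J (pt M) x.
    apply: (component_at_max (outside_connected (normr_ge0 M)) (ptn' M) M'x).
    move=> u Mu /hM; apply/negP; rewrite -ltNge; apply: le_lt_trans Mu.
    exact: ler_norm.
  by move=> /hN; apply/negP; rewrite -ltNge.
split => //; apply: xget_unique.
  by split; [exists (pt M)|move=> /norm_boundedE].
move=> C [[x Jx ->] ux].
have {}ux : ~ norm_bounded (component_at J x) by move=> /norm_boundedE.
have [N [_ _ oN]] := unbounded_outside kJ ub.
have [N' [_ _ oN']] := unbounded_outside kJ ux.
have [q /oN q1 /oN' q2] := meet N N'.
apply: same_connected_component; apply: connected_component_trans q2 _.
exact: connected_component_sym.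
Qed.

Section Curve.
Variables (J : set (plane R)) (cJ : closed_curve J).

Let kJ := closed_curve_compact cJ.
Let clJ := compact_plane_closed kJ.

Lemma Int_open : open (Int J).
Proof. by have [z [_ -> _]] := Int_component cJ; exact: component_at_open. Qed.
Lemma Ext_open : open (Ext J).
Proof. by have [z [_ -> _]] := Ext_component cJ; exact: component_at_open. Qed.
Lemma Int_connected : connected (Int J).
Proof. by have [z [_ -> _]] := Int_component cJ; exact: component_connected. Qed.
Lemma Ext_connected : connected (Ext J).
Proof. by have [z [_ -> _]] := Ext_component cJ; exact: component_connected. Qed.
Lemma Int_nonempty : Int J !=set0.
Proof. by have [z [Jz -> _]] := Int_component cJ; exists z; exact: component_at_refl. Qed.
Lemma Int_off x : Int J x -> ~ J x.
Proof. by have [z [_ -> _]] := Int_component cJ; exact: component_at_sub. Qed.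
Lemma Ext_off x : Ext J x -> ~ J x.
Proof. by have [z [_ -> _]] := Ext_component cJ; exact: component_at_sub. Qed.
Lemma closure_Int : J `<=` closure (Int J).
Proof. by have [z [Jz -> _]] := Int_component cJ; exact: closed_curve_boundary. Qed.
Lemma closure_Ext : J `<=` closure (Ext J).
Proof. by have [z [Jz -> _]] := Ext_component cJ; exact: closed_curve_boundary. Qed.

Lemma Int_no_log x : Int J x -> ~ has_log J x.
Proof.
have [z [Jz -> bz]] := Int_component cJ => zx; have Jx := component_at_sub zx.
apply: bounded_no_log => //.
by rewrite /component_at -(same_connected_component zx).
Qed.
Lemma Ext_log x : Ext J x -> has_log J x.
Proof. by have [z [Jz -> uz]] := Ext_component cJ; exact: unbounded_log. Qed.

Lemma Int_or_Ext x : ~ J x -> Int J x \/ Ext J x.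
Proof.
move=> Jx; have [bx|ub] := pselect (norm_bounded (component_at J x)).
  by left; have [z [Jz -> bz]] := Int_component cJ; exact: bounded_component_unique.
right; have [z [Jz -> uz]] := Ext_component cJ.
have [N [N0 _ oN]] := unbounded_outside kJ ub.
have [N' [N'0 _ oN']] := unbounded_outside kJ uz.
pose w : plane R := (N + N' + 1, 0).
have wn : `|w| = N + N' + 1 by rewrite prod_normE /= normr0 ger0_norm ?max_l ?addr_ge0.
have zw : component_at J z w by apply: oN'; rewrite /outside /= wn ltr_pwDr // lerDr.
apply: connected_component_trans zw _; apply: connected_component_sym; apply: oN.
by rewrite /outside /= wn ltr_pwDr // lerDl.
Qed.

Lemma Int_not_Ext x : Int J x -> ~ Ext J x.
Proof. by move=> /Int_no_log nl /Ext_log. Qed.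

Lemma sub_Int S x : connected S -> (forall u, S u -> ~ J u) -> S x -> Int J x ->
  S `<=` Int J.
Proof.
have [z [Jz -> _]] := Int_component cJ => cS SJ Sx zx u Su.
by apply: connected_component_trans zx _; exact: component_at_max cS Sx Su SJ.
Qed.
Lemma sub_Ext S x : connected S -> (forall u, S u -> ~ J u) -> S x -> Ext J x ->
  S `<=` Ext J.
Proof.
have [z [Jz -> _]] := Ext_component cJ => cS SJ Sx zx u Su.
by apply: connected_component_trans zx _; exact: component_at_max cS Sx Su SJ.
Qed.

Lemma Ext_outside : exists2 N, 0 <= N & outside N `<=` Ext J.
Proof.
have [z [Jz -> uz]] := Ext_component cJ.
by have [N [N0 _ oN]] := unbounded_outside kJ uz; exists N.
Qed.

Lemma closure_Int_off x : closure (Int J) x -> ~ J x -> Int J x.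
Proof.
move=> cx Jx; have [//|Ex] := Int_or_Ext Jx.
have /cx [u [Iu Eu]] : nbhs x (Ext J) by apply: open_nbhs_nbhs; split => //; exact: Ext_open.
by case: (Int_not_Ext Iu).
Qed.
Lemma closure_Ext_off x : closure (Ext J) x -> ~ J x -> Ext J x.
Proof.
move=> cx Jx; have [Ix|//] := Int_or_Ext Jx.
have /cx [u [Eu Iu]] : nbhs x (Int J) by apply: open_nbhs_nbhs; split => //; exact: Int_open.
by case: (Int_not_Ext Iu).
Qed.

End Curve.

(** This replaces the additivity of winding numbers: outside both [C2] and [C3]
    there are branches on both, which glue. *)
Lemma Int_cocycle C1 C2 C3 z : closed_curve C1 -> closed_curve C2 -> closed_curve C3 ->
  C1 `<=` C2 `|` C3 -> connected (C2 `&` C3) -> ~ C2 z -> ~ C3 z ->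
  Int C1 z -> Int C2 z \/ Int C3 z.
Proof.
move=> h1 h2 h3 sub cc n2 n3 I1.
have [|E2] := Int_or_Ext h2 n2; first by left.
have [|E3] := Int_or_Ext h3 n3; first by right.
case: (Int_no_log h1 I1); apply: (has_log_sub sub).
apply: has_log_glue => //.
- exact: (compact_plane_closed (closed_curve_compact h2)).
- exact: (compact_plane_closed (closed_curve_compact h3)).
- exact: Ext_log.
- exact: Ext_log.
Qed.

Lemma Ext_sub C1 C2 : closed_curve C1 -> closed_curve C2 ->
  (forall u, C2 u -> ~ Ext C1 u) -> Ext C1 `<=` Ext C2.
Proof.
move=> h1 h2 off.
have [N N0 oN] := Ext_outside h1; have [N' N'0 oN'] := Ext_outside h2.
pose w : plane R := (N + N' + 1, 0).
have wn : `|w| = N + N' + 1 by rewrite prod_normE /= normr0 ger0_norm ?max_l ?addr_ge0.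
apply: (@sub_Ext _ h2 _ w (Ext_connected h1)).
- by move=> u E1 /off.
- by apply: oN; rewrite /outside /= wn ltr_pwDr // lerDl.
- by apply: oN'; rewrite /outside /= wn ltr_pwDr // lerDr.
Qed.

(** If [C2] has no point outside [C1], then the outside of [C1] is part of the
    outside of [C2]; every point of [C1] is a limit of points outside [C1]. *)
Lemma arc_outside_other C1 C2 : closed_curve C1 -> closed_curve C2 ->
  C2 `\` C1 `<=` Int C1 -> C1 `\` C2 `<=` Ext C2.
Proof.
move=> h1 h2 D1.
have E12 : Ext C1 `<=` Ext C2.
  apply: Ext_sub => // u C2u E1; have n1 := Ext_off h1 E1.
  by apply: (Int_not_Ext h1 _ E1); exact: D1.
by move=> x [x1 x2]; apply: closure_Ext_off => //; exact/(closureS E12)/closure_Ext.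
Qed.

(** Suppose that each of the three arcs of the theta-shaped set is outside the
    curve formed by the two others.  A point inside [C1] is then off the other
    two curves, hence, by [Int_cocycle], inside one of them, say [C2]; so is all
    of the inside of [C1], and all of [C1] is in the closure of the inside of
    [C2]. *)
Lemma theta_some_inside C1 C2 C3 :
  closed_curve C1 -> closed_curve C2 -> closed_curve C3 ->
  C1 `<=` C2 `|` C3 -> C2 `<=` C1 `|` C3 -> C3 `<=` C1 `|` C2 ->
  connected (C2 `&` C3) -> C1 `\` C2 !=set0 -> C1 `\` C3 !=set0 ->
  C2 `\` C1 `<=` Ext C1 -> C1 `\` C2 `<=` Ext C2 -> C1 `\` C3 `<=` Ext C3 -> False.
Proof.
move=> h1 h2 h3 s1 s2 s3 cc [x2 D2x] [x3 D3x] E1 E2 E3.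
have off2 u : Int C1 u -> ~ C2 u.
  by move=> I1 C2u; apply: (Int_not_Ext h1 I1); apply: E1; split=> //; exact: Int_off I1.
have off3 u : Int C1 u -> ~ C3 u.
  move=> I1 C3u; have n1 := Int_off h1 I1; apply: (off2 _ I1).
  by case: (s3 _ C3u).
have [z I1] := Int_nonempty h1.
have [I2|I3] := Int_cocycle h1 h2 h3 s1 cc (off2 _ I1) (off3 _ I1) I1.
  have sub : Int C1 `<=` Int C2 := sub_Int h2 (Int_connected h1) off2 I1 I2.
  apply: (Int_not_Ext h2 _ (E2 _ D2x)); case: D2x => [C1x C2x].
  by apply: closure_Int_off => //; exact/(closureS sub)/closure_Int.
have sub : Int C1 `<=` Int C3 := sub_Int h3 (Int_connected h1) off3 I1 I3.
apply: (Int_not_Ext h3 _ (E3 _ D3x)); case: D3x => [C1x C3x].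
by apply: closure_Int_off => //; exact/(closureS sub)/closure_Int.
Qed.
End JordanTheorem.

(** * Two lines that differ by portions *)

Section Lines.
Variable R : realType.
Implicit Types (g h k p E : set (plane R)) (s t u v w : R).

Definition chart g (f : R -> plane R) (f' : plane R -> R) :=
  [/\ continuous f, range f = g, cancel f f' & {within g, continuous f'}].

Lemma continuous_within_comp (T U V : topologicalType) (A : set T) (B : set U)
  (f : T -> U) (f' : U -> V) : continuous f -> (forall x, A x -> B (f x)) ->
  {within B, continuous f'} -> {within A, continuous (f' \o f)}.
Proof.
move=> cf AB /subspace_continuousP cf'; apply/subspace_continuousP => x Ax W hW.
have hB := cf' _ (AB _ Ax) _ hW.
have hA : nbhs x (f @^-1` [set y | B y -> W (f' y)]) := cf x _ hB.
by apply: filterS hA => y /= By Ay; apply: By; exact: AB.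
Qed.

Lemma continuous_closure_image (T U : topologicalType) (f : T -> U) (A : set T) :
  continuous f -> f @` closure A `<=` closure (f @` A).
Proof.
move=> cf _ [x cx <-] W hW; have [y [Ay Wy]] := cx _ (cf x _ hW).
by exists (f y); split => //; exists y.
Qed.

Lemma closure_oo s t : s < t -> closure [set` `]s, t[] = [set` `[s, t]].
Proof.
move=> st; apply/seteqP; split; first exact: itv_closure.
move=> u /=; rewrite in_itv /= => /andP[su ut] W /nbhs_distP[e e0 he].
pose d := Num.min (e / 2) ((t - s) / 2).
have d0 : 0 < d by rewrite lt_min !divr_gt0 ?subr_gt0.
have [d1 d2] : d <= e / 2 /\ d <= (t - s) / 2 by rewrite !ge_min !lexx orbT.
have [h|h] := leP u ((s + t) / 2).
  exists (u + d / 2); split.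
    by rewrite /= in_itv /=; apply/andP; split; clear -d0 d2 su h; lra.
  apply: he; rewrite opprD addrA subrr sub0r normrN gtr0_norm ?divr_gt0 //.
  by clear -d0 d1 e0; lra.
exists (u - d / 2); split.
  by rewrite /= in_itv /=; apply/andP; split; clear -d0 d2 ut h; lra.
apply: he; rewrite opprB addrC subrK gtr0_norm ?divr_gt0 //.
by clear -d0 d1 e0; lra.
Qed.

Lemma open_bounded_interval (I : set R) : open I -> is_interval I ->
  (exists M, forall u, I u -> `|u| <= M) -> exists s t, I = [set` `]s, t[].
Proof.
move=> oI iI [M hM].
have [I0|/nonemptyPn ->] := pselect (I !=set0); last first.
  exists 0, 0; apply/seteqP; split=> u //=.
  by rewrite in_itv /= => /andP[/lt_trans/[apply]]; rewrite ltxx.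
have lbI : has_lbound I by exists (- M) => u /hM; rewrite ler_norml => /andP[].
have ubI : has_ubound I by exists M => u /hM; rewrite ler_norml => /andP[].
exists (inf I), (sup I); apply/seteqP; split=> u /=; rewrite in_itv /=.
  move=> Iu; have /nbhs_distP[e e0 he] : nbhs u I by apply: open_nbhs_nbhs.
  have I1 : I (u - e / 2).
    apply: he; rewrite opprB addrC subrK gtr0_norm ?divr_gt0 //.
    by clear -e0; lra.
  have I2 : I (u + e / 2).
    apply: he; rewrite opprD addrA subrr sub0r normrN gtr0_norm ?divr_gt0 //.
    by clear -e0; lra.
  apply/andP; split.
    by apply: le_lt_trans (ge_inf lbI I1) _; clear -e0; lra.
  by apply: lt_le_trans (ub_le_sup ubI I2); clear -e0; lra.
move=> /andP[/(inf_lt I0)[v Iv vu] /(sup_gt I0)[w Iw uw]].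
by apply: (iI v w) => //; rewrite !ltW.
Qed.

Lemma portion_interval g p f f' : chart g f f' -> portion g p ->
  exists s t, p = f @` `]s, t[.
Proof.
move=> [cf fg ff' cf'] [pg op cp kp].
have gf u : g (f u) by rewrite -fg; exists u.
have pE : p = f @` [set f' x | x in p].
  apply/seteqP; split=> x.
    move=> px; have := pg _ px; rewrite -fg => -[u _ fu].
    by exists (f' x); [exists x|rewrite -fu ff'].
  move=> [_ [y py <-] <-]; have := pg _ py; rewrite -fg => -[u _ fu].
  by rewrite -fu ff' fu.
have preE : [set f' x | x in p] = f @^-1` p.
  apply/seteqP; split=> u; last by move=> /= pu; exists (f u).
  move=> [x px <-] /=; have := pg _ px; rewrite -fg => -[v _ fv].
  by rewrite -fv ff' fv.
have [|||s [t st]] := @open_bounded_interval [set f' x | x in p].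
- rewrite preE; move/open_subspaceP : op => [V oV VE].
  have -> : f @^-1` p = f @^-1` V.
    apply/seteqP; split=> u /= h.
      by have [] : (V `&` g) (f u) by rewrite VE.
    by have [] : (p `&` g) (f u) by rewrite -VE.
  by apply: open_comp => // u _; exact: cf.
- apply/connected_intervalP.
  apply: (@connected_continuous_connected (subspace g) R p f' cp).
  exact: continuous_subspaceT.
- have kc : compact (closure (p : set (subspace g))) by rewrite -precompactE.
  have := @continuous_compact (subspace g) R f' _ (continuous_subspaceT cf') kc.
  move=> /compact_bounded[M [_ hM]]; exists (M + 1) => u [x px <-].
  by apply: hM; [rewrite ltrDl|exists x => //; exact: subset_closure].
by exists s, t; rewrite {1}pE st.
Qed.

(** The relation between two distinct members of the family. *)
Definition fellow g h := [/\ topological_line g, topological_line h, g <> h,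
  portion g (g `\` h) & portion h (h `\` g)].

Lemma fellowC g h : fellow g h -> fellow h g.
Proof. by move=> [? ? ? ? ?]; split => //; exact: nesym. Qed.

(** If [g] were contained in [h], then [h] minus [g] would be a nonempty open
    interval of [h] that separates the connected set [g]. *)
Lemma fellow_interval g h f f' : fellow g h -> chart g f f' ->
  exists s t, s < t /\ g `\` h = f @` `]s, t[.
Proof.
move=> [_ [fh [fh' ch]] gh pg ph] cg.
have [s [t E]] := portion_interval cg pg.
have [s' [t' E']] := portion_interval ch ph.
have [st|ts] := ltP s t; first by exists s, t.
exfalso.
have sub : g `<=` h.
  move=> x gx; apply: contrapT => hx; have : (g `\` h) x by [].
  rewrite E => -[u /=]; rewrite in_itv /= => /andP[su ut].
  by move: (lt_trans su ut); rewrite ltNge ts.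
have [st'|ts'] := ltP s' t'; last first.
  apply: gh; apply/seteqP; split => // x hx; apply: contrapT => gx.
  have : (h `\` g) x by []. rewrite E' => -[u /=]; rewrite in_itv /= => /andP[su ut].
  by move: (lt_trans su ut); rewrite ltNge ts'.
have [cf fg ff' cf'] := cg; have [cfh fhh ffh cfh'] := ch.
have outE u : u \notin `]s', t'[ -> g (fh u).
  move=> nu; apply: contrapT => gu.
  have : (h `\` g) (fh u) by split => //; rewrite -fhh; exists u.
  by rewrite E' => -[v vI /(can_inj ffh) vu]; move: nu; rewrite -vu vI.
have cgc : connected g.
  rewrite -fg; apply: connected_continuous_connected; last exact: continuous_subspaceT.
  by apply/connected_intervalP.
have : connected (fh' @` g).
  by apply: connected_continuous_connected => //; exact: continuous_subspaceW cfh'.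
move=> /connected_intervalP iv.
have mid : s' <= (s' + t') / 2 <= t' by clear -st'; apply/andP; split; lra.
have [||x gx xm] := iv s' t' _ _ _ mid.
- by exists (fh s'); rewrite ?ffh //; apply: outE; rewrite in_itv /= ltxx.
- by exists (fh t'); rewrite ?ffh //; apply: outE; rewrite in_itv /= ltxx andbF.
have hx := sub _ gx; move: (hx); rewrite -fhh => -[v _ vx].
have : (h `\` g) x.
  rewrite E'; exists v => //=; move: xm; rewrite -vx ffh => ->.
  by rewrite in_itv /=; clear -st'; apply/andP; split; lra.
by case.
Qed.

(** Let [c] be the parameter on [h] of the endpoint [f u].  If [c] were not an
    endpoint of the interval cut out by [h `\` g], all of [h] near [c] would lie
    on [g].  The change of parameter from [h] to [g] is continuous and injective
    there, hence strictly monotone, and takes values on both sides of [u]; but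
    on one side of [u] the line [g] leaves [h]. *)
Lemma fellow_endpoint g h f f' fh fh' s t s' t' u :
  chart g f f' -> chart h fh fh' -> s < t -> s' < t' ->
  g `\` h = f @` `]s, t[ -> h `\` g = fh @` `]s', t'[ ->
  u = s \/ u = t -> f u = fh s' \/ f u = fh t'.
Proof.
move=> [cf fg ff' cf'] [ch fhh ffh' ch'] st st' E E' ust.
have gf v : g (f v) by rewrite -fg; exists v.
have hf v : h (fh v) by rewrite -fhh; exists v.
have hu : h (f u).
  apply: contrapT => nh; have : (g `\` h) (f u) by [].
  rewrite E => -[v /= vI /(can_inj ff') vu]; move: vI; rewrite vu in_itv /=.
  by case: ust => ->; rewrite ltxx ?andbF.
move: (hu); rewrite -fhh => -[c _ cE].
apply: contrapT => /not_orP[ns nt].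
have cout : c < s' \/ t' < c.
  have [|cs] := ltP c s'; first by left.
  have [|tc] := ltP t' c; first by right.
  have cs' : s' != c by apply/eqP => e; apply: ns; rewrite -cE e.
  have ct' : c != t' by apply/eqP => e; apply: nt; rewrite -cE e.
  have : (h `\` g) (fh c).
    rewrite E'; exists c => //=.
    by rewrite in_itv /= !lt_neqAle cs' cs ct' tc.
  by rewrite cE => -[].
have [d d0 hd] : exists2 d, 0 < d & forall v, c - d <= v <= c + d -> v \notin `]s', t'[.
  case: cout => cc.
    exists ((s' - c) / 2); first by rewrite divr_gt0 ?subr_gt0.
    move=> v /andP[_ hv]; rewrite in_itv /= negb_and -leNgt; apply/orP; left.
    by clear -hv cc; lra.
  exists ((c - t') / 2); first by rewrite divr_gt0 ?subr_gt0.
  move=> v /andP[hv _]; rewrite in_itv /= negb_and -!leNgt; apply/orP; right.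
  by clear -hv cc; lra.
pose k := f' \o fh.
have inI v : v \in `[c - d, c + d] -> g (fh v).
  rewrite in_itv /= => vI; apply: contrapT => ng.
  have : (h `\` g) (fh v) by [].
  by rewrite E' => -[w wI /(can_inj ffh') wv]; move: (hd _ vI); rewrite -wv wI.
have kf v : v \in `[c - d, c + d] -> f (k v) = fh v.
  by move=> /inI; rewrite -fg => -[w _ wE]; rewrite /k /= -wE ff'.
have ck : {within [set` `[c - d, c + d]], continuous k}.
  by apply: (continuous_within_comp (B := g)).
have ik : {in `[c - d, c + d] &, injective k}.
  by move=> v w vI wI kk; apply: (can_inj ffh'); rewrite -!kf // kk.
have cI : c \in `[c - d, c + d] by rewrite in_itv /=; clear -d0; apply/andP; split; lra.
have lI : c - d \in `[c - d, c + d] by rewrite in_itv /=; clear -d0; apply/andP; split; lra.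
have rI : c + d \in `[c - d, c + d] by rewrite in_itv /=; clear -d0; apply/andP; split; lra.
have kc : k c = u by rewrite /k /= cE ff'.
have kout v : v \in `[c - d, c + d] -> k v \notin `]s, t[.
  move=> vI; apply/negP => kI; have : (g `\` h) (f (k v)) by rewrite E; exists (k v).
  by rewrite kf // => -[].
have [x1 [x2 [x1I x2I x1u ux2]]] : exists x1 x2, [/\ x1 \in `[c - d, c + d],
    x2 \in `[c - d, c + d], k x1 < u & u < k x2].
  have cl : c - d < c by rewrite gtrBl.
  have cr : c < c + d by rewrite ltrDl.
  have [mono|mono] := itv_continuous_inj_mono ck ik.
    by exists (c - d), (c + d); split => //; rewrite -kc; apply: mono.
  by exists (c + d), (c - d); split => //; rewrite -kc; apply: mono.
have /connected_intervalP iK :=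
  connected_continuous_connected (@segment_connected R (c - d) (c + d)) ck.
have hit w : w \in `]s, t[ -> k x1 <= w <= k x2 -> False.
  move=> wI ww; have [||v vI vw] := iK (k x1) (k x2) _ _ w ww; [by exists x1|by exists x2|].
  by have := kout _ vI; rewrite vw wI.
case: ust => uE; rewrite uE in x1u ux2.
  have [h2|h2] := ltP (k x2) t.
    by apply: (hit (k x2)); rewrite ?lexx ?andbT ?in_itv /= ?ux2 ?h2 ?(ltW (lt_trans x1u ux2)).
  apply: (hit ((s + t) / 2)); first by rewrite in_itv /=; clear -st; apply/andP; split; lra.
  by clear -st x1u h2; apply/andP; split; lra.
have [h2|h2] := ltP s (k x1).
  by apply: (hit (k x1)); rewrite ?lexx ?in_itv /= ?x1u ?h2 ?(ltW (lt_trans x1u ux2)).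
apply: (hit ((s + t) / 2)); first by rewrite in_itv /=; clear -st; apply/andP; split; lra.
by clear -st ux2 h2; apply/andP; split; lra.
Qed.
End Lines.

(** * The closed curve of two lines *)

Section Curves.
Variable R : realType.
Implicit Types (g h k p E : set (plane R)) (s t u v w : R).

(** The endpoints of the portion [g `\` h], described without a parameter. *)
Definition seam g h := closure (g `\` h) `&` h.

Lemma symdiff_closureE g h :
  symdiff_closure g h = closure (g `\` h) `|` closure (h `\` g).
Proof. by rewrite /symdiff_closure setY_def closureU. Qed.

Lemma symdiff_closureC g h : symdiff_closure g h = symdiff_closure h g.
Proof. by rewrite !symdiff_closureE setUC. Qed.

Lemma closed_symdiff g h : closed (symdiff_closure g h).
Proof. exact: closed_closure. Qed.

Lemma symdiff_sub g h : g `\` h `<=` symdiff_closure g h.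
Proof. by rewrite symdiff_closureE => x gx; left; exact: subset_closure. Qed.

Lemma symdiff_closure_triangle g h k :
  symdiff_closure g h `<=` symdiff_closure g k `|` symdiff_closure h k.
Proof.
rewrite /symdiff_closure -closureU; apply: closureS => x; rewrite !setY_def.
have [kx|kx] := pselect (k x).
  by move=> [[gx hx]|[hx gx]]; [right|left]; right.
by move=> [[gx hx]|[hx gx]]; [left|right]; left.
Qed.

Lemma fellow_param g h f f' : fellow g h -> chart g f f' ->
  exists s t, [/\ s < t, g `\` h = f @` `]s, t[, closure (g `\` h) = f @` `[s, t]
    & seam g h = [set f s; f t]].
Proof.
move=> gh cg; have [s [t [st E]]] := fellow_interval gh cg.
have [cf fg ff' cf'] := cg.
have cE : closure (g `\` h) = f @` `[s, t].
  rewrite E; apply/seteqP; split.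
    have cl : closed (f @` [set` `[s, t]]).
      apply: compact_plane_closed; apply: continuous_compact; last exact: segment_compact.
      exact: continuous_subspaceT.
    rewrite [X in _ `<=` X](closure_id _).1 //; apply: closureS => x [u /= uI <-].
    by exists u => //=; move: uI; rewrite !in_itv /= => /andP[/ltW -> /ltW ->].
  by rewrite -closure_oo //; exact: continuous_closure_image.
have hN u : h (f u) <-> u \notin `]s, t[.
  split=> [hu|nu].
    apply/negP => uI; have : (g `\` h) (f u) by rewrite E; exists u.
    by case.
  apply: contrapT => nh; have : (g `\` h) (f u) by split => //; rewrite -fg; exists u.
  by rewrite E => -[v vI /(can_inj ff') vu]; move: nu; rewrite -vu vI.
exists s, t; split => //; rewrite /seam cE; apply/seteqP; split=> x.
  move=> [[u /= + <-]] /hN; rewrite !in_itv /= !lt_neqAle => /andP[-> ->].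
  rewrite !andbT negb_and !negbK => /orP[/eqP <-|/eqP ->]; by [left|right].
move=> [->|->]; split.
- by exists s => //=; rewrite in_itv /= lexx ltW.
- by apply/hN; rewrite in_itv /= ltxx.
- by exists t => //=; rewrite in_itv /= lexx ltW.
- by apply/hN; rewrite in_itv /= ltxx andbF.
Qed.

Lemma seam_sub g h : fellow g h -> seam g h `<=` seam h g.
Proof.
move=> gh; have hg := fellowC gh.
have [[f [f' [cf fg ff' cf']]] [fh [fh' [cfh fhh ffh cfh']]] _ _ _] := gh.
have cg : chart g f f' by [].
have ch : chart h fh fh' by [].
have [s [t [st E _ ->]]] := fellow_param gh cg.
have [s' [t' [st' E' _ ->]]] := fellow_param hg ch.
by move=> x [->|->]; apply: (fellow_endpoint cg ch st st' E E'); [left|right].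
Qed.

Lemma seamC g h : fellow g h -> seam g h = seam h g.
Proof. by move=> gh; apply/seteqP; split; apply: seam_sub => //; exact: fellowC. Qed.

Lemma closure_diff_sub g h : fellow g h -> closure (g `\` h) `<=` g.
Proof.
move=> gh; have [[f [f' cg]] _ _ _ _] := gh.
have [s [t [_ _ -> _]]] := fellow_param gh cg.
by have [_ <- _ _] := cg; move=> x [u _ <-]; exists u.
Qed.

Lemma symdiff_closure_subU g h : fellow g h -> symdiff_closure g h `<=` g `|` h.
Proof.
move=> gh; rewrite symdiff_closureE => x [|] cx; [left|right].
  exact: closure_diff_sub gh _ cx.
exact: closure_diff_sub (fellowC gh) _ cx.
Qed.

Lemma curve_on_line g h : fellow g h -> symdiff_closure g h `&` g = closure (g `\` h).
Proof.
move=> gh; rewrite symdiff_closureE; apply/seteqP; split=> x.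
  move=> [[//|cx] gx].
  by have : seam h g x by []; rewrite -seamC // => -[].
by move=> cx; split; [left|exact: closure_diff_sub cx].
Qed.

Lemma fellow_chart g h f f' : fellow g h -> chart g f f' ->
  exists s t, [/\ s < t, forall u, (g `\` h) (f u) <-> s < u < t,
    forall u, symdiff_closure g h (f u) <-> s <= u <= t & h (f s) /\ h (f t)].
Proof.
move=> gh cg; have [s [t [st E cE sE]]] := fellow_param gh cg.
have [cf fg ff' cf'] := cg.
exists s, t; split => //.
- move=> u; rewrite E; split=> [[v + /(can_inj ff') <-]|uI].
    by rewrite /= in_itv.
  by exists u => //=; rewrite in_itv.
- move=> u; have -> : symdiff_closure g h (f u) <-> closure (g `\` h) (f u).
    rewrite -curve_on_line //; split=> [?|[]//]; split => //.
    by rewrite -fg; exists u.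
  rewrite cE; split=> [[v + /(can_inj ff') <-]|uI].
    by rewrite /= in_itv.
  by exists u => //=; rewrite in_itv.
have hs : seam g h (f s) by rewrite sE; left.
have ht : seam g h (f t) by rewrite sE; right.
by split; [case: hs|case: ht].
Qed.

Lemma closed_curve_symdiff g h : fellow g h -> closed_curve (symdiff_closure g h).
Proof.
move=> gh; have hg := fellowC gh.
have [[f [f' cg]] [fh [fh' ch]] _ _ _] := gh.
have [s [t [st E cE sE]]] := fellow_param gh cg.
have [s' [t' [st' E' cE' sE']]] := fellow_param hg ch.
have [cf fg ff' cf'] := cg; have [cfh fhh ffh cfh'] := ch.
have hA : simple_arc (closure (g `\` h)) (f s) (f t).
  by rewrite cE; apply: arc_path => // u v _ _; exact: can_inj.
have hB : simple_arc (closure (h `\` g)) (fh s') (fh t').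
  by rewrite cE'; apply: arc_path => // u v _ _; exact: can_inj.
have ss : [set fh s'; fh t'] = [set f s; f t] by rewrite -sE -sE' seamC.
have [_ _ fst] := arc_ends hA.
have hB' : simple_arc (closure (h `\` g)) (f s) (f t).
  have [Es|Es] : [set fh s'; fh t'] (f s) by rewrite ss; left.
    have [Et|Et] : [set fh s'; fh t'] (f t) by rewrite ss; right.
      by case: fst; rewrite Es Et.
    by rewrite Es Et.
  have [Et|Et] : [set fh s'; fh t'] (f t) by rewrite ss; right.
    by rewrite Es Et; exact: arc_rev.
  by case: fst; rewrite Es Et.
exists (f s), (f t), (closure (g `\` h)), (closure (h `\` g)); split => //.
  move=> x cx cx'; have : seam g h x.
    by split => //; exact: closure_diff_sub hg _ cx'.
  by rewrite sE.
exact: symdiff_closureE.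
Qed.

(** Project the circle to its horizontal diameter; the upper half runs along one
    arc, the lower half along the other. *)
Lemma closed_curve_jordan E : closed_curve E -> jordan_curve E.
Proof.
move=> [a [b [A [B [[f [cf fI f0 f1 AE]] [k [ck kI k0 k1 BE]] AB ->]]]]].
pose s (z : plane R) : R := (z.1 + 1) / 2.
have cs : continuous s.
  move=> z; apply: cvgM; last exact: cvg_cst.
  by apply: (@cvgD _ R^o); [exact: fst_continuous|exact: cvg_cst].
pose F (z : plane R) := if 0 <= z.2 then f (s z) else k (s z).
have bnd z : unit_circle R z -> -1 <= z.1 <= 1.
  rewrite /unit_circle /= => zz; rewrite -ler_norml -(@ler_pXn2r _ 2) ?nnegrE //.
  by rewrite real_normK ?num_real // expr1n -zz lerDl sqr_ge0.
have sI z : unit_circle R z -> s z \in `[0, 1].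
  move=> /bnd /andP[h1 h2]; rewrite in_itv /= /s.
  by clear -h1 h2; apply/andP; split; lra.
have flat z : unit_circle R z -> z.2 = 0 -> f (s z) = k (s z).
  rewrite /unit_circle /s /= => + z2; rewrite z2 expr0n addr0 => /eqP.
  rewrite sqrf_eq1 => /orP[/eqP ->|/eqP ->].
    by rewrite (_ : (1 + 1) / 2 = 1 :> R) ?f1 ?k1 //; clear; lra.
  by rewrite addNr mul0r f0 k0.
have FA (z : plane R) : 0 <= z.2 -> F z = f (s z) by rewrite /F => ->.
have FB z : unit_circle R z -> z.2 <= 0 -> F z = k (s z).
  move=> zz z2; rewrite /F; case: ifPn => // z2'.
  by apply: flat => //; apply/eqP; rewrite eq_le z2.
have s_inj (z w : plane R) : unit_circle R z -> unit_circle R w ->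
    0 <= z.2 * w.2 -> s z = s w -> z = w.
  rewrite /unit_circle /s /= => zz ww zw ss.
  have e1 : z.1 = w.1 by clear -ss; lra.
  have e2 : z.2 ^+ 2 = w.2 ^+ 2.
    by apply: (@addrI _ (z.1 ^+ 2)); rewrite zz e1 ww.
  rewrite [z]surjective_pairing [w]surjective_pairing e1; congr (_, _).
  move/eqP: e2; rewrite eqf_sqr => /orP[/eqP//|/eqP e2].
  move: zw; rewrite e2 mulNr oppr_ge0 -expr2 => h.
  have : w.2 ^+ 2 == 0 by rewrite eq_le h sqr_ge0.
  by rewrite sqrf_eq0 => /eqP ->; rewrite oppr0.
exists F; split.
- have clC : closed (unit_circle R).
    apply: (@closed_pre _ _ (fun z : plane R => z.1 ^+ 2 + z.2 ^+ 2) [set 1]).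
      move=> z; apply: (@cvgD _ R^o).
        by apply: cvgM; exact: fst_continuous.
      by apply: cvgM; exact: snd_continuous.
    exact: accessible_closed_set1 (hausdorff_accessible (@Rhausdorff R)) _.
  have -> : unit_circle R = (unit_circle R `&` [set z | 0 <= z.2]) `|`
      (unit_circle R `&` [set z | z.2 <= 0]).
    apply/seteqP; split=> z; last by case=> -[].
    by move=> zz; have [h|/ltW h] := leP 0 z.2; [left|right].
  have cc (h : R -> plane R) : continuous h -> continuous (h \o s).
    by move=> ch z; apply: continuous_comp; [exact: cs|exact: ch].
  apply: withinU_continuous.
  + by apply: closedI => //; exact: closed_snd_ge.
  + by apply: closedI => //; exact: closed_snd_le.
  + apply: (@subspace_eq_continuous _ _ _ (f \o s)).
      by move=> z; rewrite inE => -[_ /FA]; rewrite /from_subspace => ->.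
    exact/continuous_subspaceT/cc.
  + apply: (@subspace_eq_continuous _ _ _ (k \o s)).
      by move=> z; rewrite inE => -[z1 /(FB _ z1)]; rewrite /from_subspace => ->.
    exact/continuous_subspaceT/cc.
- have cross (z w : plane R) : unit_circle R z -> unit_circle R w -> 0 <= z.2 -> w.2 <= 0 ->
      F z = F w -> z = w.
    move=> zz ww z2 w2; rewrite FA // FB // => E'.
    have [e|e] : f (s z) = a \/ f (s z) = b.
      apply: AB; rewrite ?AE ?BE; first by exists (s z) => //; exact: sI.
      by rewrite E'; exists (s w) => //; exact: sI.
    + have I0 : (0 : R) \in `[0, 1] by rewrite in_itv /= lexx ler01.
      have sz : s z = 0 by apply: fI => //; [exact: sI|rewrite f0].
      have sw : s w = 0 by apply: kI => //; [exact: sI|rewrite k0 -E'].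
      apply: s_inj; rewrite ?sz ?sw //.
      have w1 : w.1 = -1 by move: sw; rewrite /s; clear; lra.
      move: ww; rewrite /unit_circle /= w1 sqrrN expr1n => /eqP.
      by rewrite -subr_eq0 addrAC subrr add0r sqrf_eq0 => /eqP ->; rewrite mulr0.
    + have I1 : (1 : R) \in `[0, 1] by rewrite in_itv /= lexx ler01.
      have sz : s z = 1 by apply: fI => //; [exact: sI|rewrite f1].
      have sw : s w = 1 by apply: kI => //; [exact: sI|rewrite k1 -E'].
      apply: s_inj; rewrite ?sz ?sw //.
      have w1 : w.1 = 1 by move: sw; rewrite /s; clear; lra.
      move: ww; rewrite /unit_circle /= w1 expr1n => /eqP.
      by rewrite -subr_eq0 addrAC subrr add0r sqrf_eq0 => /eqP ->; rewrite mulr0.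
  move=> z w; rewrite !inE => zz ww Fzw.
  have [z2|/ltW z2] := leP 0 z.2; have [w2|/ltW w2] := leP 0 w.2.
  + move: Fzw; rewrite !FA // => /(fI _ _ (sI _ zz) (sI _ ww)).
    by apply: s_inj => //; exact: mulr_ge0.
  + exact: cross.
  + by apply/esym; exact: cross.
  + move: Fzw; rewrite !FB // => /(kI _ _ (sI _ zz) (sI _ ww)).
    by apply: s_inj => //; exact: mulr_le0.
apply/seteqP; split=> x.
  move=> [z zz <-]; rewrite /F; case: ifP => _; [left; rewrite AE|right; rewrite BE].
    by exists (s z) => //; exact: sI.
  by exists (s z) => //; exact: sI.
have onC (u : R) (e : R) : u \in `[0, 1] -> e ^+ 2 = 1 ->
    unit_circle R (2 * u - 1, e * Num.sqrt (1 - (2 * u - 1) ^+ 2)).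
  rewrite in_itv /= => /andP[u0 u1] ee; rewrite /unit_circle /= exprMn ee mul1r.
  rewrite sqr_sqrtr; first by rewrite addrC subrK.
  by rewrite subr_ge0 expr2; clear -u0 u1; nra.
have sC (u e : R) : s (2 * u - 1, e) = u by rewrite /s /=; clear; lra.
rewrite AE BE => -[[u uI <-]|[u uI <-]].
  have := onC u 1 uI (expr1n _ _); set z := (_, _) => zz; exists z => //.
  by rewrite FA ?sC //= mul1r sqrtr_ge0.
have := onC u (-1) uI; rewrite sqrrN expr1n => /(_ erefl); set z := (_, _) => zz.
by exists z => //; rewrite FB ?sC //= mulN1r oppr_le0 sqrtr_ge0.
Qed.
End Curves.

(** * Betweenness relations and linear orders *)

Section Betweenness.
Variables (T : Type) (B : T -> T -> T -> Prop).
Implicit Types (a b c d p q x y z : T).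

Hypothesis B_distinct : forall x y z, B x y z -> [/\ x <> y, x <> z & y <> z].
Hypothesis B_sym : forall x y z, B x y z -> B y x z.
Hypothesis B_some : forall x y z, x <> y -> x <> z -> y <> z ->
  [\/ B x y z, B y z x | B x z y].
Hypothesis B_excl : forall x y z, B x y z -> ~ B y z x.
Hypothesis B_split : forall x y z w, w <> x -> w <> y -> w <> z -> B x y z ->
  B x w z \/ B y w z.

Lemma B_exclC x y z : B x y z -> ~ B x z y.
Proof. by move=> /B_sym; exact: B_excl. Qed.

Lemma B_split_any x y z w : w <> z -> B x y z -> B x w z \/ B y w z.
Proof.
move=> wz xyz.
have [->|wx] := pselect (w = x); first by right; exact: B_sym.
have [->|wy] := pselect (w = y); first by left.
exact: B_split.
Qed.

(** With [B_split_any], this says that [z] has at most two sides: [B x y z] means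
    that [x] and [y] are on different sides of [z].  One of [x], [y] and [w] is
    between the two others, and this leads to a contradiction by [B_split_any]. *)
Lemma B_not3 x y w z : B x y z -> B y w z -> ~ B x w z.
Proof.
move=> xy yw xw.
have [xny xnz ynz] := B_distinct xy; have [ynw _ wnz] := B_distinct yw.
have [xnw _ _] := B_distinct xw.
have [h|h|h] := B_some xny xnw ynw.
- have [h'|h'] := B_split_any (nesym wnz) h.
    exact: B_exclC xw h'.
  exact: B_exclC yw h'.
- have [h'|h'] := B_split_any (nesym xnz) h.
    exact: B_exclC (B_sym xy) h'.
  exact: B_exclC (B_sym xw) h'.
have [h'|h'] := B_split_any (nesym ynz) h.
  exact: B_exclC xy h'.
exact: B_exclC (B_sym yw) h'.
Qed.

Lemma B_parity x y w z : x <> z -> y <> z -> w <> z ->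
  B x y z <-> ~ (B w x z <-> B w y z).
Proof.
move=> xz yz wz; split=> [xy E|h].
  have [/B_sym wx|/B_sym wy] := B_split_any wz xy.
    by move: (E.1 wx) => wy; apply: (B_not3 (B_sym wx) wy).
  by move: (E.2 wy) => wx; apply: (B_not3 (B_sym wx) wy).
have [wx|wx] := pselect (B w x z); have [wy|wy] := pselect (B w y z).
- by case: h.
- by have [/wy|] := B_split_any yz wx.
- by have [/wx|/B_sym] := B_split_any xz wy.
- by case: h.
Qed.

Section Order.
Variables (p q : T) (pq : p <> q).

(** The side of [p] that contains [q]. *)
Definition ahead x := x <> p /\ ~ B q x p.

(** The direction from [p] to [q] is transported to every other point [x].  If
    [x] is ahead of [p], what follows [x] is the side of [x] away from [p];
    otherwise it is the side of [x] that contains [p]. *)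
Definition blt x y := x <> y /\
  ((x = p /\ ahead y) \/ (x <> p /\ ahead x /\ B p y x) \/
   (x <> p /\ ~ ahead x /\ ~ B p y x)).

Lemma blt_from y : p <> y -> blt p y <-> ahead y.
Proof. by rewrite /blt; tauto. Qed.

Lemma blt_ahead x y : x <> p -> x <> y -> ahead x -> blt x y <-> B p y x.
Proof. by rewrite /blt; tauto. Qed.

Lemma blt_behind x y : x <> p -> x <> y -> ~ ahead x -> blt x y <-> ~ B p y x.
Proof. by rewrite /blt; tauto. Qed.

Lemma aheadE x : x <> p -> ahead x <-> ~ B q x p.
Proof. by rewrite /ahead; tauto. Qed.

Let iff_not (P Q : Prop) : ~ (~ P <-> ~ Q) <-> ~ (P <-> Q).
Proof. by have [?|?] := pselect P; have [?|?] := pselect Q; tauto. Qed.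

Lemma blt_local z x y : x <> z -> y <> z -> x <> y -> B x y z <-> ~ (blt z x <-> blt z y).
Proof.
move=> xz yz xy; have nzx := nesym xz; have nzy := nesym yz.
have [zp|zp] := pselect (z = p).
  rewrite zp in xz yz nzx nzy *.
  by rewrite !blt_from // !aheadE // iff_not; apply: B_parity => //; exact: nesym.
rewrite (B_parity xz yz (nesym zp)).
have [az|az] := pselect (ahead z); first by rewrite !blt_ahead.
by rewrite !blt_behind // iff_not.
Qed.

Lemma blt_anti_base x : x <> p -> blt x p <-> ~ blt p x.
Proof.
move=> xp; have px := nesym xp; rewrite (blt_from px).
have ppx : ~ B p p x by move=> /B_distinct[].
have [ax|ax] := pselect (ahead x).
  by rewrite (blt_ahead xp xp ax); tauto.
by rewrite (blt_behind xp xp ax); tauto.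
Qed.

Lemma blt_anti x y : x <> y -> blt x y <-> ~ blt y x.
Proof.
move=> xy; have yx := nesym xy.
have [xp|xp] := pselect (x = p).
  rewrite xp in xy yx *; rewrite (blt_anti_base yx).
  by have [?|?] := pselect (blt p y); tauto.
have [yp|yp] := pselect (y = p).
  by rewrite yp in xy *; exact: blt_anti_base.
have par := B_parity xp yp (nesym pq); rewrite -iff_not -!aheadE // in par.
have same : ~ B x y p -> B p x y <-> ~ B p y x.
  move=> nb; split=> [/B_exclC//|nh].
  have [//|/B_sym//|/B_sym//] := B_some xy xp yp.
have opp : B x y p -> ~ B p x y /\ ~ B p y x.
  by move=> h; split=> /B_sym; [exact: B_exclC h|exact: B_excl h].
have [ax|ax] := pselect (ahead x); have [ay|ay] := pselect (ahead y).
- rewrite blt_ahead // blt_ahead //.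
  have [?|?] := pselect (B p y x); have [?|?] := pselect (B p x y); tauto.
- rewrite blt_ahead // blt_behind //; tauto.
- rewrite blt_behind // blt_ahead //; tauto.
- rewrite blt_behind // blt_behind //.
  have [?|?] := pselect (B p y x); have [?|?] := pselect (B p x y); tauto.
Qed.

(** If [x < y] and [y < z] but not [x < z], then [x] is between [y] and [z], and
    [y] is between [x] and [z]. *)
Lemma blt_trans x y z : blt x y -> blt y z -> blt x z.
Proof.
move=> xy yz.
have nxy : x <> y by case: xy.
have nyz : y <> z by case: yz.
have nyx : ~ blt y x by apply/(blt_anti nxy).
have nzy : ~ blt z y by apply/(blt_anti nyz).
have nxz : x <> z by move=> E; rewrite -E in yz.
apply: contrapT => xz.
have Bx : B y z x by apply/blt_local => //; [exact: nesym|exact: nesym|tauto].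
have By : B x z y by apply/blt_local => //; [exact: nesym|tauto].
exact: B_excl By (B_sym Bx).
Qed.

Lemma blt_between x y z : x <> y -> x <> z -> y <> z ->
  B x y z <-> (blt x z /\ blt z y) \/ (blt y z /\ blt z x).
Proof.
move=> xy xz yz; rewrite blt_local // (blt_anti xz) (blt_anti yz).
by have [?|?] := pselect (blt z x); have [?|?] := pselect (blt z y); tauto.
Qed.

Lemma blt_unique (lt : T -> T -> Prop) :
  (forall x, ~ lt x x) -> (forall x y, x <> y -> (lt x y <-> ~ lt y x)) ->
  (forall x y z, x <> y -> x <> z -> y <> z ->
    B x y z <-> (lt x z /\ lt z y) \/ (lt y z /\ lt z x)) ->
  lt p q -> forall x y, lt x y <-> blt x y.
Proof.
move=> irr anti ind ltpq x y.
have [xy|xy] := pselect (x = y).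
  by rewrite xy /blt; have := irr y; tauto.
have par a b z : a <> b -> a <> z -> b <> z -> B a b z <-> ~ (lt z a <-> lt z b).
  move=> ab az bz; rewrite ind // (anti _ _ az) (anti _ _ bz).
  by have [?|?] := pselect (lt z a); have [?|?] := pselect (lt z b); tauto.
have ltp a : a <> p -> lt p a <-> ahead a.
  move=> ap; have [<-|qa] := pselect (q = a).
    by rewrite /ahead; split=> // _; split; [exact: nesym|move=> /B_distinct[]].
  rewrite aheadE // (par _ _ _ qa (nesym pq) ap).
  by have [?|?] := pselect (lt p a); tauto.
have yx := nesym xy.
have [xp|xp] := pselect (x = p).
  by rewrite xp in yx xy *; rewrite ltp // blt_from.
have ltxp : lt x p <-> ~ ahead x by rewrite (anti _ _ xp) ltp.
have [yp|yp] := pselect (y = p).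
  by rewrite yp ltxp blt_anti_base // blt_from //; exact: nesym.
have := par p y x (nesym yp) (nesym xp) yx; rewrite ltxp.
have [ax|ax] := pselect (ahead x); [rewrite blt_ahead //|rewrite blt_behind //].
  by have [?|?] := pselect (lt x y); tauto.
by have [?|?] := pselect (lt x y); tauto.
Qed.

End Order.

Lemma betweenness_order : exists lt : T -> T -> Prop,
  [/\ strict_total_order_on setT lt,
    forall x y z, x <> y -> x <> z -> y <> z ->
      B x y z <-> (lt x z /\ lt z y) \/ (lt y z /\ lt z x)
    & forall lt' : T -> T -> Prop, strict_total_order_on setT lt' ->
      (forall x y z, x <> y -> x <> z -> y <> z ->
        B x y z <-> (lt' x z /\ lt' z y) \/ (lt' y z /\ lt' z x)) ->
      (forall x y, lt' x y <-> lt x y) \/ (forall x y, lt' x y <-> lt y x)].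
Proof.
have anti lt' : strict_total_order_on setT lt' -> forall x y, x <> y -> (lt' x y <-> ~ lt' y x).
  move=> [irr tr tot] x y xy; split=> [h h'|h].
    exact: (irr x I (tr _ _ _ I I I h h')).
  by have [//|//] := tot x y I I xy.
have [[p [q pq]]|triv] := pselect (exists p q : T, p <> q); last first.
  have eqT (x y : T) : x = y by apply: contrapT => xy; apply: triv; exists x, y.
  exists (fun _ _ => False); split.
  - split=> [x _ []|x y z _ _ _ []|x y _ _ xy].
    by case: (xy (eqT x y)).
  - by move=> x y z xy; case: (xy (eqT x y)).
  - by move=> lt' [irr _ _] _; left=> x y; rewrite (eqT x y); split => // /(irr y I).
exists (blt p q); split.
- split=> [x _ [] //|x y z _ _ _|x y _ _ xy]; first exact: blt_trans.
  have [h|h] := pselect (blt p q x y); first by left.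
  by right; apply/(blt_anti pq (nesym xy)).
- exact: blt_between.
- move=> lt' slt' ind; have [irr _ tot] := slt'.
  have [ltpq|ltqp] := tot p q I I pq.
    by left; apply: blt_unique => //; [move=> x; exact: irr|exact: anti].
  right=> x y.
  apply: (@blt_unique p q pq (fun x y => lt' y x)) => //.
  + by move=> a; exact: irr.
  + by move=> a b ab; apply: anti => //; exact: nesym.
  + by move=> a b c ab ac bc; rewrite ind //; tauto.
Qed.
End Betweenness.

(** * Three and four lines *)

Section Triples.
Variable R : realType.
Implicit Types (g h k : set (plane R)) (s t u v w : R).

Local Notation J := symdiff_closure.

Lemma connected_core (T : topologicalType) (S C : set T) : connected C -> C !=set0 ->
  C `<=` S ->
  (forall x, S x -> exists D, [/\ connected D, D x, D `<=` S & D `&` C !=set0]) ->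
  connected S.
Proof.
move=> cC [c Cc] CS hD.
have -> : S = \bigcup_(D in
    [set D | [/\ connected D, D `<=` S & D `&` C !=set0]]) (C `|` D).
  apply/seteqP; split=> x.
    by move=> /hD[D [cD Dx DS DC]]; exists D; [split|right].
  by move=> [D [cD DS DC] [/CS//|/DS]].
apply: bigcup_connected; first by exists c => D _; left.
by move=> D [cD DS DC]; apply: connectedU => //; rewrite setIC.
Qed.

Lemma connected_arc (f : R -> plane R) (I : set R) : continuous f -> is_interval I ->
  connected (f @` I).
Proof.
move=> cf /connected_intervalP cI; apply: connected_continuous_connected => //.
exact: continuous_subspaceT.
Qed.

Section Triple.
Variables g1 g2 g3 : set (plane R).
Hypotheses (h12 : fellow g1 g2) (h13 : fellow g1 g3) (h23 : fellow g2 g3).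

(** If [g1] were contained in the union of [g2] and [g3], then [g1 `\` g2] would
    be part of [g3 `\` g2], and [g1 `\` g3] of [g2 `\` g3].  As seams are
    symmetric and have two points each, both portions of [g1] would have the
    same endpoints, hence would coincide; but a point in both is on neither [g2]
    nor [g3]. *)
Lemma exclusive_part : exists2 x, g1 x & ~ g2 x /\ ~ g3 x.
Proof.
apply: contrapT => no.
have s12 : seam g1 g2 `<=` seam g3 g2.
  move=> x [c1 x2]; split => //; apply: (closureS _ c1) => y [y1 y2]; split => //.
  by apply: contrapT => y3; apply: no; exists y.
have s13 : seam g1 g3 `<=` seam g3 g2.
  rewrite (seamC (fellowC h23)) => x [c1 x2]; split => //; apply: (closureS _ c1) => y [y1 y2].
  by split => //; apply: contrapT => y3; apply: no; exists y.
have [[f1 [f1' c1]] _ _ _ _] := h12.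
have [[f3 [f3' c3]] _ _ _ _] := fellowC h23.
have [s [t [st E _ S]]] := fellow_param h12 c1.
have [s' [t' [st' E' _ S']]] := fellow_param h13 c1.
have [u [v [_ _ _ SS]]] := fellow_param (fellowC h23) c3.
have [_ fg ff _] := c1; have inj := can_inj ff.
rewrite S SS in s12; rewrite S' SS in s13.
have nst : f1 s <> f1 t by move=> /inj e; move: st; rewrite e ltxx.
have nst' : f1 s' <> f1 t' by move=> /inj e; move: st'; rewrite e ltxx.
have [hs ht] : [set f3 u; f3 v] (f1 s) /\ [set f3 u; f3 v] (f1 t).
  by split; apply: s12; [left|right].
have sub x : [set f3 u; f3 v] x -> x = f1 s \/ x = f1 t.
  case: hs => hs; case: ht => ht; rewrite hs ht in nst *; try by case: nst.
    by case=> ->; [left|right].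
  by case=> ->; [right|left].
have [es|es] : f1 s' = f1 s \/ f1 s' = f1 t by apply: sub; apply: s13; left.
  have [et|/inj et] : f1 t' = f1 s \/ f1 t' = f1 t by apply: sub; apply: s13; right.
    by case: nst'; rewrite es et.
  move/inj: es => es.
  pose m := (s + t) / 2.
  have mI : m \in `]s, t[ by rewrite in_itv /= /m !midf_lt.
  apply: no; exists (f1 m); first by rewrite -fg; exists m.
  split.
    by have [] : (g1 `\` g2) (f1 m) by rewrite E; exists m.
  by have [] : (g1 `\` g3) (f1 m) by rewrite E' es et; exists m.
have [/inj et|et] : f1 t' = f1 s \/ f1 t' = f1 t by apply: sub; apply: s13; right.
  by move/inj: es => es; move: st'; rewrite es et ltNge (ltW st).
by case: nst'; rewrite es et.
Qed.

End Triple.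

(** By [exclusive_part] the three portions cut out of [g1] overlap pairwise, and
    pairwise overlapping intervals have a common point. *)
Lemma exclusive_part4 g1 g2 g3 g4 : fellow g1 g2 -> fellow g1 g3 -> fellow g1 g4 ->
  fellow g2 g3 -> fellow g2 g4 -> fellow g3 g4 ->
  exists x, [/\ g1 x, ~ g2 x, ~ g3 x & ~ g4 x].
Proof.
move=> h12 h13 h14 h23 h24 h34.
have [[f [f' c1]] _ _ _ _] := h12; have [_ fg ff _] := c1.
have [s2 [t2 [st2 E2 _ _]]] := fellow_chart h12 c1.
have [s3 [t3 [st3 E3 _ _]]] := fellow_chart h13 c1.
have [s4 [t4 [st4 E4 _ _]]] := fellow_chart h14 c1.
have meet g h s t s' t' : (forall u, (g1 `\` g) (f u) <-> s < u < t) ->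
    (forall u, (g1 `\` h) (f u) <-> s' < u < t') ->
    (exists2 x, g1 x & ~ g x /\ ~ h x) -> s < t' /\ s' < t.
  move=> Eg Eh [x gx [ng nh]]; move: (gx); rewrite -fg => -[u _ ux].
  have /andP[a b] : s < u < t by apply/Eg; rewrite ux.
  have /andP[c d] : s' < u < t' by apply/Eh; rewrite ux.
  by split; [exact: lt_trans d|exact: lt_trans b].
have [m23 m32] := meet _ _ _ _ _ _ E2 E3 (exclusive_part h12 h13 h23).
have [m24 m42] := meet _ _ _ _ _ _ E2 E4 (exclusive_part h12 h14 h24).
have [m34 m43] := meet _ _ _ _ _ _ E3 E4 (exclusive_part h13 h14 h34).
have [u [u2 u3 u4]] : exists u, [/\ s2 < u < t2, s3 < u < t3 & s4 < u < t4].
  pose lo := Num.max s2 (Num.max s3 s4); pose hi := Num.min t2 (Num.min t3 t4).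
  have lohi : lo < hi by rewrite /lo /hi !gt_max !lt_min st2 st3 st4 m23 m32 m24 m42 m34 m43.
  have [l2 l3 l4] : [/\ s2 <= lo, s3 <= lo & s4 <= lo].
    by rewrite /lo !le_max !lexx !orbT.
  have [r2 r3 r4] : [/\ hi <= t2, hi <= t3 & hi <= t4].
    by rewrite /hi !ge_min !lexx !orbT.
  have [lm mh] : lo < (lo + hi) / 2 /\ (lo + hi) / 2 < hi.
    by rewrite !midf_lt.
  exists ((lo + hi) / 2); split; apply/andP; split.
  - exact: le_lt_trans lm.
  - exact: lt_le_trans mh _.
  - exact: le_lt_trans lm.
  - exact: lt_le_trans mh _.
  - exact: le_lt_trans lm.
  - exact: lt_le_trans mh _.
exists (f u); split; first by rewrite -fg; exists u.
- by have [] := (E2 u).2 u2.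
- by have [] := (E3 u).2 u3.
- by have [] := (E4 u).2 u4.
Qed.

Section Theta.
Variables g1 g2 g3 : set (plane R).
Hypotheses (h12 : fellow g1 g2) (h13 : fellow g1 g3) (h23 : fellow g2 g3).

Let h31 := fellowC h13.
Let h32 := fellowC h23.

Lemma theta_arc_nonempty : J g1 g3 `\` J g1 g2 !=set0.
Proof.
have [x x3 [x1 x2]] := exclusive_part h31 h32 h12.
exists x; split; first by rewrite symdiff_closureC; apply: symdiff_sub.
by move=> /(symdiff_closure_subU h12)[].
Qed.

(** On [g3] the intersection is the intersection of two intervals.  A point off
    [g3] is on [g1] and [g2]; on [g1] its parameter is in the interval cut out
    by [g3] and not in the one cut out by [g2].  As these two overlap, [g1]
    stays in the intersection from that point to the endpoint of the first
    interval that is on the same side of the overlap, and this endpoint is on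
    [g3]. *)
Lemma theta_connected : connected (J g1 g3 `&` J g2 g3).
Proof.
have [[f1 [f1' c1]] _ _ _ _] := h12; have [[f3 [f3' c3]] _ _ _ _] := h31.
have [cf1 fg1 ff1 _] := c1; have [cf3 fg3 ff3 _] := c3.
have [a [b [ab P12 _ _]]] := fellow_chart h12 c1.
have [a' [b' [ab' P13 Q13 [a3 b3]]]] := fellow_chart h13 c1.
have [p [q [pq P31 Q31 _]]] := fellow_chart h31 c3.
have [p' [q' [pq' P32 Q32 _]]] := fellow_chart h32 c3.
pose S := J g1 g3 `&` J g2 g3; rewrite -/S.
have SE u : S (f3 u) <-> p <= u <= q /\ p' <= u <= q'.
  by rewrite -Q31 -Q32 /S (symdiff_closureC g3) (symdiff_closureC g3).
pose I : set R := [set u | p <= u <= q /\ p' <= u <= q'].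
have Icon : connected (f3 @` I).
  apply: (connected_arc cf3) => u v.
  move=> [/andP[u1 _] /andP[u3 _]] [/andP[_ v2] /andP[_ v4]] w /andP[uw wv].
  split; apply/andP; split.
  - exact: le_trans uw.
  - exact: le_trans wv v2.
  - exact: le_trans uw.
  - exact: le_trans wv v4.
have core x : S x -> g3 x -> (f3 @` I) x.
  by move=> Sx; rewrite -fg3 => -[u _ ux]; exists u => //; apply/SE; rewrite ux.
apply: (@connected_core _ _ (f3 @` I)) => //.
- have [x x3 [x1 x2]] := exclusive_part h31 h32 h12.
  exists x; apply: core => //; split; rewrite symdiff_closureC; exact: symdiff_sub.
- by move=> _ [u Iu <-]; apply/SE.
move=> x Sx; have [x3|x3] := pselect (g3 x).
  exists [set x]; split => // [|y ->//|]; first exact: connected1.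
  by exists x; split => //; exact: core.
have [Sx1 Sx2] := Sx.
have x1 : g1 x by case: (symdiff_closure_subU h13 Sx1).
have x2 : g2 x by case: (symdiff_closure_subU h23 Sx2).
move: (x1); rewrite -fg1 => -[s _ sx].
have sI' : a' < s < b' by apply/P13; rewrite sx.
have nsI : ~ (a < s < b) by move=> /P12; rewrite sx => -[].
have /andP[as' sb'] := sI'.
have [w /andP[aw wb] /andP[aw' wb']] : exists2 w, a < w < b & a' < w < b'.
  have [y y1 [y2 y3]] := exclusive_part h12 h13 h23.
  move: (y1); rewrite -fg1 => -[w _ wy].
  by exists w; [apply/P12|apply/P13]; rewrite wy.
have clS : closed S by apply: closedI; exact: closed_symdiff.
have in_S u : a' < u < b' -> ~ (a < u < b) -> S (f1 u).
  move=> u13 u12; split; first by apply: symdiff_sub; apply/P13.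
  apply: symdiff_sub; have [_ n3] := (P13 u).2 u13; split => //.
  by apply: contrapT => n2; apply: u12; apply/P12; split => //; rewrite -fg1; exists u.
have clSf : closed (f1 @^-1` S) by exact: closed_pre.
have [sa|as_] := leP s a.
  have piece u : a' < u <= s -> S (f1 u).
    move=> /andP[a'u us]; apply: in_S; first by rewrite a'u (le_lt_trans us).
    by move=> /andP[au _]; move: (le_trans us sa); rewrite leNgt au.
  have Sa' : S (f1 a').
    suff : (f1 @^-1` S) a' by [].
    apply: clSf; have : closure [set` `]a', s[] a'.
      by rewrite closure_oo //= in_itv /= lexx ltW.
    apply: closureS => u /=; rewrite in_itv /= => /andP[h1 h2].
    by apply: piece; rewrite h1 ltW.
  exists (f1 @` `[a', s]); split.
  - exact/connected_arc/interval_is_interval.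
  - by exists s => //=; rewrite in_itv /= lexx (ltW as').
  - move=> _ [u /= + <-]; rewrite in_itv /= le_eqVlt => /andP[/orP[/eqP <-//|h1] h2].
    by apply: piece; rewrite h1.
  - exists (f1 a'); split; last exact: core.
    by exists a' => //=; rewrite in_itv /= lexx (ltW as').
have bs : b <= s by rewrite leNgt; apply/negP => sb; apply: nsI; rewrite as_.
have piece u : s <= u < b' -> S (f1 u).
  move=> /andP[su ub']; apply: in_S; first by rewrite ub' (lt_le_trans as').
  by move=> /andP[_ ub]; move: (le_trans bs su); rewrite leNgt ub.
have Sb' : S (f1 b').
  suff : (f1 @^-1` S) b' by [].
  apply: clSf; have : closure [set` `]s, b'[] b'.
    by rewrite closure_oo //= in_itv /= lexx (ltW sb').
  apply: closureS => u /=; rewrite in_itv /= => /andP[h1 h2].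
  by apply: piece; rewrite h2 (ltW h1).
exists (f1 @` `[s, b']); split.
- exact/connected_arc/interval_is_interval.
- by exists s => //=; rewrite in_itv /= lexx (ltW sb').
- move=> _ [u /= + <-]; rewrite in_itv /= => /andP[h1]; rewrite le_eqVlt => /orP[/eqP ->//|h2].
  by apply: piece; rewrite h1.
- exists (f1 b'); split; last exact: core.
  by exists b' => //=; rewrite in_itv /= lexx (ltW sb').
Qed.

(** The same decomposition as in [theta_connected]: an interval of [g3], and
    pieces of [g1] that reach it. *)
Lemma theta_arc_connected : connected (J g1 g3 `\` J g1 g2).
Proof.
have [[f1 [f1' c1]] _ _ _ _] := h12; have [[f3 [f3' c3]] _ _ _ _] := h31.
have [cf1 fg1 ff1 _] := c1; have [cf3 fg3 ff3 _] := c3.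
have [a [b [ab P12 Q12 _]]] := fellow_chart h12 c1.
have [a' [b' [ab' P13 Q13 [a3 b3]]]] := fellow_chart h13 c1.
have [p [q [pq P31 Q31 _]]] := fellow_chart h31 c3.
have [p' [q' [pq' P32 Q32 _]]] := fellow_chart h32 c3.
pose S := J g1 g3 `\` J g1 g2; rewrite -/S.
pose I : set R := [set u | p <= u <= q /\ ~ J g1 g2 (f3 u)].
have SE u : S (f3 u) <-> I u.
  by rewrite /I /= -Q31 /S (symdiff_closureC g3).
have Icon : connected (f3 @` I).
  apply: (connected_arc cf3) => u v Iu Iv w /andP[].
  rewrite le_eqVlt => /orP[/eqP <-//|uw]; rewrite le_eqVlt => /orP[/eqP ->//|wv].
  have in23 z : S (f3 z) -> p' <= z <= q'.
    move=> [j13 nj12]; apply/Q32; rewrite symdiff_closureC.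
    have := @symdiff_closure_triangle _ _ _ g2 _ j13.
    by rewrite (symdiff_closureC g3) => -[/nj12//|].
  have /andP[u3 _] := in23 _ ((SE u).2 Iu); have /andP[_ v4] := in23 _ ((SE v).2 Iv).
  have [/andP[u1 _] _] := Iu; have [/andP[_ v2] _] := Iv.
  have pw : p < w < q by rewrite (le_lt_trans u1 uw) (lt_le_trans wv v2).
  have pw' : p' < w < q' by rewrite (le_lt_trans u3 uw) (lt_le_trans wv v4).
  split; first by case/andP: pw => /ltW -> /ltW ->.
  have [_ n1] := (P31 w).2 pw; have [_ n2] := (P32 w).2 pw'.
  by move=> /(symdiff_closure_subU h12)[].
have core x : S x -> g3 x -> (f3 @` I) x.
  by move=> Sx; rewrite -fg3 => -[u _ ux]; exists u => //; apply/SE; rewrite ux.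
apply: (@connected_core _ _ (f3 @` I)) => //.
- have [x x3 [x1 x2]] := exclusive_part h31 h32 h12.
  exists x; apply: core => //; split; first by rewrite symdiff_closureC; exact: symdiff_sub.
  by move=> /(symdiff_closure_subU h12)[].
- by move=> _ [u Iu <-]; apply/SE.
move=> x Sx; have [x3|x3] := pselect (g3 x).
  exists [set x]; split => // [|y ->//|]; first exact: connected1.
  by exists x; split => //; exact: core.
have [Sx1 Sx2] := Sx.
have x1 : g1 x by case: (symdiff_closure_subU h13 Sx1).
move: (x1); rewrite -fg1 => -[s _ sx].
have /andP[as' sb'] : a' < s < b' by apply/P13; rewrite sx.
have nsI : ~ (a <= s <= b) by move=> /Q12; rewrite sx.
have in_S u : a' <= u <= b' -> ~ (a <= u <= b) -> S (f1 u).
  by move=> u13 u12; split; [apply/Q13|move=> /Q12].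
have [sa|as_] := ltP s a.
  have piece u : a' <= u <= s -> S (f1 u).
    move=> /andP[a'u us]; apply: in_S; first by rewrite a'u (le_trans us) // ltW.
    by move=> /andP[au _]; move: (le_lt_trans us sa); rewrite ltNge au.
  exists (f1 @` `[a', s]); split.
  - exact/connected_arc/interval_is_interval.
  - by exists s => //=; rewrite in_itv /= lexx (ltW as').
  - by move=> _ [u /= + <-]; rewrite in_itv /= => uI; exact: piece.
  - exists (f1 a'); split; first by exists a' => //=; rewrite in_itv /= lexx (ltW as').
    by apply: (core _ _ a3); apply: piece; rewrite lexx (ltW as').
have bs : b < s by rewrite ltNge; apply/negP => sb; apply: nsI; rewrite as_.
have piece u : s <= u <= b' -> S (f1 u).
  move=> /andP[su ub']; apply: in_S; first by rewrite ub' (le_trans (ltW as')).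
  by move=> /andP[_ ub]; move: (lt_le_trans bs su); rewrite ltNge ub.
exists (f1 @` `[s, b']); split.
- exact/connected_arc/interval_is_interval.
- by exists s => //=; rewrite in_itv /= lexx (ltW sb').
- by move=> _ [u /= + <-]; rewrite in_itv /= => uI; exact: piece.
- exists (f1 b'); split; first by exists b' => //=; rewrite in_itv /= lexx (ltW sb').
  by apply: (core _ _ b3); apply: piece; rewrite lexx (ltW sb').
Qed.

End Theta.

(** [b] is between [a] and [c]; by [inner_or_outer], what is not inner is
    outside [J a c]. *)
Definition inner (a c b : set (plane R)) := J a b `\` J a c `<=` Int (J a c).

Section Inner.
Variables a b c : set (plane R).
Hypotheses (hab : fellow a b) (hac : fellow a c) (hbc : fellow b c).

Let hca := fellowC hac.
Let cJ g h (hgh : fellow g h) : closed_curve (J g h) := closed_curve_symdiff hgh.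

Lemma theta_arcC : J a b `\` J a c = J c b `\` J c a.
Proof.
apply/seteqP; split=> x [h1 h2]; split.
- have := @symdiff_closure_triangle _ _ _ c _ h1; rewrite (symdiff_closureC b).
  by move=> [/h2|].
- by rewrite symdiff_closureC.
- have := @symdiff_closure_triangle _ _ _ a _ h1; rewrite (symdiff_closureC b).
  by move=> [/h2|].
- by rewrite symdiff_closureC.
Qed.

Lemma innerC : inner a c b -> inner c a b.
Proof. by rewrite /inner theta_arcC (symdiff_closureC a c). Qed.

Lemma inner_or_outer :
  inner a c b \/ J a b `\` J a c `<=` Ext (J a c).
Proof.
have con := theta_arc_connected hac hab (fellowC hbc).
have [x Dx] := theta_arc_nonempty hac hab (fellowC hbc).
have off x' : (J a b `\` J a c) x' -> ~ J a c x' by case.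
have [Ix|Ex] := Int_or_Ext (cJ hac) (off _ Dx); [left|right].
  exact: (sub_Int (cJ hac) con off Dx Ix).
exact: (sub_Ext (cJ hac) con off Dx Ex).
Qed.

Lemma inner_point x : (J a b `\` J a c) x -> Int (J a c) x -> inner a c b.
Proof.
move=> Dx Ix; have [//|sub] := inner_or_outer.
by case: (Int_not_Ext (cJ hac) Ix (sub _ Dx)).
Qed.

Lemma innerP : J a b `<=` closure (Int (J a c)) <-> inner a c b.
Proof.
split=> [sub x [x1 x2]|sub x x1].
  by apply: (closure_Int_off (cJ hac)) => //; exact: sub.
have [x2|x2] := pselect (J a c x); first exact: closure_Int (cJ hac) _ x2.
by apply: subset_closure; apply: sub.
Qed.

Lemma outerP : J a b `<=` closure (Ext (J a c)) <-> ~ inner a c b.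
Proof.
have [x Dx] := theta_arc_nonempty hac hab (fellowC hbc).
split=> [sub inn|ninn].
  apply: (Int_not_Ext (cJ hac) (inn _ Dx)); case: Dx => x1 x2.
  by apply: (closure_Ext_off (cJ hac)) => //; exact: sub.
have [//|out] := inner_or_outer => y y1.
have [y2|y2] := pselect (J a c y); first exact: closure_Ext (cJ hac) _ y2.
by apply: subset_closure; apply: out.
Qed.

Lemma inner_excl : inner a c b -> ~ inner c b a.
Proof.
move=> inn; rewrite /inner (symdiff_closureC c a) => inn'.
have hba := fellowC hab; have hcb := fellowC hbc.
have [x Dx] := theta_arc_nonempty hcb hca hba.
have D : J c b `\` J a c `<=` Int (J a c).
  by move: inn; rewrite /inner theta_arcC (symdiff_closureC c a).
have out := arc_outside_other (cJ hac) (cJ hcb) D.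
rewrite (symdiff_closureC c a) in Dx.
exact: (Int_not_Ext (cJ hcb) (inn' _ Dx) (out _ Dx)).
Qed.

End Inner.

Lemma inner_some a b c : fellow a b -> fellow a c -> fellow b c ->
  [\/ inner a c b, inner c b a | inner a b c].
Proof.
move=> hab hac hbc; have hba := fellowC hab; have hca := fellowC hac; have hcb := fellowC hbc.
have [in1|o1] := inner_or_outer hab hac hbc; first exact: Or31.
have [in2|o2] := inner_or_outer hca hcb hab; first exact: Or32.
have [in3|o3] := inner_or_outer hac hab hcb; first exact: Or33.
exfalso.
have ex1 := theta_arc_nonempty hcb hca hba.
have ex2 := theta_arc_nonempty hab hac hbc.
have o1' : symdiff_closure c b `\` symdiff_closure a c `<=` Ext (symdiff_closure a c).
  by move: o1; rewrite (theta_arcC a b c) (symdiff_closureC c a).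
apply: (@theta_some_inside _ (symdiff_closure a c) (symdiff_closure c b) (symdiff_closure a b)).
- exact: closed_curve_symdiff.
- exact: closed_curve_symdiff.
- exact: closed_curve_symdiff.
- have := @symdiff_closure_triangle _ a c b.
  by rewrite setUC.
- have := @symdiff_closure_triangle _ c b a.
  by rewrite (symdiff_closureC c a) (symdiff_closureC b a).
- have := @symdiff_closure_triangle _ a b c.
  by rewrite (symdiff_closureC b c).
- by have := theta_connected hca hcb hab; rewrite (symdiff_closureC c b).
- by rewrite (symdiff_closureC a c).
- exact: ex2.
- exact: o1'.
- by rewrite (symdiff_closureC a c).
- exact: o3.
Qed.

(** A point of [b] on none of [a], [c] and [d] is inside [J a c], hence inside
    [J a d] or [J c d] by [Int_cocycle]. *)
Lemma inner_split a b c d : fellow a b -> fellow a c -> fellow a d ->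
  fellow b c -> fellow b d -> fellow c d -> inner a c b -> inner a d b \/ inner c d b.
Proof.
move=> hab hac had hbc hbd hcd inn.
have [t [tb ta tc td]] := exclusive_part4 (fellowC hab) hbc hbd hac had hcd.
have Jt g : fellow b g -> ~ g t -> J g b t.
  by move=> hbg gt; rewrite symdiff_closureC; apply: symdiff_sub.
have nJ g h : fellow g h -> ~ g t -> ~ h t -> ~ J g h t.
  by move=> hgh gt ht /(symdiff_closure_subU hgh)[].
have hba := fellowC hab.
have It : Int (J a c) t by apply: inn; split; [exact: Jt|exact: nJ].
have := @Int_cocycle _ (J a c) (J a d) (J c d) t (closed_curve_symdiff hac)
  (closed_curve_symdiff had) (closed_curve_symdiff hcd)
  (@symdiff_closure_triangle _ a c d) (theta_connected hac had hcd)
  (nJ _ _ had ta td) (nJ _ _ hcd tc td) It.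
case=> It'; [left|right].
  by apply: (inner_point hab had hbd) It'; split; [exact: Jt|exact: nJ].
by apply: (inner_point (fellowC hbc) hcd hbd) It'; split; [exact: Jt|exact: nJ].
Qed.

End Triples.

Theorem theorem3 (R : realType) (Gamma : set (set (plane R)))
    (Gamma_line : forall gamma, Gamma gamma -> topological_line gamma)
    (Gamma_portion : forall gamma gamma', Gamma gamma -> Gamma gamma' ->
      gamma <> gamma' -> portion gamma (gamma `\` gamma')) :
  [/\ forall gamma gamma', Gamma gamma -> Gamma gamma' -> gamma <> gamma' ->
        jordan_curve (symdiff_closure gamma gamma'),
      exists lt : set (plane R) -> set (plane R) -> Prop,
        [/\ strict_total_order_on Gamma lt,
            induces_between Gamma lt
          & forall lt' : set (plane R) -> set (plane R) -> Prop,
              strict_total_order_on Gamma lt' ->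
              induces_between Gamma lt' ->
              (forall gamma gamma', Gamma gamma -> Gamma gamma' ->
                 (lt' gamma gamma' <-> lt gamma gamma')) \/
              (forall gamma gamma', Gamma gamma -> Gamma gamma' ->
                 (lt' gamma gamma' <-> lt gamma' gamma))]
    & forall gamma gamma' sigma,
        Gamma gamma -> Gamma gamma' -> Gamma sigma ->
        gamma <> gamma' -> gamma <> sigma -> gamma' <> sigma ->
        (~ between Gamma gamma gamma' sigma <->
         symdiff_closure gamma sigma `<=`
           closure (Ext (symdiff_closure gamma gamma')))].
Proof.
have fel g h : Gamma g -> Gamma h -> g <> h -> fellow g h.
  move=> gG hG gh; split; [exact: Gamma_line|exact: Gamma_line|by []| |].
    exact: Gamma_portion.
  by apply: Gamma_portion => //; exact: nesym.
have betwE g h k : Gamma g -> Gamma h -> Gamma k -> g <> h -> g <> k -> h <> k ->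
    between Gamma g h k <-> inner g h k.
  move=> gG hG kG gh gk hk.
  rewrite -(innerP k (fel _ _ gG hG gh)).
  by split=> [[]//|sub]; split => //; exact: nesym.
split.
- move=> g h gG hG gh; apply: closed_curve_jordan; apply: closed_curve_symdiff.
  exact: fel.
- pose X := {g : set (plane R) | Gamma g}.
  pose B (x y z : X) := [/\ x <> y, x <> z, y <> z & inner (sval x) (sval y) (sval z)].
  have vinj (x y : X) : x <> y -> sval x <> sval y.
    by move=> xy /eq_sig_hprop E; apply: xy; apply: E => ? ? ?; exact: Prop_irrelevance.
  have felX (x y : X) : x <> y -> fellow (sval x) (sval y).
    by move=> /vinj; apply: fel; exact: svalP.
  have [|||||lt [slt ind uni]] := @betweenness_order X B.
  + by move=> x y z [].
  + move=> x y z [xy xz yz i]; split => //; [exact: nesym|].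
    by apply: innerC => //; exact: felX.
  + move=> x y z xy xz yz; have [yx zx zy] := And3 (nesym xy) (nesym xz) (nesym yz).
    have [i|i|i] := inner_some (felX _ _ xz) (felX _ _ xy) (felX _ _ zy).
    * by apply: Or31; split.
    * by apply: Or32; split.
    * by apply: Or33; split.
  + move=> x y z [xy xz yz i] [_ _ _ i'].
    by apply: (inner_excl (felX _ _ xz) (felX _ _ xy) (felX _ _ (nesym yz)) i i').
  + move=> x y z w wx wy wz [xy xz yz i].
    have [h|h] := inner_split (felX _ _ xz) (felX _ _ xy) (felX _ _ (nesym wx))
      (felX _ _ (nesym yz)) (felX _ _ (nesym wz)) (felX _ _ (nesym wy)) i.
      by left; split => //; exact: nesym.
    by right; split => //; exact: nesym.
  have [irr tr tot] := slt.
  have XB (lt0 : set (plane R) -> set (plane R) -> Prop) : induces_between Gamma lt0 ->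
      forall x y z : X, x <> y -> x <> z -> y <> z ->
      B x y z <-> (lt0 (sval x) (sval z) /\ lt0 (sval z) (sval y)) \/
                  (lt0 (sval y) (sval z) /\ lt0 (sval z) (sval x)).
    move=> ind0 x y z xy xz yz.
    have [Gx Gy Gz] := And3 (svalP x) (svalP y) (svalP z).
    rewrite -(ind0 _ _ _ Gx Gy Gz (vinj _ _ xy) (vinj _ _ xz) (vinj _ _ yz)).
    rewrite (betwE _ _ _ Gx Gy Gz (vinj _ _ xy) (vinj _ _ xz) (vinj _ _ yz)).
    by rewrite /B; split=> [[]//|].
  pose ltG g h := exists (gG : Gamma g) (hG : Gamma h), lt (exist _ g gG) (exist _ h hG).
  have ltGE g h (gG : Gamma g) (hG : Gamma h) : ltG g h <-> lt (exist _ g gG) (exist _ h hG).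
    split=> [[gG' [hG']]|]; last by exists gG, hG.
    by rewrite (Prop_irrelevance gG' gG) (Prop_irrelevance hG' hG).
  have neX g h (gG : Gamma g) (hG : Gamma h) : g <> h ->
      exist _ g gG <> exist _ h hG :> X by move=> gh [].
  exists ltG; split.
  + split.
    * by move=> g gG; rewrite (ltGE _ _ gG gG); exact: irr.
    * move=> g h k gG hG kG; rewrite (ltGE _ _ gG hG) (ltGE _ _ hG kG) (ltGE _ _ gG kG).
      exact: tr.
    * move=> g h gG hG gh; rewrite (ltGE _ _ gG hG) (ltGE _ _ hG gG).
      by apply: tot => //; exact: neX.
  + move=> g h k gG hG kG gh gk hk; rewrite betwE //.
    rewrite (ltGE _ _ gG kG) (ltGE _ _ kG hG) (ltGE _ _ hG kG) (ltGE _ _ kG gG).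
    rewrite -ind; [|exact: neX|exact: neX|exact: neX].
    split=> [i|[]//]; split => //; exact: neX.
  + move=> lt' [irr' tr' tot'] ind'.
    have [||same|opp] := uni (fun x y => lt' (sval x) (sval y)).
    * split=> [x _|x y z _ _ _|x y _ _ xy]; first exact/irr'/svalP.
        by apply: tr'; exact: svalP.
      by apply: tot'; [exact: svalP|exact: svalP|exact: vinj].
    * exact: XB.
    * left=> g h gG hG; rewrite (ltGE _ _ gG hG).
      exact: (same (exist _ g gG) (exist _ h hG)).
    * right=> g h gG hG; rewrite (ltGE _ _ hG gG).
      exact: (opp (exist _ g gG) (exist _ h hG)).
- move=> g h k gG hG kG gh gk hk.
  rewrite (betwE _ _ _ gG hG kG gh gk hk).
  by rewrite (outerP (fel _ _ gG kG gk) (fel _ _ gG hG gh) (fel _ _ kG hG (nesym hk))).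
Qed.
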